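(* Consider either the Racah (R) or the $q$-Racah ($q$R) case, let $M\ge 1$ and let $\mathcal D=\{d_1<\cdots<d_M\}$ be a set of $M$ positive integers for which hypothesis (A) of the context holds. Let the parameters $(a,b,c,d)$ be generic (in particular $a$ is treated as an indeterminate, not specialized to $-N$ or $q^{-N}$). For any polynomial $Y(\eta)\neq0$ put $$X(\eta)=I_{\lambda+M\delta}\bigl[\Xi_{\mathcal D}Y\bigr](\eta),\qquad L=\deg X=\ell_{\mathcal D}+\deg Y+1,$$ where $(\Xi_{\mathcal D}Y)(\eta)=\Xi_{\mathcal D}(\eta;\lambda)Y(\eta)$. Then the multi-indexed ($q$-)Racah polynomials satisfy $1+2L$ term recurrence relations with constant coefficients: there exist constants $r^{X,\mathcal D}_{n,k}$ (independent of $\eta$) such that $$X(\eta)P_{\mathcal D,n}(\eta)=\sum_{k=-L}^{L}r^{X,\mathcal D}_{n,k}P_{\mathcal D,n+k}(\eta)\qquad(n\in\mathbb Z_{\ge0};\ \eta\in\mathbb C),$$ or equivalently, with $\check X(x)=X(\eta(x;\lambda+M\delta))$, $$\check X(x)\check P_{\mathcal D,n}(x)=\sum_{k=-L}^{L}r^{X,\mathcal D}_{n,k}\check P_{\mathcal D,n+k}(x)\qquad(n\in\mathbb Z_{\ge0};\ x\in\mathbb C),$$ where $P_{\mathcal D,m}=0$ for $m<0$.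
   Context: Notation. Two parallel cases, Racah (R) and $q$-Racah ($q$R, with fixed $0<q<1$). $(z)_k$ and $(z;q)_k$ are the (q-)shifted factorials and $(z_1,\dots,z_r)_k=\prod_i (z_i)_k$, $(z_1,\dots,z_r;q)_k=\prod_i(z_i;q)_k$. Parameters: $\lambda=(a,b,c,d)$ (R), $q^{\lambda}=(a,b,c,d)$ ($q$R), complex. With $\delta=(1,1,1,1)$, replacing $\lambda$ by $\lambda+\beta\delta$ means $(a,b,c,d)\to(a+\beta,b+\beta,c+\beta,d+\beta)$ (R), $(a,b,c,d)\to(aq^\beta,bq^\beta,cq^\beta,dq^\beta)$ ($q$R). ''Generic'' means outside a countable union of zero sets of nonzero polynomials in $(a,b,c,d)$ (in particular no denominator below vanishes and the degrees below are as stated). $\eta(x;\lambda)=x(x+d)$ (R), $(q^{-x}-1)(1-dq^x)$ ($q$R), $x\in\mathbb C$. $\tilde d=a+b+c-d-1$ (R), $abcd^{-1}q^{-1}$ ($q$R). ($q$-)Racah polynomials: $\check P_n(x;\lambda)=P_n(\eta(x;\lambda);\lambda)={}_4F_3\bigl(-n,n+\tilde d,-x,x+d;\,a,b,c;\,1\bigr)$ (R), ${}_4\phi_3\bigl(q^{-n},\tilde dq^n,q^{-x},dq^x;\,a,b,c;\,q;q\bigr)$ ($q$R). Energies: $\mathcal E_n=n(n+\tilde d)$ (R), $(q^{-n}-1)(1-\tilde dq^n)$ ($q$R). Virtual energies: $\tilde{\mathcal E}_{v}=-(c+v)(\tilde d-c-v)$ (R), $-(1-cq^{v})(1-c^{-1}\tilde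 dq^{-v})$ ($q$R). $\alpha=1$ (R), $abd^{-1}q^{-1}$ ($q$R). Twist: $\mathfrak t$ replaces $(a,b,c,d)$ by $(d-a+1,d-b+1,c,d)$ (R), $(dq/a,dq/b,c,d)$ ($q$R). $\check\xi_v(x;\lambda)=\check P_v(x;\mathfrak t(\lambda))$. $B'(x;\lambda)=-\frac{(x+d-a+1)(x+d-b+1)(x+c)(x+d)}{(2x+d)(2x+1+d)}$ (R), $-\frac{(1-a^{-1}dq^{x+1})(1-b^{-1}dq^{x+1})(1-cq^x)(1-dq^x)}{(1-dq^{2x})(1-dq^{2x+1})}$ ($q$R). $\varphi_m(x;\lambda)=\prod_{1\le j<k\le m}\frac{\eta(x+k-1;\lambda)-\eta(x+j-1;\lambda)}{\eta(k-j;\lambda)}$. Normalization constants: $\mathcal C_{\mathcal D}(\lambda)=\frac1{\varphi_M(0;\lambda)}\prod_{1\le j<k\le M}\frac{\tilde{\mathcal E}_{d_j}-\tilde{\mathcal E}_{d_k}}{\alpha B'(j-1;\lambda)}$, $\mathcal C_{\mathcal D,n}(\lambda)=(-1)^M\mathcal C_{\mathcal D}(\lambda)\frac{\varphi_M(0;\lambda)}{\varphi_{M+1}(0;\lambda)}\prod_{j=1}^M\frac{\mathcal E_n-\tilde{\mathcal E}_{d_j}}{\alpha B'(j-1;\lambda)}$. Denominator polynomial and multi-indexed polynomials: with $x_j=x+j-1$, $\check\Xi_{\mathcal D}(x;\lambda)=\Xi_{\mathcal D}(\eta(x;\lambda+(M-1)\delta);\lambda)=\mathcal C_{\mathcal D}(\lambda)^{-1}\varphi_M(x;\lambda)^{-1}\det\bigl(\check\xi_{d_k}(x_j;\lambda)\bigr)_{1\le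 j,k\le M}$, $\check P_{\mathcal D,n}(x;\lambda)=P_{\mathcal D,n}(\eta(x;\lambda+M\delta);\lambda)=\mathcal C_{\mathcal D,n}(\lambda)^{-1}\varphi_{M+1}(x;\lambda)^{-1}\det\bigl(\check\xi_{d_1}(x_j),\dots,\check\xi_{d_M}(x_j),\,r_j(x_j)\check P_n(x_j)\bigr)_{1\le j\le M+1}$ (the $j$-th row is displayed), where $r_j(x_j)=\frac{(x+a,x+b)_{j-1}(x+d-a+j,x+d-b+j)_{M+1-j}}{(d-a+1,d-b+1)_M}$ (R), $r_j(x_j)=\frac{(aq^x,bq^x;q)_{j-1}(a^{-1}dq^{x+j},b^{-1}dq^{x+j};q)_{M+1-j}}{(abd^{-1}q^{-1})^{j-1}q^{Mx}(a^{-1}dq,b^{-1}dq;q)_M}$ ($q$R). $\Xi_{\mathcal D}(\eta;\lambda)$ and $P_{\mathcal D,n}(\eta;\lambda)$ are polynomials in $\eta$ of degrees $\ell_{\mathcal D}$ and $\ell_{\mathcal D}+n$, $\ell_{\mathcal D}=\sum_jd_j-\frac12M(M-1)$, with value $1$ at $\eta=0$, and $\check P_{\mathcal D,0}(x;\lambda)=\check\Xi_{\mathcal D}(x;\lambda+\delta)$. Put $P_{\mathcal D,n}=0$ for $n<0$. Map $I_\lambda$: for a polynomial $p(\eta)$, $I_{\lambda}[p]=P$ is the unique polynomial with $P(0)=0$, $\deg P=\deg p+1$, and $\frac{P(\eta(x;\lambda))-P(\eta(x-1;\lambda))}{\eta(x;\lambda)-\eta(x-1;\lambda)}=p(\eta(x;\lambda-\delta))$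 identically in $x$. Hypothesis (A): for generic $(a,b,c,d)$, (i) all zeros of $\Xi_{\mathcal D}(\eta;\lambda)$ and all zeros of $\Xi_{\mathcal D}(\eta;\lambda+\delta)$ are simple; (ii) for every $n\ge1$, $P_{\mathcal D,0}(\eta;\lambda)$ and $P_{\mathcal D,n}(\eta;\lambda)$ have no common root. *)

(* Defs.v *)
From mathcomp Require Import all_boot all_order all_algebra.
From mathcomp Require Import complex.
From mathcomp Require mpoly.
(* The notations of mpoly clash with those of mathcomp-analysis. *)
Import (canonicals, coercions) mpoly.
From mathcomp Require Import boolp classical_sets reals exp trigo.

Set Implicit Arguments.
Unset Strict Implicit.
Unset Printing Implicit Defensive.

Import Order.TTheory GRing.Theory Num.Theory.
Local Open Scope ring_scope.
Local Open Scope complex_scope.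

(* The indices j, k of the products, rows and columns start at 0 here and at 1
   in the source formulas: j stands for j - 1, and x_j = x + j - 1 becomes
   x + j%:R. *)

(* The parameter q of the q-Racah case is carried by the constructor. *)
Inductive model (R : realType) : Type := Racah | qRacah of R.
Arguments Racah {R}.
Arguments qRacah {R} q.

Definition model_ok (R : realType) (m : model R) : bool :=
  match m with Racah => true | qRacah q => 0 < q < 1 end.

(* These are lambda (Racah) or q ^ lambda (q-Racah). *)
Record params (R : realType) := Params { pa : R[i]; pb : R[i]; pc : R[i]; pd : R[i] }.

Definition coords (R : realType) (l : params R) : 'I_4 -> R[i] :=
  tnth [tuple pa l; pb l; pc l; pd l].

(* P holds outside a countable union of zero sets of nonzero polynomials in
   (a, b, c, d). *)
Definition generically (R : realType) (P : params R -> Prop) : Prop :=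
  exists F : nat -> mpoly.mpoly 4 R[i],
    (forall i, F i != 0) /\
    (forall l : params R, (forall i, mpoly.meval (coords l) (F i) != 0) -> P l).

(* q ^ x = exp (x ln q) for complex x. *)
Definition qpow (R : realType) (q : R) (x : R[i]) : R[i] :=
  (q `^ complex.Re x)%:C *
  (cos (complex.Im x * ln q) +i* sin (complex.Im x * ln q)).

Definition poch (R : realType) (z : R[i]) (k : nat) : R[i] :=
  \prod_(i < k) (z + i%:R).

Definition qpoch (R : realType) (q : R) (z : R[i]) (k : nat) : R[i] :=
  \prod_(i < k) (1 - z * q%:C ^+ i).

(* lambda + s delta *)
Definition shift (R : realType) (m : model R) (l : params R) (s : int) : params R :=
  match m with
  | Racah => Params (pa l + s%:~R) (pb l + s%:~R) (pc l + s%:~R) (pd l + s%:~R)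
  | qRacah q => Params (pa l * q%:C ^ s) (pb l * q%:C ^ s)
                       (pc l * q%:C ^ s) (pd l * q%:C ^ s)
  end.

Definition eta (R : realType) (m : model R) (x : R[i]) (l : params R) : R[i] :=
  match m with
  | Racah => x * (x + pd l)
  | qRacah q => (qpow q (- x) - 1) * (1 - pd l * qpow q x)
  end.

Definition dtilde (R : realType) (m : model R) (l : params R) : R[i] :=
  match m with
  | Racah => pa l + pb l + pc l - pd l - 1
  | qRacah q => pa l * pb l * pc l * (pd l)^-1 * q%:C^-1
  end.

(* The 4F3 and 4phi3 series terminate at k = n because of their first upper
   parameter -n, resp. q ^ (-n). *)
Definition Pcheck (R : realType) (m : model R) (n : nat) (x : R[i]) (l : params R) : R[i] :=
  match m with
  | Racah =>
    \sum_(k < n.+1)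
      (poch (- n%:R) k * poch (n%:R + dtilde m l) k * poch (- x) k * poch (x + pd l) k)
      / (poch (pa l) k * poch (pb l) k * poch (pc l) k * k`!%:R)
  | qRacah q =>
    \sum_(k < n.+1)
      (qpoch q (q%:C ^- n) k * qpoch q (dtilde m l * q%:C ^+ n) k
       * qpoch q (qpow q (- x)) k * qpoch q (pd l * qpow q x) k)
      / (qpoch q (pa l) k * qpoch q (pb l) k * qpoch q (pc l) k * qpoch q q%:C k)
      * q%:C ^+ k
  end.

Definition energy (R : realType) (m : model R) (n : nat) (l : params R) : R[i] :=
  match m with
  | Racah => n%:R * (n%:R + dtilde m l)
  | qRacah q => (q%:C ^- n - 1) * (1 - dtilde m l * q%:C ^+ n)
  end.

Definition venergy (R : realType) (m : model R) (v : nat) (l : params R) : R[i] :=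
  match m with
  | Racah => - ((pc l + v%:R) * (dtilde m l - pc l - v%:R))
  | qRacah q => - ((1 - pc l * q%:C ^+ v) * (1 - (pc l)^-1 * dtilde m l * q%:C ^- v))
  end.

Definition alpha (R : realType) (m : model R) (l : params R) : R[i] :=
  match m with
  | Racah => 1
  | qRacah q => pa l * pb l * (pd l)^-1 * q%:C^-1
  end.

Definition twist (R : realType) (m : model R) (l : params R) : params R :=
  match m with
  | Racah => Params (pd l - pa l + 1) (pd l - pb l + 1) (pc l) (pd l)
  | qRacah q => Params (pd l * q%:C / pa l) (pd l * q%:C / pb l) (pc l) (pd l)
  end.

Definition xicheck (R : realType) (m : model R) (v : nat) (x : R[i]) (l : params R) : R[i] :=
  Pcheck m v x (twist m l).

Definition Bprime (R : realType) (m : model R) (x : R[i]) (l : params R) : R[i] :=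
  match m with
  | Racah =>
    - ((x + pd l - pa l + 1) * (x + pd l - pb l + 1) * (x + pc l) * (x + pd l)
       / ((2 * x + pd l) * (2 * x + 1 + pd l)))
  | qRacah q =>
    - ((1 - (pa l)^-1 * pd l * qpow q (x + 1)) * (1 - (pb l)^-1 * pd l * qpow q (x + 1))
       * (1 - pc l * qpow q x) * (1 - pd l * qpow q x)
       / ((1 - pd l * qpow q (2 * x)) * (1 - pd l * qpow q (2 * x + 1))))
  end.

Definition varphi (R : realType) (m : model R) (N : nat) (x : R[i]) (l : params R) : R[i] :=
  \prod_(k < N) \prod_(j < N | (j < k)%N)
    ((eta m (x + k%:R) l - eta m (x + j%:R) l) / eta m (k - j)%:R l).

Definition CD (R : realType) (m : model R) (M : nat) (D : M.-tuple nat) (l : params R) : R[i] :=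
  (varphi m M 0 l)^-1 *
  \prod_(k < M) \prod_(j < M | (j < k)%N)
    ((venergy m (tnth D j) l - venergy m (tnth D k) l)
     / (alpha m l * Bprime m j%:R l)).

Definition CDn (R : realType) (m : model R) (M : nat) (D : M.-tuple nat) (n : nat)
    (l : params R) : R[i] :=
  (-1) ^+ M * CD m D l * (varphi m M 0 l / varphi m M.+1 0 l) *
  \prod_(j < M)
    ((energy m n l - venergy m (tnth D j) l) / (alpha m l * Bprime m j%:R l)).

(* rfactor m M j x l is r_{j+1}(x_{j+1}) as a function of x. *)
Definition rfactor (R : realType) (m : model R) (M j : nat) (x : R[i]) (l : params R) : R[i] :=
  match m with
  | Racah =>
    (poch (x + pa l) j * poch (x + pb l) j
     * poch (x + pd l - pa l + j.+1%:R) (M - j) * poch (x + pd l - pb l + j.+1%:R) (M - j))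
    / (poch (pd l - pa l + 1) M * poch (pd l - pb l + 1) M)
  | qRacah q =>
    (qpoch q (pa l * qpow q x) j * qpoch q (pb l * qpow q x) j
     * qpoch q ((pa l)^-1 * pd l * qpow q (x + j.+1%:R)) (M - j)
     * qpoch q ((pb l)^-1 * pd l * qpow q (x + j.+1%:R)) (M - j))
    / ((pa l * pb l * (pd l)^-1 * q%:C^-1) ^+ j * qpow q (M%:R * x)
       * (qpoch q ((pa l)^-1 * pd l * q%:C) M * qpoch q ((pb l)^-1 * pd l * q%:C) M))
  end.

Definition Xi_det (R : realType) (m : model R) (M : nat) (D : M.-tuple nat)
    (x : R[i]) (l : params R) : R[i] :=
  (CD m D l)^-1 * (varphi m M x l)^-1 *
  \det (\matrix_(j < M, k < M) xicheck m (tnth D k) (x + j%:R) l).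

(* The last column (k = M, where unlift returns None) is r_j(x_j) P_n(x_j). *)
Definition PD_det (R : realType) (m : model R) (M : nat) (D : M.-tuple nat) (n : nat)
    (x : R[i]) (l : params R) : R[i] :=
  (CDn m D n l)^-1 * (varphi m M.+1 x l)^-1 *
  \det (\matrix_(j < M.+1, k < M.+1)
          if unlift ord_max k is Some k' then xicheck m (tnth D k') (x + j%:R) l
          else rfactor m M j x l * Pcheck m n (x + j%:R) l).

(* The determinantal formulas are identities of meromorphic functions of x; they
   are imposed at the points where varphi does not vanish. For generic parameters
   eta takes infinitely many values at such points, so they determine the
   polynomial. When no polynomial satisfies the formula, xget returns 0. *)
Definition Xi (R : realType) (m : model R) (M : nat) (D : M.-tuple nat)
    (l : params R) : {poly R[i]} :=
  xget 0 [set p : {poly R[i]} | forall x : R[i], varphi m M x l != 0 ->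
            p.[eta m x (shift m l (M%:Z - 1))] = Xi_det m D x l].

Definition PD (R : realType) (m : model R) (M : nat) (D : M.-tuple nat) (n : nat)
    (l : params R) : {poly R[i]} :=
  xget 0 [set p : {poly R[i]} | forall x : R[i], varphi m M.+1 x l != 0 ->
            p.[eta m x (shift m l M%:Z)] = PD_det m D n x l].

Definition PDz (R : realType) (m : model R) (M : nat) (D : M.-tuple nat) (n : int)
    (l : params R) : {poly R[i]} :=
  match n with Posz n' => PD m D n' l | Negz _ => 0 end.

Definition PDcheck (R : realType) (m : model R) (M : nat) (D : M.-tuple nat) (n : int)
    (x : R[i]) (l : params R) : R[i] :=
  (PDz m D n l).[eta m x (shift m l M%:Z)].

(* The natural subtraction is exact when D consists of distinct positive
   integers. *)
Definition ellD (M : nat) (D : M.-tuple nat) : nat :=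
  ((\sum_(j < M) tnth D j) - 'C(M, 2))%N.

(* The map I_lambda; the size condition is deg P = deg p + 1 for p != 0. *)
Definition Imap (R : realType) (m : model R) (l : params R) (p : {poly R[i]}) : {poly R[i]} :=
  xget 0 [set P : {poly R[i]} |
    [/\ P.[0] = 0,
        size P = (size p).+1 &
        forall x : R[i], eta m x l - eta m (x - 1) l != 0 ->
          (P.[eta m x l] - P.[eta m (x - 1) l]) / (eta m x l - eta m (x - 1) l)
          = p.[eta m x (shift m l (- 1))]]].

Definition simple_zeros (R : realType) (p : {poly R[i]}) : Prop :=
  forall z, root p z -> mup z p = 1%N.

Definition no_common_root (R : realType) (p p' : {poly R[i]}) : Prop :=
  forall z, ~ (root p z /\ root p' z).

Definition hypA (R : realType) (m : model R) (M : nat) (D : M.-tuple nat) : Prop :=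
  generically (fun l : params R =>
    [/\ simple_zeros (Xi m D l),
        simple_zeros (Xi m D (shift m l 1)) &
        forall n : nat, (1 <= n)%N -> no_common_root (PD m D 0 l) (PD m D n l)]).

(* Main.v *)
(* In the lattice variable both families take the same form. The quotient of a
   Casoratian by the Vandermonde product of the sinusoidal coordinate is a regular
   function invariant under the reflection of the lattice, hence a polynomial in
   that coordinate; divided differences give its degree.

   If the difference of X is divisible by Xi, then X times the Casoratian of the
   seed functions and r_j P_n is the Casoratian of the seed functions and r_j q for
   some polynomial q, so X P_{D,n} is a combination of the P_{D,j} with
   j <= n + L.

   For i <> j the Darboux identity writes P_{D,i} P_{D,j} as the image of a regular
   function under a first-order difference operator. If P_{D,m} with m < n - L
   occurred in X P_{D,n}, then expanding X P_{D,n} P_{D,m} in two ways would put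
   P_{D,m}^2 in that image, hence P_{D,m} P_{D,0} Z for every Z whose difference is
   divisible by Xi. Taking Z divisible by Xi(x) Xi(x + 1), the preimages become
   divisible too, so all multiples of P_{D,m} P_{D,0} are images under a reduced
   operator; shifting the parameters produces such a polynomial of smaller and
   smaller degree, which is absurd. *)

Require Import Defs.
From mathcomp Require Import all_boot all_order all_algebra.
From mathcomp Require Import complex reals.
From mathcomp Require Import all_fingroup ring zify.
From mathcomp Require mpoly boolp.
Import (canonicals, coercions) mpoly.
From mathcomp Require Import classical_sets exp trigo.

Set Implicit Arguments.
Unset Strict Implicit.
Unset Printing Implicit Defensive.

Import Order.TTheory GRing.Theory Num.Theory.
Local Open Scope ring_scope.
Local Open Scope complex_scope.

(** * The lattice *)

(** The familiar way to bound the indices from below is orthogonality: a linear functional that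
    kills P_i P_j for i <> j but not P_m ^ 2. With [a] an indeterminate there is no finite weight
    that would define one. The null polynomials ([null_poly]), an image of a difference operator,
    stand in for the kernel of that functional, and [nondegenerate] for the nonvanishing of the
    norms. The only boundary of the lattice that enters is x = 0, where the backward coefficient of
    the reduced operator vanishes; this makes that operator injective on regular functions. Degrees
    have to be known exactly, so many leading coefficients have to be nonzero. The variable u makes
    the Racah and q-Racah cases obey the same rational identities, and it makes the points a group.
    Each nonvanishing condition then says that two group elements i a + j b + k c + l d + n are
    distinct, which for generic parameters is integer arithmetic. *)

(* With r = 1 and k = 1 the variable u is x; with r = 1 / q and k = (r - 1) ^ 2
   it is (r ^ x - 1) / (r - 1), and [lwt u] is r ^ x. A point u matters only when
   [lwt u] is nonzero. The sinusoidal coordinate with parameter point e is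
   [leta e u], its other solution in u is [lrefl e u], and x -> x + 1 is [lshift].
   A parameter alpha is the point u with x = - alpha, resp. r ^ x = alpha, so
   lambda -> lambda + delta applies [lshift_inv]. *)
Record lattice (K : fieldType) := Lattice {
  lr : K; lk : K;
  lr_neq0 : lr != 0;
  lk_neq0 : lk != 0;
  l2_neq0 : 2 != 0 :> K;
  lnu_neq0 : forall n, \sum_(i < n.+1) lr ^+ i != 0 }.

Section Lattice.
Variables (K : fieldType) (T : lattice K).
Local Notation r := (lr T).
Local Notation k := (lk T).

(** The r-analogue of n, which is also the lattice point of x = n ([shn0]). That it is nonzero for n
    > 0 makes the orbits of [lshift] infinite. *)
Definition lnum n : K := \sum_(i < n) r ^+ i.
Definition lwt (u : K) := 1 + (r - 1) * u.
Definition lshift (u : K) := r * u + 1.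
Definition lshift_inv (u : K) := (u - 1) / r.
Definition leta (e u : K) := k * (u * (u - e)) / lwt u.
Definition lrefl (e u : K) := (e - u) / lwt u.
Definition lwidth (e u : K) := u - lrefl e u.

Let r0 : r != 0 := lr_neq0 T.

Lemma nu_neq0 n : (0 < n)%N -> lnum n != 0.
Proof. by case: n => // n _; apply: lnu_neq0. Qed.

Lemma nuS n : lnum n.+1 = lnum n + r ^+ n.
Proof. by rewrite /lnum big_ord_recr. Qed.

Lemma nu0 : lnum 0 = 0. Proof. by rewrite /lnum big_ord0. Qed.

Lemma nu1 : lnum 1 = 1. Proof. by rewrite nuS nu0 add0r. Qed.

Lemma expE n : r ^+ n = 1 + (r - 1) * lnum n.
Proof.
elim: n => [|n IH]; first by rewrite nu0 mulr0 addr0.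
by rewrite nuS mulrDr addrA -IH exprS; ring.
Qed.

Lemma nuSl n : lnum n.+1 = 1 + r * lnum n.
Proof. by rewrite nuS expE; ring. Qed.

Lemma wt_nu n : lwt (lnum n) = r ^+ n. Proof. by rewrite /lwt expE. Qed.

Lemma wt0 : lwt 0 = 1. Proof. by rewrite /lwt mulr0 addr0. Qed.

Lemma wt_sh u : lwt (lshift u) = r * lwt u. Proof. by rewrite /lwt /lshift; ring. Qed.

Lemma shK : cancel lshift lshift_inv. Proof. by move=> u; rewrite /lshift /lshift_inv; field. Qed.
Lemma hsK : cancel lshift_inv lshift. Proof. by move=> u; rewrite /lshift /lshift_inv; field. Qed.

Lemma wt_hs u : lwt (lshift_inv u) = lwt u / r.
Proof. by rewrite -{2}(hsK u) wt_sh; field. Qed.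

Lemma wt_sh0 u : (lwt (lshift u) != 0) = (lwt u != 0).
Proof. by rewrite wt_sh mulf_eq0 (negbTE r0). Qed.
Lemma wt_hs0 u : (lwt (lshift_inv u) != 0) = (lwt u != 0).
Proof. by rewrite -{2}(hsK u) wt_sh0. Qed.
Lemma wt_shn0 n u : (lwt (iter n lshift u) != 0) = (lwt u != 0).
Proof. by elim: n => //= n <-; rewrite wt_sh0. Qed.
Lemma wt_hsn0 n u : (lwt (iter n lshift_inv u) != 0) = (lwt u != 0).
Proof. by elim: n => //= n <-; rewrite wt_hs0. Qed.

Lemma shnE n u : iter n lshift u = u + lnum n * lwt u.
Proof.
elim: n => [|n IH] /=; first by rewrite nu0 mul0r addr0.
by rewrite IH nuSl /lshift /lwt; ring.
Qed.

Lemma shn0 n : iter n lshift 0 = lnum n.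
Proof. by rewrite shnE wt0 add0r mulr1. Qed.

Lemma wt_shn n u : lwt (iter n lshift u) = r ^+ n * lwt u.
Proof. by elim: n => [|n IH] /=; rewrite ?mul1r // wt_sh IH exprS mulrA. Qed.
Lemma wt_hsn n u : lwt (iter n lshift_inv u) = lwt u / r ^+ n.
Proof.
elim: n => [|n IH] /=; first by rewrite divr1.
by rewrite wt_hs IH exprS; field; rewrite ?expf_neq0 // r0.
Qed.

Lemma hsnK n : cancel (iter n lshift_inv) (iter n lshift).
Proof. by elim: n => // n IH u; rewrite iterSr iterS hsK IH. Qed.
Lemma shnK n : cancel (iter n lshift) (iter n lshift_inv).
Proof. by elim: n => // n IH u; rewrite iterSr iterS shK IH. Qed.

Lemma shn_inj u i j : lwt u != 0 -> iter i lshift u = iter j lshift u -> i = j.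
Proof.
move=> wu; wlog: i j / (i <= j)%N => [H|ij E].
  by case: (leqP i j) => [/H//|/ltnW /H h E]; rewrite h.
apply/eqP; rewrite eqn_leq ij leqNgt; apply/negP => lt.
move: E; rewrite -(subnKC ij) iterD; set m := (j - i)%N => E.
have m0 : (0 < m)%N by rewrite subn_gt0.
have := can_inj (shnK i) E; rewrite shnE => /esym/eqP.
by rewrite addrC -subr_eq0 addrK mulf_eq0 (negbTE wu) (negbTE (nu_neq0 m0)).
Qed.

Lemma wtE u : (1 + (r - 1) * u != 0) = (lwt u != 0). Proof. by []. Qed.

Lemma et_diff e u : lwt u != 0 -> leta e (lshift u) - leta e u = k * lwidth (lshift_inv e) u.
Proof.
move=> wu; rewrite /leta /lwidth /lrefl wt_sh; move: wu; rewrite /lwt /lshift /lshift_inv => wu.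
by field; rewrite wu r0.
Qed.

(** The reflection at [lshift_inv e] exchanges [leta e (lshift u)] and [leta e u], so their
    symmetric functions are polynomials in [leta (lshift_inv e) u]. Together with [et_prod] this
    yields all of them. *)
Lemma et_sum e u : lwt u != 0 ->
  leta e (lshift u) + leta e u = (1 + r) * leta (lshift_inv e) u + leta e 1.
Proof.
move=> wu; have -> : leta e 1 = k * (1 - e) / r.
  by rewrite /leta /lwt; field; rewrite ?r0 // addrC subrK.
rewrite /leta wt_sh; move: wu; rewrite /lwt /lshift /lshift_inv => wu.
by field; rewrite wu r0.
Qed.

Lemma et_prod e u : lwt u != 0 ->
  leta e (lshift u) * leta e u = r * leta (lshift_inv e) u ^+ 2 - k * e * leta (lshift_inv e) u.
Proof.
move=> wu; rewrite /leta wt_sh; move: wu; rewrite /lwt /lshift /lshift_inv => wu.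
by field; rewrite wu r0.
Qed.

(** In the Racah case this is (x + 1)(x + 1 + d) = x (x + d + 2) + d + 1: a step of the argument is
    traded for two steps of the parameter and an affine change of the coordinate. *)
Lemma et_shE e u : lwt u != 0 -> leta e (lshift u) = r * leta (lshift_inv (lshift_inv e)) u + leta e 1.
Proof.
move=> wu; have -> : leta e 1 = k * (1 - e) / r.
  by rewrite /leta /lwt; field; rewrite ?r0 // addrC subrK.
rewrite /leta wt_sh; move: wu; rewrite /lwt /lshift /lshift_inv => wu.
by field; rewrite wu r0.
Qed.

Lemma dl_sh e u : lwt u != 0 -> lwidth e (lshift u) = r * lwidth (lshift_inv (lshift_inv e)) u.
Proof.
move=> wu; rewrite /lwidth /lrefl wt_sh; move: wu; rewrite /lwt /lshift /lshift_inv => wu.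
by field; rewrite wu r0.
Qed.

Lemma hsnE n e : iter n lshift_inv e = (e - lnum n) / r ^+ n.
Proof.
apply: (can_inj (shnK n)); rewrite hsnK shnE /lwt.
have rn : r ^+ n != 0 by rewrite expf_neq0.
rewrite expE in rn *; by field.
Qed.

Lemma et_diffn n e u : lwt u != 0 ->
  leta e (iter n lshift u) - leta e u = lnum n * (k * lwidth (iter n lshift_inv e) u).
Proof.
move=> wu; rewrite hsnE /lwidth /lrefl /leta wt_shn shnE.
have rn : r ^+ n != 0 by rewrite expf_neq0.
rewrite expE in rn *; move: wu; rewrite /lwt => wu; by field; rewrite rn wu.
Qed.

Lemma ioK e u : lwt e != 0 -> lwt u != 0 -> lrefl e (lrefl e u) = u.
Proof.
move=> we wu; rewrite /lrefl.
have -> : lwt ((e - u) / lwt u) = lwt e / lwt u by move: wu; rewrite /lwt => wu; field.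
by move: we wu; rewrite /lwt => we wu; field; rewrite wu we.
Qed.

Lemma wt_io e u : lwt u != 0 -> lwt (lrefl e u) = lwt e / lwt u.
Proof. by rewrite /lrefl /lwt => wu; field. Qed.

Lemma wt_io0 e u : lwt e != 0 -> lwt u != 0 -> lwt (lrefl e u) != 0.
Proof. by move=> we wu; rewrite wt_io // mulf_neq0 ?invr_eq0. Qed.

Lemma et_io e u : lwt e != 0 -> lwt u != 0 -> leta e (lrefl e u) = leta e u.
Proof.
move=> we wu; rewrite /leta wt_io // /lrefl.
by move: we wu; rewrite /lwt => we wu; field; rewrite wu we.
Qed.

Lemma dl_io e u : lwt e != 0 -> lwt u != 0 -> lwidth e (lrefl e u) = - lwidth e u.
Proof. by move=> we wu; rewrite /lwidth ioK // opprB. Qed.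

Lemma sh_io e u : lwt u != 0 -> lshift (lrefl (lshift_inv e) u) = lrefl e u.
Proof. by rewrite /lshift /lrefl /lshift_inv /lwt => wu; field; rewrite wu r0. Qed.

Lemma io_sh e u : lwt u != 0 -> lrefl e (lshift u) = lrefl (lshift_inv e) u.
Proof.
move=> wu; rewrite /lrefl wt_sh; move: wu; rewrite /lshift /lshift_inv /lwt => wu; field.
by rewrite wu r0.
Qed.

Lemma io_shn n e u : lwt u != 0 -> lrefl e (iter n lshift u) = lrefl (iter n lshift_inv e) u.
Proof.
by move=> wu; elim: n e => // n IH e; rewrite iterS io_sh ?wt_shn0 // IH iterSr.
Qed.

Lemma shn_io n e u : lwt u != 0 -> iter n lshift (lrefl (iter n lshift_inv e) u) = lrefl e u.
Proof. by move=> wu; elim: n e => // n IH e; rewrite iterSr iterS sh_io // IH. Qed.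

(** Up to the reflection at e, the reflection at the n-th level reverses the orbit segment from u to
    its n-th shift. This is the symmetry of Casoratians and of gauge factors. *)
Lemma shn_io_rev j n e u : lwt u != 0 -> (j <= n)%N ->
  iter j lshift (lrefl (iter n lshift_inv e) u) = lrefl e (iter (n - j) lshift u).
Proof.
by move=> wu jn; rewrite -{1}(subnKC jn) iterD shn_io // io_shn.
Qed.

Lemma add_io e u : lwt u != 0 -> u + lrefl e u = (r - 1) * (leta e u / k) + e.
Proof.
move=> wu; rewrite /lrefl /leta; move: wu (lk_neq0 T); rewrite /lwt => wu k0; field.
by rewrite wu k0.
Qed.

Lemma mul_io e u : lwt u != 0 -> u * lrefl e u = - (leta e u / k).
Proof.
move=> wu; rewrite /lrefl /leta; move: wu (lk_neq0 T); rewrite /lwt => wu k0; field.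
by rewrite wu k0.
Qed.

(** The roots of this quadratic are u and its reflection. Hence 1 and u generate the regular
    functions as a module over the polynomials in the coordinate ([reg_dec]). *)
Lemma sqr_uE e u : lwt u != 0 ->
  u ^+ 2 = ((r - 1) * (leta e u / k) + e) * u + leta e u / k.
Proof. by move=> wu; rewrite -add_io // -[leta e u / k]opprK -mul_io //; ring. Qed.

Lemma inv_wtE e u : lwt e != 0 -> lwt u != 0 ->
  (lwt u)^-1 = (1 + (r - 1) * ((r - 1) * (leta e u / k) + e - u)) / lwt e.
Proof.
move=> we wu; rewrite -add_io // [u + _]addrC addrK -/(lwt _) wt_io //.
by rewrite mulrAC mulfV // mul1r.
Qed.

Lemma dl_sqr e u : lwt u != 0 ->
  lwidth e u ^+ 2 = ((r - 1) * (leta e u / k) + e) ^+ 2 + 4 * (leta e u / k).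
Proof. by move=> wu; rewrite -add_io // -[leta e u / k]opprK -mul_io // /lwidth; ring. Qed.

End Lattice.

Definition horner_simpl := (hornerD, hornerN, hornerM, hornerZ, hornerC, hornerX, hornerXn, horner_exp, horner0).

(** * Regular functions on the lattice *)

Section Regular.
Variables (K : closedFieldType) (T : lattice K).
Local Notation r := (lr T).
Local Notation k := (lk T).
Local Notation wt := (lwt T).
Local Notation sh := (lshift T).
Local Notation hs := (lshift_inv T).
Local Notation et := (leta T).
Local Notation io := (lrefl T).
Local Notation dl := (lwidth T).

(** Polynomials in x when r = 1, Laurent polynomials in r ^ x otherwise. Points of weight zero
    correspond to no x, so equality is only asked for elsewhere ([eq_valid]). *)
Definition regular_fun (f : K -> K) : Prop :=
  exists p : {poly K}, exists n, forall u, wt u != 0 -> f u = p.[u] / wt u ^+ n.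

Definition eq_valid (f g : K -> K) : Prop := forall u, wt u != 0 -> f u = g u.

Lemma reg_ext f g : eq_valid f g -> regular_fun g -> regular_fun f.
Proof. by move=> fg [p [n pn]]; exists p, n => u wu; rewrite fg // pn. Qed.

Lemma regC c : regular_fun (fun=> c).
Proof. by exists c%:P, 0%N => u _; rewrite hornerC divr1. Qed.

Lemma reg_id : regular_fun id.
Proof. by exists 'X, 0%N => u _; rewrite hornerX divr1. Qed.

Lemma reg_iwt : regular_fun (fun u => (wt u)^-1).
Proof. by exists 1, 1%N => u _; rewrite hornerC div1r. Qed.

Definition wp : {poly K} := 1 + (r - 1) *: 'X.

Lemma wpE u : wp.[u] = wt u.
Proof. by rewrite /wp !horner_simpl. Qed.

Lemma regD f g : regular_fun f -> regular_fun g -> regular_fun (fun u => f u + g u).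
Proof.
move=> [p [n pE]] [q [m qE]]; exists (p * wp ^+ m + q * wp ^+ n), (n + m)%N.
move=> u wu; rewrite pE // qE // hornerD !hornerM !horner_exp !wpE exprD.
by field; rewrite !expf_neq0.
Qed.

Lemma regM f g : regular_fun f -> regular_fun g -> regular_fun (fun u => f u * g u).
Proof.
move=> [p [n pE]] [q [m qE]]; exists (p * q), (n + m)%N.
by move=> u wu; rewrite pE // qE // hornerM exprD invfM mulrACA.
Qed.

Lemma regN f : regular_fun f -> regular_fun (fun u => - f u).
Proof.
move=> fr; apply: (reg_ext (g := fun u => -1 * f u)) => [u _|].
  by rewrite mulN1r.
by apply: regM => //; apply: regC.
Qed.

Lemma regB f g : regular_fun f -> regular_fun g -> regular_fun (fun u => f u - g u).
Proof. by move=> fr gr; apply: regD => //; apply: regN. Qed.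

Lemma regMc c f : regular_fun f -> regular_fun (fun u => c * f u).
Proof. by move=> fr; apply: regM => //; apply: regC. Qed.

Lemma regX f n : regular_fun f -> regular_fun (fun u => f u ^+ n).
Proof.
move=> fr; elim: n => [|n IH]; first exact: (regC 1).
apply: (reg_ext (g := fun u => f u * f u ^+ n)); last exact: regM.
by move=> u _; rewrite exprS.
Qed.

Lemma reg_sum (I : Type) (s : seq I) (P : pred I) (F : I -> K -> K) :
  (forall i, P i -> regular_fun (F i)) -> regular_fun (fun u => \sum_(i <- s | P i) F i u).
Proof.
move=> FR; elim: s => [|i s IH].
  by apply: (reg_ext (g := fun=> 0)); [move=> u _; rewrite big_nil | apply: regC].
case Pi: (P i).
  apply: (reg_ext (g := fun u => F i u + \sum_(j <- s | P j) F j u)).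
    by move=> u _; rewrite big_cons Pi.
  by apply: regD => //; apply: FR.
by apply: (reg_ext (g := fun u => \sum_(j <- s | P j) F j u)) => // u _; rewrite big_cons Pi.
Qed.

Lemma reg_prod (I : Type) (s : seq I) (P : pred I) (F : I -> K -> K) :
  (forall i, P i -> regular_fun (F i)) -> regular_fun (fun u => \prod_(i <- s | P i) F i u).
Proof.
move=> FR; elim: s => [|i s IH].
  by apply: (reg_ext (g := fun=> 1)); [move=> u _; rewrite big_nil | apply: regC].
case Pi: (P i).
  apply: (reg_ext (g := fun u => F i u * \prod_(j <- s | P j) F j u)).
    by move=> u _; rewrite big_cons Pi.
  by apply: regM => //; apply: FR.
by apply: (reg_ext (g := fun u => \prod_(j <- s | P j) F j u)) => // u _; rewrite big_cons Pi.
Qed.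

Lemma reg_det n (F : 'I_n -> 'I_n -> K -> K) :
  (forall i j, regular_fun (F i j)) -> regular_fun (fun u => \det (\matrix_(i, j) F i j u)).
Proof.
move=> FR; rewrite /determinant; apply: reg_sum => s _; apply: regMc.
apply: reg_prod => i _; apply: reg_ext (FR i (s i)) => u _.
by rewrite mxE.
Qed.

Lemma reg_poly p f : regular_fun f -> regular_fun (fun u => p.[f u]).
Proof.
move=> fr; apply: (reg_ext (g := fun u => \sum_(i < size p) p`_i * f u ^+ i)).
  by move=> u _; rewrite horner_coef.
by apply: reg_sum => i _; apply: regMc; apply: regX.
Qed.

Lemma reg_comp f g h : regular_fun f -> regular_fun g -> regular_fun h ->
  (forall u, wt u != 0 -> wt (g u) != 0 /\ (wt (g u))^-1 = h u) ->
  regular_fun (fun u => f (g u)).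
Proof.
move=> [p [n pE]] gr hr E; apply: (reg_ext (g := fun u => p.[g u] * h u ^+ n)).
  by move=> u wu; have [w1 <-] := E u wu; rewrite pE // exprVn.
by apply: regM; [apply: reg_poly | apply: regX].
Qed.

Lemma reg_sh f : regular_fun f -> regular_fun (fun u => f (sh u)).
Proof.
move=> fr; apply: (reg_comp (h := fun u => r^-1 * (wt u)^-1)) => //.
- by apply: regD (regC _); apply: regMc; apply: reg_id.
- by apply: regMc; apply: reg_iwt.
by move=> u wu; rewrite wt_sh0; split => //; rewrite wt_sh invfM.
Qed.

Lemma reg_hs f : regular_fun f -> regular_fun (fun u => f (hs u)).
Proof.
move=> fr; apply: (reg_comp (h := fun u => r * (wt u)^-1)) => //.
- by apply: regM (regC _); apply: regB (regC _); apply: reg_id.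
- by apply: regMc; apply: reg_iwt.
by move=> u wu; rewrite wt_hs0; split => //; rewrite wt_hs invfM invrK mulrC.
Qed.

Lemma reg_shn n f : regular_fun f -> regular_fun (fun u => f (iter n sh u)).
Proof.
elim: n f => // n IH f fr; apply: (reg_ext (g := fun u => f (iter n sh (sh u)))).
  by move=> u _; rewrite iterSr.
exact: (reg_sh (IH _ fr)).
Qed.

Lemma reg_hsn n f : regular_fun f -> regular_fun (fun u => f (iter n hs u)).
Proof.
elim: n f => // n IH f fr; apply: (reg_ext (g := fun u => f (iter n hs (hs u)))).
  by move=> u _; rewrite iterSr.
exact: (reg_hs (IH _ fr)).
Qed.

Lemma reg_ioid e : regular_fun (io e).
Proof.
apply: regM reg_iwt; apply: regB reg_id; exact: regC.
Qed.

Lemma reg_io e f : wt e != 0 -> regular_fun f -> regular_fun (fun u => f (io e u)).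
Proof.
move=> we fr; apply: (reg_comp (h := fun u => wt u * (wt e)^-1)) => //.
- exact: reg_ioid.
- apply: regM (regC _); apply: regD (regC _) _; apply: regMc; exact: reg_id.
by move=> u wu; rewrite wt_io0 //; split => //; rewrite wt_io // invf_div.
Qed.

Lemma reg_et e : regular_fun (et e).
Proof.
apply: regM reg_iwt; apply: regMc; apply: regM reg_id _; apply: regB reg_id _.
exact: regC.
Qed.

Lemma reg_dl e : regular_fun (dl e).
Proof. exact: regB reg_id (reg_ioid e). Qed.

Lemma reg_pet p e : regular_fun (fun u => p.[et e u]).
Proof. by apply: reg_poly; apply: reg_et. Qed.

Definition nonzero_fun (f : K -> K) := exists2 u, wt u != 0 & f u != 0.

Lemma poly_inf0 (p : {poly K}) u : wt u != 0 ->
  (forall n, p.[iter n sh u] = 0) -> p = 0.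
Proof.
move=> wu z; apply/eqP; apply/negPn/negP => p0.
have := @max_poly_roots _ p [seq iter i sh u | i <- iota 0 (size p)] p0.
rewrite size_map size_iota ltnn => H; suff : false by [].
apply: H; first by apply/allP => x /mapP [i _ ->]; apply/rootP; exact: z.
rewrite map_inj_in_uniq ?iota_uniq // => i j _ _; exact: shn_inj.
Qed.

Lemma reg_orbit0 f u : regular_fun f -> wt u != 0 ->
  (forall n, f (iter n sh u) = 0) -> eq_valid f (fun=> 0).
Proof.
move=> [p [m pE]] wu z v wv; rewrite pE // (@poly_inf0 p u) ?horner0 ?mul0r //.
move=> n; have := z n; rewrite pE ?wt_shn0 // => /eqP.
by rewrite mulf_eq0 invr_eq0 expf_eq0 (negbTE (_ : wt (iter n sh u) != 0)) ?wt_shn0 // andbF orbF => /eqP.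
Qed.

Lemma reg_zero f : regular_fun f -> eq_valid f (fun=> 0) \/ nonzero_fun f.
Proof.
move=> fr; have [p [m pE]] := fr; have w0 : wt 0 != 0 by rewrite wt0 oner_neq0.
case: (eqVneq p 0) pE => [->|p0] pE.
  by left => u wu; rewrite pE // horner0 mul0r.
right; pose s := [seq iter i sh 0 | i <- iota 0 (size p)].
have [/allP A|/allPn [x /mapP [i _ ->]] nr] := boolP (all (root p) s).
  have := @max_poly_roots _ p s p0; rewrite size_map size_iota ltnn => H.
  suff : false by []. apply: H; first exact/allP.
  rewrite map_inj_in_uniq ?iota_uniq // => i' j' _ _; exact: shn_inj.
exists (iter i sh 0); first by rewrite wt_shn0.
rewrite pE ?wt_shn0 // mulf_neq0 // invr_neq0 // expf_neq0 //.
by rewrite wt_shn0.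
Qed.

Lemma nz_poly f p m : eq_valid f (fun u => p.[u] / wt u ^+ m) -> nonzero_fun f -> p != 0.
Proof.
move=> pE [u wu]; apply: contraNneq => p0; by rewrite pE // p0 horner0 mul0r.
Qed.

Lemma nzM f g : regular_fun f -> regular_fun g -> nonzero_fun f -> nonzero_fun g -> nonzero_fun (fun u => f u * g u).
Proof.
move=> fr gr nf ng; have [|//] := reg_zero (regM fr gr).
have [p [n pE]] := fr; have [q [m qE]] := gr => E.
have p0 := nz_poly pE nf; have q0 := nz_poly qE ng.
suff : p * q == 0 by rewrite mulf_eq0 (negbTE p0) (negbTE q0).
have w0 : wt 0 != 0 by rewrite wt0 oner_neq0.
apply/eqP; apply: (poly_inf0 w0) => i; set v := iter i sh 0.
have wv : wt v != 0 by rewrite wt_shn0.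
have /eqP := E v wv; rewrite pE // qE // hornerM.
rewrite !mulf_eq0 !invr_eq0 !expf_eq0 (negbTE wv) !andbF !orbF -mulf_eq0.
by move/eqP.
Qed.

Lemma reg_cancel f g : regular_fun f -> regular_fun g -> nonzero_fun g ->
  (forall u, wt u != 0 -> g u != 0 -> f u = 0) -> eq_valid f (fun=> 0).
Proof.
move=> fr gr ng H; have [//|nf] := reg_zero fr.
have [u wu] := nzM fr gr nf ng; rewrite mulf_eq0 negb_or => /andP [fu gu].
by rewrite H // eqxx in fu.
Qed.

(** Regular functions form a domain because orbits are infinite. An identity may therefore be
    checked away from the zeros of a nonzero regular function, which justifies each cancellation of
    a denominator below. *)
Lemma reg_eq_on f1 f2 g : regular_fun f1 -> regular_fun f2 -> regular_fun g -> nonzero_fun g ->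
  (forall u, wt u != 0 -> g u != 0 -> f1 u = f2 u) -> eq_valid f1 f2.
Proof.
move=> r1 r2 gr ng H u wu; apply/eqP; rewrite -subr_eq0; apply/eqP.
apply: (reg_cancel (regB r1 r2) gr ng) => // v wv gv.
by rewrite /= H // subrr.
Qed.

Lemma nz_prod (I : Type) (s : seq I) (P : pred I) (F : I -> K -> K) :
  (forall i, P i -> regular_fun (F i)) -> (forall i, P i -> nonzero_fun (F i)) ->
  nonzero_fun (fun u => \prod_(i <- s | P i) F i u).
Proof.
move=> FR FN; elim: s => [|i s IH].
  by exists 0; rewrite ?wt0 ?big_nil oner_neq0.
case Pi: (P i); last first.
  by have [u wu lnum] := IH; exists u => //; rewrite big_cons Pi.
have [u wu lnum] := nzM (FR _ Pi) (reg_prod s FR) (FN _ Pi) IH.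
by exists u => //; rewrite big_cons Pi.
Qed.

Lemma nz_sh f : nonzero_fun f -> nonzero_fun (fun u => f (sh u)).
Proof. by move=> [u wu fu]; exists (hs u); rewrite ?wt_hs0 ?hsK. Qed.
Lemma nz_hs f : nonzero_fun f -> nonzero_fun (fun u => f (hs u)).
Proof. by move=> [u wu fu]; exists (sh u); rewrite ?wt_sh0 ?shK. Qed.
Lemma nz_shn n f : nonzero_fun f -> nonzero_fun (fun u => f (iter n sh u)).
Proof. by move=> [u wu fu]; exists (iter n hs u); rewrite ?wt_hsn0 ?hsnK. Qed.
Lemma nz_io e f : wt e != 0 -> nonzero_fun f -> nonzero_fun (fun u => f (io e u)).
Proof. by move=> we [u wu fu]; exists (io e u); rewrite ?wt_io0 ?ioK. Qed.

Lemma reg_dec e f : wt e != 0 -> regular_fun f ->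
  exists h g : {poly K}, eq_valid f (fun u => h.[et e u] + g.[et e u] * u).
Proof.
move=> we; pose dec f := exists h g : {poly K}, eq_valid f (fun u => h.[et e u] + g.[et e u] * u).
have decM f1 f2 : dec f1 -> dec f2 -> dec (fun u => f1 u * f2 u).
  move=> [h [g E]] [h' [g' E']].
  exists (h * h' + g * g' * (k^-1 *: 'X)).
  exists (h * g' + h' * g + g * g' * ((r - 1) *: (k^-1 *: 'X) + e%:P)) => u wu.
  rewrite E // E' // !horner_simpl.
  transitivity (h.[et e u] * h'.[et e u] + (h.[et e u] * g'.[et e u]
     + h'.[et e u] * g.[et e u]) * u + g.[et e u] * g'.[et e u] * u ^+ 2); first by ring.
  by rewrite (sqr_uE e wu); ring.
have decD f1 f2 : dec f1 -> dec f2 -> dec (fun u => f1 u + f2 u).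
  move=> [h [g E]] [h' [g' E']]; exists (h + h'), (g + g') => u wu.
  by rewrite E // E' // !horner_simpl; ring.
have decC c : dec (fun=> c) by exists c%:P, 0 => u wu; rewrite !horner_simpl; ring.
have decI : dec id by exists 0, 1 => u wu; rewrite horner0 hornerC; ring.
have decW : dec (fun u => (wt u)^-1).
  exists ((wt e)^-1 *: (1 + (r - 1) *: ((r - 1) *: (k^-1 *: 'X) + e%:P))).
  exists (- (r - 1) / wt e)%:P => u wu.
  rewrite (inv_wtE we) // !horner_simpl; field; by rewrite wtE we (lk_neq0 T).
move=> [p [n pE]]; have decX f1 m : dec f1 -> dec (fun u => f1 u ^+ m).
  move=> d; elim: m => [|m [h [g E]]]; first exact: (decC 1).
  have [h' [g' E']] := decM _ _ d (ex_intro _ h (ex_intro _ g E)).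
  by exists h', g' => u wu; rewrite -E' // exprS.
have decP : dec (fun u => p.[u]).
  elim/poly_ind: (p) => [|q c [h [g E]]].
    by have [h [g E]] := decC 0; exists h, g => u wu; rewrite -E // horner0.
  have [h' [g' E']] := decD _ _ (decM _ _ (ex_intro _ h (ex_intro _ g E)) decI) (decC c).
  by exists h', g' => u wu; rewrite -E' // !horner_simpl.
have [h [g E]] := decM _ _ decP (decX _ n decW).
by exists h, g => u wu; rewrite -E // pE // exprVn.
Qed.

Lemma nz_id c : nonzero_fun (fun u => u - c).
Proof.
have w0 : wt 0 != 0 by rewrite wt0 oner_neq0.
have [E|//] := reg_zero (regB reg_id (regC c)).
have := E 0 w0; have := E (sh 0); rewrite wt_sh0 => /(_ w0) /= /subr0_eq <- /subr0_eq.
by move/(@shn_inj _ T 0 0 1 w0).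
Qed.

Lemma shn_root_bound (p : {poly K}) u : wt u != 0 -> p != 0 ->
  exists n, p.[iter n sh u] != 0.
Proof.
move=> wu p0; have [/allP A|/allPn [x /mapP [i _ ->]] nr] :=
  boolP (all (root p) [seq iter i sh u | i <- iota 0 (size p)]); last by exists i.
have := @max_poly_roots _ p [seq iter i sh u | i <- iota 0 (size p)] p0.
rewrite size_map size_iota ltnn => H; suff : false by [].
apply: H; first by apply/allP.
rewrite map_inj_in_uniq ?iota_uniq // => i j _ _; exact: shn_inj.
Qed.

Lemma et_surj e y : wt e != 0 -> exists2 u, wt u != 0 & et e u = y.
Proof.
move=> we; pose p : {poly K} := k *: 'X^2 - (k * e + y * (r - 1)) *: 'X - y%:P.
have [|u /rootP] := @closed_rootP _ p _.
  have c2 : p`_2 = k by rewrite /p !coefE /= !mulr0 !subr0 mulr1.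
  rewrite neq_ltn; apply/orP; right; rewrite ltnNge; apply/negP => s1.
  have := lk_neq0 T; rewrite -c2 nth_default ?eqxx //.
  exact: leq_trans s1 _.
rewrite /p !horner_simpl => E.
have {}E : k * (u * (u - e)) = y * wt u.
  by apply/subr0_eq; rewrite -[RHS]E /lwt; ring.
suff wu : wt u != 0 by exists u => //; rewrite /leta E mulfK.
(* At a root of weight zero the equation would force u = 0 or u = e, and both of these have nonzero
   weight. *)
apply/negP => /eqP w0; move: E; rewrite w0 mulr0 => /eqP.
rewrite !mulf_eq0 (negbTE (lk_neq0 T)) subr_eq0 /= => /orP [] /eqP u0.
  by move: w0; rewrite u0 wt0 => /eqP; rewrite oner_eq0.
by move: we; rewrite -u0 w0 eqxx.
Qed.

Lemma et_poly0 e (p : {poly K}) : wt e != 0 -> eq_valid (fun u => p.[et e u]) (fun=> 0) -> p = 0.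
Proof.
move=> we z; have w0 : wt 0 != 0 by rewrite wt0 oner_neq0.
apply: (poly_inf0 w0) => n; have [u wu <-] := et_surj (iter n sh 0) we.
exact: z.
Qed.

Lemma nz_dl e : nonzero_fun (dl e).
Proof.
have [E|//] := reg_zero (reg_dl e).
pose p : {poly K} := (r - 1) *: 'X^2 + 2 *: 'X - e%:P.
have w0 : wt 0 != 0 by rewrite wt0 oner_neq0.
have p0 : p = 0.
  apply: (poly_inf0 w0) => n; set u := iter n sh 0.
  have wu : wt u != 0 by rewrite wt_shn0.
  have -> : p.[u] = dl e u * wt u.
    rewrite /p !horner_simpl /lwidth /lrefl; move: wu; rewrite /lwt => wu; by field.
  by rewrite E // mul0r.
have /eqP := congr1 (fun q : {poly K} => q`_2) p0.
have /eqP := congr1 (fun q : {poly K} => q`_1) p0.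
rewrite /p !coefE /= !mulr1 !mulr0 !subr0 add0r addr0 => two /eqP /subr0_eq r1.
have := @nu_neq0 _ T 2 isT; rewrite !nuS nu0 add0r expr0 expr1 r1.
by rewrite (_ : 1 + 1 = 2) // two.
Qed.

Lemma dec0 e (h g : {poly K}) : wt e != 0 ->
  eq_valid (fun u => h.[et e u] + g.[et e u] * u) (fun=> 0) -> h = 0 /\ g = 0.
Proof.
move=> we E; have g0 : g = 0.
  apply: (et_poly0 we); apply: (reg_cancel (reg_pet g e) (reg_dl e)).
    exact: nz_dl.
  move=> u wu d0; have := E u wu; have := E (io e u) (wt_io0 we wu).
  rewrite /= et_io // => E1 E2; apply: (mulIf d0); rewrite mul0r /lwidth mulrBr.
  transitivity ((h.[et e u] + g.[et e u] * u) - (h.[et e u] + g.[et e u] * io e u)); first by ring.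
  by rewrite E1 E2 subrr.
split => //; apply: (et_poly0 we) => u wu.
by have := E u wu; rewrite g0 horner0 mul0r addr0.
Qed.

End Regular.

(** * Divisibility of regular functions *)

Section Divisibility.
Variables (K : closedFieldType) (T : lattice K).
Local Notation r := (lr T).
Local Notation wt := (lwt T).
Local Notation sh := (lshift T).
Local Notation hs := (lshift_inv T).
Local Notation et := (leta T).
Local Notation io := (lrefl T).
Local Notation reg := (regular_fun T).
Local Notation eqv := (eq_valid T).
Local Notation nz := (nonzero_fun T).

Lemma reg_sym e f : wt e != 0 -> reg f ->
  (forall u, wt u != 0 -> f (io e u) = f u) ->
  exists p : {poly K}, eqv f (fun u => p.[et e u]).
Proof.
move=> we fr fi; have [h [g E]] := reg_dec we fr.
suff g0 : g = 0 by exists h => u wu; rewrite E // g0 horner0 mul0r addr0.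
apply: (et_poly0 we); apply: (reg_cancel (reg_pet T g e) (reg_dl T e) (nz_dl T e)).
move=> u wu d0; apply: (mulIf d0); rewrite mul0r /lwidth mulrBr.
have := fi u wu; rewrite (E u wu) (E _ (wt_io0 we wu)) et_io // => /addrI ->.
by rewrite subrr.
Qed.

(** All factors of the weight are pulled out of the numerator, so that the roots of what remains are
    genuine zeros of f. When r = 1 the weight is 1 and nothing has to be pulled out. *)
Lemma reg_num f : reg f -> nz f -> exists p : {poly K}, exists m, exists n,
  (forall u, wt u = 0 -> p.[u] != 0) /\
  eqv f (fun u => p.[u] * wt u ^+ m / wt u ^+ n).
Proof.
move=> [p [n pE]] nf; have p0 := nz_poly pE nf.
have [r1|r1] := eqVneq r 1.
  exists p, 0%N, n; split=> [u|u wu]; last by rewrite pE // mulr1.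
  by rewrite /lwt r1 subrr mul0r addr0 => /eqP; rewrite oner_eq0.
have r10 : r - 1 != 0 by rewrite subr_eq0.
have wtX u : wt u = (r - 1) * (u - - (r - 1)^-1) by rewrite /lwt; field.
have [m [q nq pq]] := multiplicity_XsubC p (- (r - 1)^-1).
exists (((r - 1) ^- m) *: q), m, n; split=> [u|u wu].
  rewrite wtX => /eqP; rewrite mulf_eq0 (negbTE r10) subr_eq0 /= => /eqP ->.
  by rewrite hornerZ mulf_neq0 ?invr_eq0 ?expf_neq0 //; move: nq; rewrite p0.
rewrite pE // pq hornerM hornerZ horner_exp hornerXsubC wtX !exprMn.
have : (r - 1) ^+ m != 0 by rewrite expf_neq0.
by move: ((r - 1) ^+ m) => x x0; congr (_ / _); rewrite mulrACA mulVf // mul1r.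
Qed.

(** Gauss's lemma for the numerators; since [reg_num] makes the numerator of A prime to the weight,
    stray powers of the weight are harmless. *)
Lemma coprime_div A B F G : reg A -> reg B -> reg F -> reg G -> nz A ->
  (forall u, wt u != 0 -> A u = 0 -> B u != 0) ->
  eqv (fun u => F u * B u) (fun u => G u * A u) ->
  exists2 q, reg q & eqv F (fun u => q u * A u).
Proof.
move=> rA [pB [j BE]] [pF [i FE]] [pG [l GE]] nA cop E.
have [pA [m [n [ninv AE]]]] := reg_num rA nA.
have w0 : wt 0 != 0 by rewrite wt0 oner_neq0.
have pE : pF * (pB * wp T ^+ (l + n)) = pG * pA * wp T ^+ (i + j + m).
  apply/eqP; rewrite -subr_eq0; apply/eqP; apply: (poly_inf0 w0) => s.
  set u := iter s sh 0; have wu : wt u != 0 by rewrite wt_shn0.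
  have := E u wu; rewrite FE // BE // GE // AE // => E1.
  rewrite hornerD hornerN !hornerM !horner_exp wpE !exprD.
  set x := pF.[u] in E1 *; set y := pB.[u] in E1 *; set z := pG.[u] in E1 *.
  set t := pA.[u] in E1 *.
  have wi q : wt u ^+ q != 0 by rewrite expf_neq0.
  apply/eqP; rewrite subr_eq0; apply/eqP.
  transitivity (x / wt u ^+ i * (y / wt u ^+ j) * (wt u ^+ i * wt u ^+ j * wt u ^+ l * wt u ^+ n)).
    by field; rewrite !wi.
  by rewrite E1; field; rewrite !wi.
have cp : coprimep pA (pB * wp T ^+ (l + n)).
  apply: Pdiv.ClosedField.root_coprimep => u /rootP ru.
  have wu : wt u != 0 by apply: contra_eqN ru => /eqP /ninv.
  rewrite hornerM horner_exp wpE mulf_neq0 ?expf_neq0 //.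
  have /(cop u wu) : A u = 0 by rewrite AE // ru !mul0r.
  by rewrite BE // mulf_eq0 negb_or => /andP [].
have /divpK dv : pA %| pF.
  by rewrite -(Gauss_dvdpl _ cp) pE -mulrA mulrCA dvdp_mulr.
exists (fun u => (pF %/ pA).[u] * (wt u ^+ n * (wt u)^-1 ^+ (i + m))).
  apply: regM; first by apply: reg_poly; apply: reg_id.
  apply: regM; last by apply: regX; apply: reg_iwt.
  by apply: regX; apply: regD (regC _ _) _; apply: regMc; apply: reg_id.
move=> u wu; rewrite FE // -{1}dv hornerM AE // exprVn exprD.
by field; rewrite !expf_neq0.
Qed.

Lemma reg_unit H : reg H -> nz H -> (forall u, wt u != 0 -> H u != 0) ->
  reg (fun u => (H u)^-1).
Proof.
move=> rH nH H0; have [pA [m [n [ninv HE]]]] := reg_num rH nH.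
have s1 : size pA == 1%N.
  apply/negPn/negP => /closed_rootP [u /rootP ru].
  have wu : wt u != 0 by apply: contra_eqN ru => /eqP /ninv.
  by have := H0 u wu; rewrite HE // ru !mul0r eqxx.
have /size_poly1P [c c0 cE] := s1.
apply: (reg_ext (g := fun u => c^-1 * (wt u ^+ n * (wt u)^-1 ^+ m))).
  move=> u wu; rewrite HE // cE hornerC exprVn; field.
  by rewrite !expf_neq0 // c0.
apply: regMc; apply: regM; last by apply: regX; apply: reg_iwt.
by apply: regX; apply: regD (regC _ _) _; apply: regMc; apply: reg_id.
Qed.

(* At the top of an sh-orbit of poles of G / H the equation forces a zero of
   Ns, at its bottom a zero of N. *)
Lemma chain A G H N Ns : reg A -> reg G -> reg H -> reg N -> reg Ns -> nz H ->
  (forall u n, wt u != 0 -> N u = 0 -> Ns (iter n sh u) != 0) ->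
  eqv (fun u => A u * H u * H (hs u))
      (fun u => N u * G u * H (hs u) - Ns u * G (hs u) * H u) ->
  exists2 g, reg g & eqv G (fun u => g u * H u).
Proof.
move=> rA [pG [i GE]] rH rN rNs nH cop E.
have [pH [j HE]] := rH; have pH0 := nz_poly HE nH.
pose d := gcdp pG pH; pose g' := pG %/ d; pose h' := pH %/ d.
have d0 : d != 0 by rewrite gcdp_eq0 negb_and pH0 orbT.
have gE : g' * d = pG by rewrite divpK // dvdp_gcdl.
have horner_simpl : h' * d = pH by rewrite divpK // dvdp_gcdr.
have h'0 : h' != 0 by apply: contraNneq pH0 => h0; rewrite -horner_simpl h0 mul0r.
have cp : coprimep h' g' by rewrite coprimep_sym coprimep_div_gcd // pH0 orbT.
pose G1 u := g'.[u] / wt u ^+ i; pose H1 u := h'.[u] / wt u ^+ j.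
have rX p : reg (fun u => p.[u]) by apply: reg_poly; apply: reg_id.
have rw n : reg (fun u => (wt u ^+ n)^-1).
  apply: (reg_ext (g := fun u => (wt u)^-1 ^+ n)); first by move=> u _; rewrite exprVn.
  by apply: regX; apply: reg_iwt.
have rG1 : reg G1 by apply: regM.
have rH1 : reg H1 by apply: regM.
have nD : nz (fun u => d.[u]).
  have w0 : wt 0 != 0 by rewrite wt0 oner_neq0.
  by have [n dn] := shn_root_bound w0 d0; exists (iter n sh 0); rewrite ?wt_shn0.
have GE1 u : wt u != 0 -> G u = d.[u] * G1 u.
  by move=> wu; rewrite GE // -gE hornerM /G1; ring.
have HE1 u : wt u != 0 -> H u = d.[u] * H1 u.
  by move=> wu; rewrite HE // -horner_simpl hornerM /H1; ring.
have E1 : eqv (fun u => A u * H1 u * H1 (hs u))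
      (fun u => N u * G1 u * H1 (hs u) - Ns u * G1 (hs u) * H1 u).
  apply: (@reg_eq_on _ _ _ _ (fun u => d.[u] * d.[hs u])).
  - by apply: regM; [apply: regM | apply: reg_hs].
  - by apply: regB; apply: regM => //; [apply: regM | apply: reg_hs | apply: regM => //; apply: reg_hs].
  - by apply: regM => //; apply: reg_hs.
  - by apply: nzM => //; [apply: reg_hs | apply: nz_hs].
  move=> u wu /= nd; apply: (mulfI nd).
  have := E u wu; rewrite /= !HE1 ?wt_hs0 // !GE1 ?wt_hs0 // => E2.
  by transitivity (A u * (d.[u] * H1 u) * (d.[hs u] * H1 (hs u))); [ring | rewrite E2; ring].
have H1root u : wt u != 0 -> H1 u = 0 -> h'.[u] = 0.
  move=> wu /eqP; rewrite mulf_eq0 invr_eq0 expf_eq0 (negbTE wu) andbF orbF.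
  by move/eqP.
have G1nz u : wt u != 0 -> H1 u = 0 -> G1 u != 0.
  move=> wu /(H1root u wu) /rootP ru.
  by rewrite mulf_neq0 ?invr_eq0 ?expf_neq0 //; apply: coprimep_root ru.
have top u : wt u != 0 -> H1 u = 0 ->
    exists n, H1 (iter n sh u) = 0 /\ H1 (iter n.+1 sh u) != 0.
  move=> wu Hu; have [n hn] := shn_root_bound wu h'0.
  have {}hn : H1 (iter n sh u) != 0 by rewrite mulf_neq0 ?invr_eq0 ?expf_neq0 ?wt_shn0.
  elim: n hn => [|n IH] hn; first by rewrite /= Hu eqxx in hn.
  by have [z|/IH//] := eqVneq (H1 (iter n sh u)) 0; exists n.
have bot u : wt u != 0 -> H1 u = 0 ->
    exists n, H1 (iter n hs u) = 0 /\ H1 (iter n.+1 hs u) != 0.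
  move=> wu Hu.
  have [n hn] : exists n, H1 (iter n hs u) != 0.
    pose s := [seq iter i hs u | i <- iota 0 (size h')].
    have [/allP A1|/allPn [x /mapP [n _ ->]] nr] := boolP (all (root h') s).
      have := @max_poly_roots _ h' s h'0; rewrite size_map size_iota ltnn => F.
      suff : false by [].
      apply: F; first exact/allP.
      rewrite map_inj_in_uniq ?iota_uniq // => a b _ _ ab.
      have := congr1 (iter (a + b) sh) ab.
      rewrite {1}addnC !iterD !hsnK => /(shn_inj wu) /esym.
      by [].
    by exists n; rewrite mulf_neq0 ?invr_eq0 ?expf_neq0 ?wt_hsn0.
  elim: n hn => [|n IH] hn; first by rewrite /= Hu eqxx in hn.
  by have [z|/IH//] := eqVneq (H1 (iter n hs u)) 0; exists n.
have H1nz u : wt u != 0 -> H1 u != 0.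
  move=> wu; apply/negP => /eqP Hu.
  have [n [Ht Ht1]] := top u wu Hu; have [m [Hb Hb1]] := bot u wu Hu.
  have wb : wt (iter m hs u) != 0 by rewrite wt_hsn0.
  have wtp : wt (iter n sh u) != 0 by rewrite wt_shn0.
  have := E1 (iter m hs u) wb; rewrite Hb !mulr0 mul0r subr0 => /esym/eqP.
  rewrite 2!mulf_eq0 (negbTE Hb1) (negbTE (G1nz _ wb Hb)) !orbF => /eqP Nb.
  have := cop _ (n.+1 + m)%N wb Nb; rewrite iterD hsnK.
  have := E1 (iter n.+1 sh u); rewrite wt_shn0 => /(_ wu).
  rewrite /= shK Ht !mulr0 sub0r => /esym/eqP.
  by rewrite oppr_eq0 2!mulf_eq0 (negbTE Ht1) (negbTE (G1nz _ wtp Ht)) !orbF => ->.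
have nH1 : nz H1 by exists 0; rewrite ?H1nz // wt0 oner_neq0.
exists (fun u => G1 u * (H1 u)^-1); first by apply: regM => //; apply: reg_unit.
move=> u wu; rewrite GE1 // HE1 //; field; exact: H1nz.
Qed.

End Divisibility.

(** * Degrees and leading coefficients *)

Section Top.
Variable R : idomainType.
Implicit Types p q : {poly R}.

(** Here c may be zero, so leading coefficients can be computed before being shown nonzero. Below,
    [top n c ('X * g)] bounds the degree of g by n - 1 without truncated subtraction. *)
Definition top n (c : R) p := (size p <= n.+1)%N /\ p`_n = c.

Lemma topC c : top 0 c c%:P.
Proof. by split; rewrite ?size_polyC_leq1 // coefC. Qed.

Lemma top0 n : top n 0 0.
Proof. by split; rewrite ?size_poly0 ?coef0. Qed.

Lemma topX : top 1 1 'X.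
Proof. by split; rewrite ?size_polyX ?coefX. Qed.

Lemma topD n c d p q : top n c p -> top n d q -> top n (c + d) (p + q).
Proof.
move=> [sp <-] [sq <-]; split; last by rewrite coefD.
by rewrite (leq_trans (size_polyD _ _)) // geq_max sp.
Qed.

Lemma topZ n c d p : top n c p -> top n (d * c) (d *: p).
Proof.
by move=> [sp <-]; split; rewrite ?coefZ // (leq_trans (size_scale_leq _ _)).
Qed.

Lemma topN n c p : top n c p -> top n (- c) (- p).
Proof. by move=> [sp <-]; split; rewrite ?coefN ?size_polyN. Qed.

Lemma topM n m c d p q : top n c p -> top m d q -> top (n + m) (c * d) (p * q).
Proof.
move=> [sp <-] [sq <-]; split.
  have [->|p0] := eqVneq p 0; first by rewrite mul0r size_poly0.
  have [->|q0] := eqVneq q 0; first by rewrite mulr0 size_poly0.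
  by rewrite size_mul // -subn1 leq_subLR add1n -addnS -addSn leq_add.
rewrite coefM (bigD1 (inord n)) //= inordK ?ltnS ?leq_addr // addKn.
rewrite big1 ?addr0 // => i /negP ni; have [lt|gt|E] := ltngtP i n.
- by rewrite [q`__]nth_default ?mulr0 // (leq_trans sq) // ltn_subRL ltn_add2r.
- by rewrite nth_default ?mul0r // (leq_trans sp).
- by case: ni; apply/eqP/val_inj; rewrite /= inordK ?ltnS ?leq_addr.
Qed.

Lemma topW n c p : top n c p -> top n.+1 0 p.
Proof. by move=> [sp _]; split; rewrite ?nth_default // ltnW. Qed.

Lemma topXr n c p : top n c p -> top n.+1 c ('X * p).
Proof. by move/(topM topX); rewrite mul1r. Qed.

Lemma topX0 n c p : top n c ('X * p) -> top n 0 p.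
Proof.
have [->|p0] := eqVneq p 0; first by move=> _; exact: top0.
by rewrite mulrC => -[]; rewrite size_mulX // => sp _; split; rewrite ?nth_default // ltnW.
Qed.

Lemma topXI n c p : top n.+1 c ('X * p) -> top n c p.
Proof.
have [->|p0] := eqVneq p 0; first by rewrite mulr0 => -[_ <-]; rewrite coef0; exact: top0.
by rewrite mulrC => -[]; rewrite size_mulX // coefMX.
Qed.

Lemma topX00 c p : top 0 c ('X * p) -> p = 0 /\ c = 0.
Proof.
have [->|p0] := eqVneq p 0; first by rewrite mulr0 => -[_ <-]; rewrite coef0.
by rewrite mulrC => -[]; rewrite size_mulX // ltnS leqn0 size_poly_eq0 (negbTE p0).
Qed.

Lemma top_sum0 n (I : Type) (s : seq I) (F : I -> {poly R}) :
  (forall i, top n 0 (F i)) -> top n 0 (\sum_(i <- s) F i).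
Proof.
by move=> H; elim/big_ind: _ => // [|p q tp tq]; [apply: top0 | rewrite -[0]addr0; apply: topD].
Qed.

Lemma topZ0 n d p : top n 0 p -> top n 0 (d *: p).
Proof. by move/(topZ d); rewrite mulr0. Qed.

Lemma top_mono n c p m : top n c p -> (n < m)%N -> top m 0 p.
Proof.
move=> [sp _] nm; split; last by rewrite nth_default // (leq_trans sp).
by rewrite (leq_trans sp) // ltnS ltnW.
Qed.

Lemma topXn n j c p : top n c ('X^j * p) ->
  ((j <= n)%N /\ top (n - j) c p) \/ (p = 0 /\ c = 0).
Proof.
elim: j n p c => [|j IH] n p c; first by rewrite mul1r subn0; left.
rewrite exprSr -mulrA => /IH [[jn t]|[]]; last first.
  by move/eqP; rewrite mulf_eq0 polyX_eq0 => /eqP; right.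
have [lt|gt|E] := ltngtP j n.
- by left; split => //; apply: topXI; rewrite -subSn // subSS.
- by move: jn; rewrite leqNgt gt.
- by move: t; rewrite E subnn => /topX00; right.
Qed.

Lemma topP n c p : top n c p -> c != 0 -> size p = n.+1.
Proof.
move=> [sp pn] c0; apply/eqP; rewrite eqn_leq sp ltnNge; apply/negP => s'.
by move: c0; rewrite -pn nth_default ?eqxx.
Qed.

Lemma top_size p n : size p = n.+1 -> top n (lead_coef p) p.
Proof. by move=> s; split; rewrite ?s // lead_coefE s. Qed.

Lemma top_le p n : (size p <= n.+1)%N -> top n p`_n p. Proof. by []. Qed.

End Top.

(** * Divided differences, averages and a degree filtration *)

Section Operators.
Variables (K : closedFieldType) (T : lattice K).
Local Notation r := (lr T).
Local Notation k := (lk T).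
Local Notation wt := (lwt T).
Local Notation sh := (lshift T).
Local Notation hs := (lshift_inv T).
Local Notation et := (leta T).
Local Notation io := (lrefl T).
Local Notation dl := (lwidth T).
Local Notation nu := (lnum T).
Local Notation eqv := (eq_valid T).

Let k0 : k != 0 := lk_neq0 T.

Definition E1 e : {poly K} := (1 + r) *: 'X + (et e 1)%:P.
Definition E2 e : {poly K} := r *: 'X^2 - (k * e) *: 'X.
(** With t1 + t2 = E1 and t1 t2 = E2, both the power sums t1 ^ m + t2 ^ m and the quotients (t1 ^ m
    - t2 ^ m) / (t1 - t2) obey this recurrence; [Sm] and [Dm] differ in their initial values
    only. *)
Definition step e (x : {poly K} * {poly K}) := (x.2, E1 e * x.2 - E2 e * x.1).
Definition Dm e m := (iter m (step e) (0, 1)).1.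
Definition Sm e m := (iter m (step e) (2%:P, E1 e)).1.

Lemma E1E e u : wt u != 0 -> (E1 e).[et (hs e) u] = et e (sh u) + et e u.
Proof. by move=> wu; rewrite et_sum // /E1 !horner_simpl. Qed.

Lemma E2E e u : wt u != 0 -> (E2 e).[et (hs e) u] = et e (sh u) * et e u.
Proof. by move=> wu; rewrite et_prod // /E2 !horner_simpl. Qed.

Lemma DmSS e m : Dm e m.+2 = E1 e * Dm e m.+1 - E2 e * Dm e m.
Proof. by []. Qed.
Lemma SmSS e m : Sm e m.+2 = E1 e * Sm e m.+1 - E2 e * Sm e m.
Proof. by []. Qed.

Lemma ind2 (P : nat -> Prop) : P 0%N -> P 1%N ->
  (forall n, P n -> P n.+1 -> P n.+2) -> forall n, P n.
Proof.
by move=> p0 p1 ps n; suff [] : P n /\ P n.+1 by []; elim: n => // n [a b]; split => //; apply: ps.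
Qed.

Lemma DmE e m u : wt u != 0 ->
  et e (sh u) ^+ m - et e u ^+ m = (et e (sh u) - et e u) * (Dm e m).[et (hs e) u].
Proof.
move=> wu; elim/ind2: m => [||m a b]; first by rewrite horner0 subrr mulr0.
  by rewrite hornerC mulr1.
rewrite DmSS hornerD hornerN !hornerM E1E // E2E //.
transitivity ((et e (sh u) + et e u) * (et e (sh u) ^+ m.+1 - et e u ^+ m.+1)
  - et e (sh u) * et e u * (et e (sh u) ^+ m - et e u ^+ m)); first by rewrite !exprS; ring.
by rewrite a b; ring.
Qed.

Lemma SmE e m u : wt u != 0 ->
  et e (sh u) ^+ m + et e u ^+ m = (Sm e m).[et (hs e) u].
Proof.
move=> wu; elim/ind2: m => [||m a b]; first by rewrite hornerC; ring.
  by rewrite E1E.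
rewrite SmSS hornerD hornerN !hornerM E1E // E2E // -a -b !exprS; ring.
Qed.

Lemma topE1 e : top 1 (1 + r) (E1 e).
Proof.
rewrite -[1 + r]mulr1 -[X in top _ X _]addr0; apply: topD; last exact: topW (topC _).
by apply: topZ; apply: topX.
Qed.

Lemma topE2 e : top 2 r (E2 e).
Proof.
rewrite -[X in top _ X _]mulr1 -[X in top _ X _]subr0; apply: topD.
  by apply: topZ; rewrite -[1]mulr1; apply: (topM (topX _) (topX _)).
apply: topN; exact: topW (topZ _ (topX _)).
Qed.

(** To leading order the two values of the coordinate behave as r X and X, whence (r ^ m - 1) / (r -
    1) here and r ^ m + 1 for [Sm]. *)
Lemma topDm e m : top m (nu m) ('X * Dm e m).
Proof.
suff H n : top n (nu n.+1) (Dm e n.+1).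
  by case: m => [|m]; [rewrite nu0 mulr0; apply: top0 | apply: topXr].
elim/ind2: n => [||n a b].
- by rewrite nu1; exact: topC.
- rewrite DmSS mulr0 subr0 mulr1 nuS nu1 expr1; exact: topE1.
rewrite DmSS (_ : nu n.+3 = (1 + r) * nu n.+2 - r * nu n.+1).
  by apply: topD; [exact: topM (topE1 e) b | apply: topN; exact: topM (topE2 e) a].
by rewrite !nuS !exprS; ring.
Qed.

Lemma topSm e m : top m (1 + r ^+ m) (Sm e m).
Proof.
elim/ind2: m => [||n a b].
- exact: topC.
- exact: topE1.
rewrite SmSS (_ : 1 + r ^+ n.+2 = (1 + r) * (1 + r ^+ n.+1) - r * (1 + r ^+ n)).
  by apply: topD; [exact: topM (topE1 e) b | apply: topN; exact: topM (topE2 e) a].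
by rewrite !exprS; ring.
Qed.

Definition Dop e (p : {poly K}) : {poly K} := \sum_(i < size p) p`_i *: Dm e i.
Definition Sop e (p : {poly K}) : {poly K} := \sum_(i < size p) p`_i *: Sm e i.

Lemma DopE e p u : wt u != 0 ->
  p.[et e (sh u)] - p.[et e u] = k * dl (hs e) u * (Dop e p).[et (hs e) u].
Proof.
move=> wu; rewrite -et_diff // !(horner_coef p) -sumrB /Dop horner_sum mulr_sumr.
by apply: eq_bigr => i _; rewrite hornerZ mulrCA -DmE // mulrBr.
Qed.

Lemma SopE e p u : wt u != 0 ->
  p.[et e (sh u)] + p.[et e u] = (Sop e p).[et (hs e) u].
Proof.
move=> wu; rewrite !(horner_coef p) -big_split /= /Sop horner_sum.
by apply: eq_bigr => i _; rewrite hornerZ -SmE // mulrDr.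
Qed.

Lemma widen_sum (V : zmodType) (F : nat -> K -> V) (p : {poly K}) n :
  (size p <= n)%N -> (forall i, F i 0 = 0) ->
  \sum_(i < size p) F i p`_i = \sum_(i < n) F i p`_i.
Proof.
move=> sp F0; rewrite (big_ord_widen n (fun i => F i p`_i) sp) big_mkcond.
by apply: eq_bigr => i _; case: ltnP => // si; rewrite nth_default.
Qed.

Lemma topDop e m c p : top m c p -> top m (nu m * c) ('X * Dop e p).
Proof.
move=> [sp <-]; rewrite /Dop (widen_sum (F := fun i x => x *: Dm e i) sp) => [|i]; last exact: scale0r.
rewrite mulr_sumr -[X in top m X _]add0r big_ord_recr /=; apply: topD.
  apply: top_sum0 => i; rewrite -scalerAr; apply: topZ0.
  exact: top_mono (topDm e i) _.
by rewrite -scalerAr mulrC; apply: topZ; apply: topDm.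
Qed.

Lemma topSop e m c p : top m c p -> top m ((1 + r ^+ m) * c) (Sop e p).
Proof.
move=> [sp <-]; rewrite /Sop (widen_sum (F := fun i x => x *: Sm e i) sp) => [|i]; last exact: scale0r.
rewrite -[X in top m X _]add0r big_ord_recr /=; apply: topD.
  by apply: top_sum0 => i; apply: topZ0; apply: top_mono (topSm e i) _.
by rewrite mulrC; apply: topZ; apply: topSm.
Qed.

(** The coefficients h + g dl and h - g dl are exchanged by the reflection at [hs e], so the
    first-order difference they define is odd, hence divisible by the width; [Aop] is the quotient
    ([AopE]). *)
Definition Aop e (h g z : {poly K}) := h * Dop e z + k^-1 *: (g * Sop e z).

Lemma AopE e h g z u : wt u != 0 ->
  (h.[et (hs e) u] + g.[et (hs e) u] * dl (hs e) u) * z.[et e (sh u)]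
  - (h.[et (hs e) u] - g.[et (hs e) u] * dl (hs e) u) * z.[et e u]
  = k * dl (hs e) u * (Aop e h g z).[et (hs e) u].
Proof.
move=> wu; rewrite /Aop !horner_simpl -SopE //.
transitivity (h.[et (hs e) u] * (k * dl (hs e) u * (Dop e z).[et (hs e) u]) + 
  g.[et (hs e) u] * dl (hs e) u * (z.[et e (sh u)] + z.[et e u])).
  by rewrite -DopE //; ring.
by field.
Qed.

Lemma topAop e h g z s ch cg m c : top s ch h -> top s cg ('X * g) -> top m c z ->
  top (s + m) ((ch * nu m + cg / k * (1 + r ^+ m)) * c) ('X * Aop e h g z).
Proof.
move=> th tg tz; rewrite /Aop [X in top _ _ X]mulrDr mulrDl; apply: topD.
  by rewrite mulrCA -mulrA; apply: topM th _; apply: topDop.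
rewrite -scalerAr mulrA (_ : _ * c = k^-1 * (cg * ((1 + r ^+ m) * c))); last by ring.
by apply: topZ; apply: topM tg _; apply: topSop.
Qed.

(** [Qh] is the even part of (u - x)(u - y) / wt u under the reflection at e, and [Qg] is the odd
    part divided by the width. *)
Definition Qg e x y : K := (e - x - y - (r - 1) * (x * y)) / (2 * wt e).
Definition Qh e x y : {poly K} :=
  ((wt e + wt x * wt y) / (2 * wt e * k)) *: 'X +
  (x * y / wt e + e * (e - x - y + (r - 1) * (x * y)) / (2 * wt e))%:P.

Lemma QE e x y u : wt e != 0 -> wt u != 0 ->
  (u - x) * (u - y) / wt u = (Qh e x y).[et e u] + (Qg e x y)%:P.[et e u] * dl e u.
Proof.
move=> we wu; rewrite /Qh /Qg !horner_simpl /lwidth /lrefl /leta.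
move: we wu k0 (l2_neq0 T); rewrite /lwt => we wu k1 two; field.
by rewrite we wu k1 two.
Qed.

Lemma QiE e x y u : wt e != 0 -> wt u != 0 ->
  (io e u - x) * (io e u - y) / wt (io e u)
  = (Qh e x y).[et e u] - (Qg e x y)%:P.[et e u] * dl e u.
Proof. by move=> we wu; rewrite (QE x y we (wt_io0 we wu)) et_io // dl_io // mulrN. Qed.

Lemma topQh e x y : top 1 ((wt e + wt x * wt y) / (2 * wt e * k)) (Qh e x y).
Proof.
rewrite /Qh -[X in top _ X _]addr0; apply: topD; last exact: topW (topC _).
by rewrite -[X in top _ X _]mulr1; apply: topZ; apply: topX.
Qed.

Lemma topQg e x y : top 1 (Qg e x y) ('X * (Qg e x y)%:P).
Proof. by apply: topXr; apply: topC. Qed.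

(** A degree filtration with leading coefficients. As u grows, u behaves like (r - 1) / k times the
    coordinate, so c is the coefficient of f at infinity. When r = 1, u has half the degree of the
    coordinate and c reduces to ch. Unlike ch and cg separately, c is multiplicative. *)
Definition L e n (c : K) (f : K -> K) := exists h g : {poly K}, exists ch cg,
  [/\ eqv f (fun u => h.[et e u] + g.[et e u] * u), top n ch h, top n cg ('X * g)
    & c = ch + cg * ((r - 1) / k)].

Lemma L_ext e n c f f' : eqv f f' -> L e n c f' -> L e n c f.
Proof.
move=> ff [h [g [ch [cg [E a b d]]]]]; exists h, g, ch, cg; split => // u wu.
by rewrite ff // E.
Qed.

Lemma LD e n c c' f f' : L e n c f -> L e n c' f' -> L e n (c + c') (fun u => f u + f' u).
Proof.
move=> [h [g [ch [cg [E th tg ->]]]]] [h' [g' [ch' [cg' [E' th' tg' ->]]]]].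
exists (h + h'), (g + g'), (ch + ch'), (cg + cg'); split.
- by move=> u wu; rewrite E // E' // !hornerD; ring.
- exact: topD.
- by rewrite mulrDr; apply: topD.
- by ring.
Qed.

Lemma LM e n n' c c' f f' : L e n c f -> L e n' c' f' ->
  L e (n + n') (c * c') (fun u => f u * f' u).
Proof.
move=> [h [g [ch [cg [E th tg ->]]]]] [h' [g' [ch' [cg' [E' th' tg' ->]]]]].
pose q := g * g' * 'X.
have tgg : top (n + n') (cg * cg') ('X * q).
  by rewrite (_ : 'X * q = ('X * g) * ('X * g')); [apply: topM | rewrite /q; ring].
have tq := topX0 tgg.
exists (h * h' + k^-1 *: q).
exists (h * g' + h' * g + (r - 1) / k *: q + e *: (g * g')).
exists (ch * ch'), (ch * cg' + ch' * cg + (r - 1) / k * (cg * cg')); split.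
- move=> u wu; rewrite E // E' // /q !horner_simpl.
  transitivity (h.[et e u] * h'.[et e u] + (h.[et e u] * g'.[et e u]
     + h'.[et e u] * g.[et e u]) * u + g.[et e u] * g'.[et e u] * u ^+ 2); first by ring.
  by rewrite (sqr_uE e wu); ring.
- by rewrite -[ch * ch']addr0 -(mulr0 k^-1); apply: topD; [apply: topM | apply: topZ].
- rewrite -[X in top _ X _]addr0 -(mulr0 e) !mulrDr -!scalerAr; apply: topD.
    apply: topD; last exact: topZ.
    apply: topD; first by rewrite mulrCA; apply: topM.
    by rewrite addnC mulrCA; apply: topM.
  by apply: topZ; rewrite (_ : 'X * _ = q) // /q; ring.
- by ring.
Qed.

Lemma LC e c : L e 0 c (fun=> c).
Proof.
exists c%:P, 0, c, 0; split; first by move=> u _; rewrite !horner_simpl; ring.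
- exact: topC.
- by rewrite mulr0; apply: top0.
by ring.
Qed.

Lemma L0 e n : L e n 0 (fun=> 0).
Proof.
exists 0, 0, 0, 0; split; first by move=> u _; rewrite !horner_simpl; ring.
- exact: top0.
- by rewrite mulr0; apply: top0.
by ring.
Qed.

Lemma LZ e n c d f : L e n c f -> L e n (d * c) (fun u => d * f u).
Proof. exact: (LM (LC e d)). Qed.

Lemma L_sum e n (I : Type) (s : seq I) (F : I -> K -> K) (c : I -> K) :
  (forall i, L e n (c i) (F i)) -> L e n (\sum_(i <- s) c i) (fun u => \sum_(i <- s) F i u).
Proof.
move=> H; elim: s => [|i s IH].
  by rewrite big_nil; apply: L_ext (L0 e n) => u _; rewrite big_nil.
rewrite big_cons; apply: L_ext (LD (H i) IH) => u _; by rewrite big_cons.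
Qed.

Lemma L_sum0 e n (I : Type) (s : seq I) (F : I -> K -> K) :
  (forall i, L e n 0 (F i)) -> L e n 0 (fun u => \sum_(i <- s) F i u).
Proof. by move=> H; have := L_sum s H; rewrite big1. Qed.

Lemma LZ0 e n d f : L e n 0 f -> L e n 0 (fun u => d * f u).
Proof. by move/(LZ d); rewrite mulr0. Qed.

Lemma L_prod e (I : Type) (s : seq I) (P : pred I) (n : I -> nat) (F : I -> K -> K) (c : I -> K) :
  (forall i, L e (n i) (c i) (F i)) ->
  L e (\sum_(i <- s | P i) n i) (\prod_(i <- s | P i) c i) (fun u => \prod_(i <- s | P i) F i u).
Proof.
move=> H; elim: s => [|i s IH].
  by rewrite !big_nil; apply: L_ext (LC e 1) => u _; rewrite big_nil.
rewrite !big_cons; case Pi: (P i).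
  by apply: L_ext (LM (H i) IH) => u _; rewrite big_cons Pi.
by apply: L_ext IH => u _; rewrite big_cons Pi.
Qed.

Lemma L_det e n (m : 'I_n -> nat) (F : 'I_n -> 'I_n -> K -> K) (c : 'I_n -> 'I_n -> K) :
  (forall i j, L e (m j) (c i j) (F i j)) ->
  L e (\sum_j m j) (\det (\matrix_(i, j) c i j)) (fun u => \det (\matrix_(i, j) F i j u)).
Proof.
move=> H; rewrite /determinant; apply: L_sum => s; apply: LZ.
rewrite (reindex_inj (@perm_inj _ s)) /=.
rewrite (_ : \prod_i (\matrix_(i0, j) c i0 j) i (s i) = \prod_i c i (s i)); last first.
  by apply: eq_bigr => i _; rewrite mxE.
apply: (@L_ext _ _ _ _ (fun u => \prod_i F i (s i) u)).
  by move=> u _; apply: eq_bigr => i _; rewrite mxE.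
exact: L_prod.
Qed.

(** Coordinates with different parameter points agree to leading order, so functions from all levels
    can be compared in the filtration of a single one. *)
Lemma L_pet e e' m c p : wt e != 0 -> top m c p -> L e m c (fun u => p.[et e' u]).
Proof.
move=> we [sp <-].
have L1 : L e 1 1 (et e').
  exists ((1 - (e - e') * (r - 1) / wt e) *: 'X), (k * (e - e') / wt e)%:P.
  exists (1 - (e - e') * (r - 1) / wt e), (k * (e - e') / wt e); split.
  - move=> u wu; rewrite !horner_simpl /leta; move: we wu; rewrite /lwt => we wu.
    by field; rewrite we wu.
  - by rewrite -[X in top _ X _]mulr1; apply: topZ; apply: topX.
  - by apply: topXr; apply: topC.
  - by field; rewrite we k0.
have LX n : L e n 1 (fun u => et e' u ^+ n).
  elim: n => [|n IH]; first exact: LC.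
  have := LM L1 IH; rewrite mul1r add1n; apply: L_ext => u _; exact: exprS.
have LXn n j : (j < n)%N -> L e n 0 (fun u => et e' u ^+ j).
  move=> jn; have [h [g [ch [cg [E a b _]]]]] := LX j.
  exists h, g, 0, 0; split => //; last by ring.
    exact: top_mono a jn.
  exact: top_mono b jn.
apply: (@L_ext _ _ _ _ (fun u => \sum_(i < m.+1) p`_i * et e' u ^+ i)).
  by move=> u wu; rewrite horner_coef (widen_sum (F := fun i x => x * et e' u ^+ i) sp) // => i; rewrite mul0r.
apply: (@L_ext _ _ _ _ (fun u => \sum_(i < m) p`_i * et e' u ^+ i + p`_m * et e' u ^+ m)).
  by move=> u wu; rewrite big_ord_recr.
rewrite -[X in L _ _ X]add0r; apply: LD; last first.
  by rewrite -[X in L _ _ X]mulr1; apply: LZ; apply: LX.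
by apply: L_sum0 => i; apply: LZ0; apply: LXn.
Qed.

Lemma L_quad e x y : wt e != 0 -> L e 1 k^-1 (fun u => (u - x) * (u - y) / wt u).
Proof.
move=> we.
exists ((1 - (e - x - y) * (r - 1) / wt e + x * y * (r - 1) ^+ 2 / wt e) / k *: 'X
   + (x * y * (1 + (r - 1) * e) / wt e)%:P).
exists ((e - x - y) / wt e - x * y * (r - 1) / wt e)%:P.
exists ((1 - (e - x - y) * (r - 1) / wt e + x * y * (r - 1) ^+ 2 / wt e) / k).
exists ((e - x - y) / wt e - x * y * (r - 1) / wt e); split.
- move=> u wu; rewrite !horner_simpl /leta; move: we wu k0; rewrite /lwt => we wu k1.
  by field; rewrite we wu k1.
- rewrite -[X in top _ X _]addr0; apply: topD; last exact: topW (topC _).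
  by rewrite -[X in top _ X _]mulr1; apply: topZ; apply: topX.
- by apply: topXr; apply: topC.
- by field; rewrite we k0.
Qed.

Lemma L_poly e n c p : wt e != 0 -> L e n c (fun u => p.[et e u]) -> top n c p.
Proof.
move=> we [h [g [ch [cg [E th tg ->]]]]].
have [|hp g0] := @dec0 _ T e (p - h) (- g) we.
  by move=> u wu; rewrite !horner_simpl E //; ring.
move/subr0_eq: hp => ->; move/eqP: g0; rewrite oppr_eq0 => /eqP g0.
by move: tg; rewrite g0 mulr0 => -[_ <-]; rewrite coef0 mul0r addr0.
Qed.

End Operators.

(** * Casoratians *)

(** The table of divided differences is described without division because the nodes, values of the
    coordinate along an orbit, may coincide for special u. *)
Lemma newton_interpolation (R : comNzRingType) N (y : nat -> R) (D : nat -> nat -> R) :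
  (forall j i, (i + j < N)%N -> D j.+1 i * (y (i + j).+1 - y i) = D j i.+1 - D j i) ->
  forall n i, (i + n <= N)%N ->
  D 0%N (i + n)%N = \sum_(j < n.+1) D j i * \prod_(t < j) (y (i + n)%N - y (i + t)%N).
Proof.
move=> H; elim=> [|n IH] i iN.
  by rewrite big_ord1 big_ord0 mulr1 addn0.
have := IH i.+1; rewrite addSnnS => -> //; set Y := y _.
pose A j := \prod_(t < j) (Y - y (i.+1 + t)%N).
pose B j := \prod_(t < j) (Y - y (i + t)%N).
have BS j : B j.+1 = (Y - y i) * A j.
  rewrite /B big_ord_recl addn0; congr (_ * _); apply: eq_bigr => t _.
  by rewrite /bump /= addSnnS.
have AS j : A j.+1 = A j * (Y - y (i + j).+1) by rewrite /A big_ord_recr.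
suff S m : (m <= n.+1)%N ->
  \sum_(j < m) D j i.+1 * A j = \sum_(j < m) D j i * B j + D m i * (B m - A m).
  rewrite (eq_bigr (fun j : 'I_n.+1 => D j i.+1 * A j)) // S // [RHS]big_ord_recr /=.
  have A0 : A n.+1 = 0 by rewrite AS /Y addnS subrr mulr0.
  by congr (_ + _ * _); rewrite A0 subr0.
elim: m => [_|m IHm mn]; first by rewrite !big_ord0 add0r /A /B !big_ord0 subrr mulr0.
rewrite !big_ord_recr /= IHm 1?ltnW // BS AS.
have -> : D m i.+1 = D m.+1 i * (y (i + m).+1 - y i) + D m i.
  by rewrite H ?subrK // (leq_trans _ iN) // ltn_add2l.
by ring.
Qed.

Lemma det_rev_rows (R : comNzRingType) n (F : nat -> nat -> R) :
  \det (\matrix_(i < n, j < n) F (n.-1 - i)%N j) =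
  (-1) ^+ odd_perm (perm (@rev_ord_inj n)) * \det (\matrix_(i < n, j < n) F i j).
Proof.
rewrite -det_perm -det_mulmx -row_permE; congr (\det _); apply/matrixP => i j.
by rewrite !mxE permE /=; congr F; rewrite -subn1 -subnDA add1n.
Qed.

Lemma det_scale_rows (R : comNzRingType) n (c : 'I_n -> R) (A : 'I_n -> 'I_n -> R) :
  \det (\matrix_(i, j) (c i * A i j)) = \prod_i c i * \det (\matrix_(i, j) A i j).
Proof.
rewrite (_ : (\matrix_(i, j) _) = diag_mx (\row_i c i) *m \matrix_(i, j) A i j).
  by rewrite det_mulmx det_diag; congr (_ * _); apply: eq_bigr => i _; rewrite mxE.
by apply/matrixP => i j; rewrite mul_diag_mx !mxE.
Qed.

Lemma det_scale_cols (R : comNzRingType) n (c : 'I_n -> R) (A : 'I_n -> 'I_n -> R) :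
  \det (\matrix_(i, j) (A i j * c j)) = \prod_i c i * \det (\matrix_(i, j) A i j).
Proof.
rewrite (_ : (\matrix_(i, j) _) = (\matrix_(i, j) A i j) *m diag_mx (\row_i c i)).
  by rewrite det_mulmx det_diag mulrC; congr (_ * _); apply: eq_bigr => i _; rewrite mxE.
by apply/matrixP => i j; rewrite mul_mx_diag !mxE.
Qed.

Lemma det_newton_basis (R : idomainType) n (v : nat -> R) (x : 'I_n -> R) :
  \det (\matrix_(i < n, j < n) \prod_(t < i) (x j - v t)) =
  \prod_(i < n) \prod_(j < n | (i < j)%N) (x j - x i).
Proof.
pose p i : {poly R} := \prod_(t < i) ('X - (v t)%:P).
have sp i : size (p i) = i.+1.
  by rewrite /p size_prod_XsubC; rewrite /index_enum -enumT size_enum_ord.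
rewrite (_ : (\matrix_(i, j) _) = (\matrix_(i < n, s < n) (p i)`_s) *m Vandermonde n (\row_j x j)).
  rewrite det_mulmx det_Vandermonde det_trig.
    rewrite big1 ?mul1r => [|i _]; last first.
      rewrite mxE; have := monic_prod_XsubC (index_enum 'I_i) xpredT (fun t : 'I_i => v t).
      by move/monicP; rewrite -/(p i) lead_coefE sp.
    by apply: eq_bigr => i _; apply: eq_bigr => j _; rewrite !mxE.
  by apply/is_trig_mxP => i j ij; rewrite mxE nth_default // sp.
apply/matrixP => i j; rewrite !mxE.
rewrite (_ : \prod_(t < i) _ = (p i).[x j]).
  rewrite horner_coef sp (big_ord_widen n (fun s => (p i)`_s * x j ^+ s)) // big_mkcond.
  apply: eq_bigr => s _; rewrite !mxE; case: ifP => // /negbT; rewrite -leqNgt => is_.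
  by rewrite [(p i)`_s]nth_default ?mul0r // sp.
by rewrite /p horner_prod; apply: eq_bigr => t _; rewrite hornerXsubC.
Qed.

Section Casoratian.
Variables (K : closedFieldType) (T : lattice K) (a b d : K).
Local Notation r := (lr T).
Local Notation k := (lk T).
Local Notation wt := (lwt T).
Local Notation sh := (lshift T).
Local Notation hs := (lshift_inv T).
Local Notation et := (leta T).
Local Notation io := (lrefl T).
Local Notation nu := (lnum T).
Local Notation reg := (regular_fun T).
Local Notation eqv := (eq_valid T).
Local Notation nz := (nonzero_fun T).

Let r0 : r != 0 := lr_neq0 T.
Let k0 : k != 0 := lk_neq0 T.

Definition level s := iter s hs d.
(** In the Racah case [quad_up] is (x + a)(x + b), [quad_down] is (x + d - a + 1)(x + d - b + 1),
    and [gauge_prod n j] is the numerator of r_(j+1) for M = n. *)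
Definition quad_up u := (u - a) * (u - b) / wt u.
Definition quad_down u := quad_up (io (hs d) u).
Definition gauge_prod n j u := \prod_(i < j) quad_up (iter i sh u) * \prod_(j <= i < n) quad_down (iter i sh u).
(* The flag of a column tells whether its entries carry the factor r_j. *)
Definition casorati_entry n (c : bool * {poly K}) j u :=
  (if c.1 then gauge_prod n j u else 1) * c.2.[et d (iter j sh u)].
Definition casoratian n (F : nat -> bool * {poly K}) u :=
  \det (\matrix_(i < n, j < n) casorati_entry n.-1 (F j) i u).
Definition eta_diffs n u := \prod_(i < n) \prod_(j < n | (j < i)%N)
  (et d (iter i sh u) - et d (iter j sh u)).

(** What is left of a j-th divided difference once the shared gauge factors are removed. For a
    gauged column one [quad_up] and one [quad_down] remain, and they turn the plain difference into
    [Aop]. *)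
Fixpoint divided_poly (c : bool * {poly K}) j : {poly K} :=
  if j is j'.+1 then
    (nu j)^-1 *: (if c.1 then Aop T (level j') (Qh T (level j) a b) (Qg T (level j) a b)%:P (divided_poly c j')
                  else Dop T (level j') (divided_poly c j'))
  else c.2.

(** The two products consist of the gauge factors common to the entries i, ..., i + j of the
    column. *)
Definition divided_diff n (c : bool * {poly K}) j i u :=
  (if c.1 then \prod_(l < i) quad_up (iter l sh u) * \prod_(i <= l < n - j) quad_down (iter (l + j) sh u) else 1)
  * (divided_poly c j).[et (level j) (iter i sh u)].

Hypothesis wd : wt d != 0.

Lemma wt_lv s : wt (level s) != 0. Proof. by rewrite wt_hsn0. Qed.

Lemma lvS s : level s.+1 = hs (level s). Proof. by []. Qed.

Lemma am_shn j u : wt u != 0 -> quad_down (iter j sh u) = quad_up (io (level j.+1) u).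
Proof. by move=> wu; rewrite /quad_down io_shn // /level iterSr. Qed.

(** The two neighbours share all gauge factors but one [quad_up] and one [quad_down]. These are
    exchanged by the reflection at level j + 1, so the difference is divisible by the width of that
    level, as is the difference of the nodes ([et_diffn]). *)
Lemma dtab_rel n c j i u : wt u != 0 -> (i + j < n)%N ->
  divided_diff n c j.+1 i u * (et d (iter (i + j).+1 sh u) - et d (iter i sh u)) =
  divided_diff n c j i.+1 u - divided_diff n c j i u.
Proof.
move=> wu ijn; set v := iter i sh u; have wv : wt v != 0 by rewrite wt_shn0.
have -> : iter (i + j).+1 sh u = iter j.+1 sh v by rewrite addnC -addSn iterD.
rewrite et_diffn // -/(level j.+1); have nz := nu_neq0 T (ltn0Sn j).
rewrite /divided_diff /=; case: (c.1); last first.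
  rewrite !mul1r -/v -/(sh v) DopE //.
  by rewrite hornerZ -lvS; field.
rewrite big_ord_recr /= -/v.
rewrite [\prod_(i <= l < n - j) _]big_ltn; last by rewrite ltn_subRL addnC.
have -> : \prod_(i <= l < n - j.+1) quad_down (iter (l + j.+1) sh u) =
          \prod_(i.+1 <= l < n - j) quad_down (iter (l + j) sh u).
  by rewrite big_add1 subnS; apply: eq_bigr => l _; rewrite addnS.
set P := \prod_(l < i) _; set Q := \prod_(_ <= _ < _) _.
have -> : iter (i + j) sh u = iter j sh v by rewrite addnC iterD.
rewrite am_shn // hornerZ.
transitivity (P * Q * (quad_up v * (divided_poly c j).[et (level j) (sh v)] - quad_up (io (level j.+1) v) * (divided_poly c j).[et (level j) v])); last by ring.
rewrite /quad_up (QE a b (wt_lv j.+1) wv) (QiE a b (wt_lv j.+1) wv) lvS AopE // -lvS; field.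
by [].
Qed.

Lemma phi_newton n u :
  eta_diffs n u = \det (\matrix_(i < n, j < n) \prod_(t < j) (et d (iter i sh u) - et d (iter t sh u))).
Proof.
rewrite det_trig; last first.
  by apply/is_trig_mxP => i j ij; rewrite mxE (bigD1 (Ordinal ij)) //= subrr mul0r.
apply: eq_bigr => i _; rewrite mxE.
by rewrite (big_ord_widen n (fun t => et d (iter i sh u) - et d (iter t sh u))) // ltnW.
Qed.

Definition divided_det n (F : nat -> bool * {poly K}) u := \det (\matrix_(i < n, j < n) divided_diff n.-1 (F j) i 0 u).

(** Newton interpolation factors the Casorati matrix into a lower triangular matrix with determinant
    [eta_diffs] and the matrix of divided differences. *)
Lemma cdet_phi n F u : wt u != 0 -> casoratian n F u = eta_diffs n u * divided_det n F u.
Proof.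
move=> wu; rewrite phi_newton -det_mulmx; congr (\det _); apply/matrixP => i j.
rewrite !mxE; case: n i j => [|n] i j; first by case: i.
have := @newton_interpolation _ n (fun s => et d (iter s sh u)) (fun s t => divided_diff n (F j) s t u).
move=> /(_ (fun s t h => dtab_rel _ wu h)) /(_ i 0%N).
rewrite !add0n -ltnS ltn_ord => /(_ isT) E.
transitivity (divided_diff n (F j) 0 i u).
  rewrite /divided_diff /casorati_entry /gauge_prod subn0; congr ((if _ then _ * _ else _) * _).
  by apply: eq_bigr => l _; rewrite addn0.
rewrite E (big_ord_widen n.+1 (fun s : nat => divided_diff n (F j) s 0 u * \prod_(t < s) (et d (iter i sh u) - et d (iter t sh u)))) //.
rewrite big_mkcond; apply: eq_bigr => s _; rewrite !mxE mulrC /=.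
case: ifP => // /negbT; rewrite ltnS -ltnNge => is_.
by rewrite (bigD1 (Ordinal is_)) //= subrr !mul0r.
Qed.

Lemma reg_ap : reg quad_up.
Proof.
apply: regM; last exact: reg_iwt.
by apply: regM; apply: regB (reg_id _) (regC _ _).
Qed.

Lemma reg_am : reg quad_down.
Proof. by apply: reg_io reg_ap; rewrite wt_hs0. Qed.

Lemma nz_ap : nz quad_up.
Proof.
apply: nzM; try exact: reg_iwt.
- by apply: regM; apply: regB (reg_id _) (regC _ _).
- by apply: nzM; try exact: nz_id; apply: regB (reg_id _) (regC _ _).
by exists 0; rewrite ?wt0 ?invr1 ?oner_neq0.
Qed.

Lemma nz_am : nz quad_down.
Proof. by apply: nz_io nz_ap; rewrite wt_hs0. Qed.

Lemma reg_dtab n c j i : reg (divided_diff n c j i).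
Proof.
apply: regM; last by apply: (reg_shn i (f := fun v => (divided_poly c j).[et (level j) v])); apply: reg_pet.
case: (c.1); last exact: regC.
by apply: regM; apply: reg_prod => l _; apply: reg_shn; [apply: reg_ap | apply: reg_am].
Qed.

Lemma reg_ddet n F : reg (divided_det n F).
Proof. by apply: reg_det => i j; apply: reg_dtab. Qed.

Lemma reg_phi n : reg (eta_diffs n).
Proof.
apply: reg_prod => i _; apply: reg_prod => j _.
by apply: regB; apply: reg_shn; apply: reg_et.
Qed.

Lemma nz_phi n : nz (eta_diffs n).
Proof.
have rg (i j : nat) : reg (fun u => et d (iter i sh u) - et d (iter j sh u)).
  by apply: regB; apply: reg_shn; apply: reg_et.
apply: nz_prod => [i _|i _]; first by apply: reg_prod => j _.
apply: nz_prod => [j _|j ji]; first exact: rg.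
have [u wu du] := nz_shn j (nz_dl T (iter (i - j) hs d)).
exists u => //; have -> : iter i sh u = iter (i - j) sh (iter j sh u).
  by rewrite -iterD subnK // ltnW.
by rewrite et_diffn ?wt_shn0 // !mulf_neq0 // nu_neq0 // subn_gt0.
Qed.

Lemma ap_rev n i u : wt u != 0 -> (i < n)%N ->
  quad_up (iter i sh (io (level n) u)) = quad_down (iter (n - i.+1) sh u).
Proof.
move=> wu iN; rewrite shn_io_rev // 1?ltnW // -[(n - i)%N]prednK ?subn_gt0 //.
by rewrite iterS io_sh ?wt_shn0 // -subnS.
Qed.

Lemma am_rev n i u : wt u != 0 -> (i < n)%N ->
  quad_down (iter i sh (io (level n) u)) = quad_up (iter (n - i.+1) sh u).
Proof.
move=> wu iN; rewrite /quad_down shn_io_rev // 1?ltnW // -[(n - i)%N]prednK ?subn_gt0 //.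
by rewrite iterS io_sh ?wt_shn0 // ioK ?wt_hs0 ?wt_shn0 // -subnS.
Qed.

Lemma rf_io n j u : wt u != 0 -> (j <= n)%N -> gauge_prod n j (io (level n) u) = gauge_prod n (n - j) u.
Proof.
move=> wu jn; rewrite /gauge_prod mulrC; congr (_ * _).
  rewrite big_nat_rev -{1}(add0n j) big_addn big_mkord; apply: eq_bigr => i _.
  have ij := ltn_ord i; have -> : (j + n - (i + j).+1 = n - i.+1)%N by lia.
  by rewrite am_rev //; [congr (quad_up (iter _ _ _)); lia | lia].
rewrite [RHS]big_nat_rev -{1}(add0n (n - j)%N) big_addn subKn // big_mkord.
apply: eq_bigr => i _; have ij := ltn_ord i; rewrite ap_rev //; last by lia.
by congr (quad_down (iter _ _ _)); lia.
Qed.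

Lemma colv_io n c j u : wt u != 0 -> (j <= n)%N ->
  casorati_entry n c j (io (level n) u) = casorati_entry n c (n - j) u.
Proof.
by move=> wu jn; rewrite /casorati_entry rf_io // shn_io_rev // et_io ?wt_shn0.
Qed.

Definition sg n : K := (-1) ^+ odd_perm (perm (@rev_ord_inj n)).

Lemma cdet_io n F u : wt u != 0 -> casoratian n F (io (level n.-1) u) = sg n * casoratian n F u.
Proof.
move=> wu; have E := det_rev_rows n (fun i j => casorati_entry n.-1 (F j) i u).
rewrite /sg /casoratian -{}E; congr (\det _); apply/matrixP => i j.
rewrite !mxE colv_io //; move: (ltn_ord i); lia.
Qed.

Lemma phi_io n u : wt u != 0 -> eta_diffs n (io (level n.-1) u) = sg n * eta_diffs n u.
Proof.
pose V v := \det (\matrix_(i < n, j < n) et d (iter i sh v) ^+ j).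
have phiV v : eta_diffs n v = V v.
  rewrite /V -det_tr.
  rewrite (_ : _^T = Vandermonde n (\row_(i < n) et d (iter i sh v))); last first.
    by apply/matrixP => i j; rewrite !mxE.
  rewrite det_Vandermonde /eta_diffs (exchange_big_dep predT) //=.
  by apply: eq_bigr => i _; apply: eq_bigr => j _; rewrite !mxE.
move=> wu; have E := det_rev_rows n (fun i j => et d (iter i sh u) ^+ j).
rewrite !phiV /V /sg -{}E.
congr (\det _); apply/matrixP => i j; rewrite !mxE; congr (_ ^+ _).
have iN : (i <= n.-1)%N by move: (ltn_ord i); lia.
by rewrite shn_io_rev // et_io // wt_shn0.
Qed.

Lemma sg_neq0 n : sg n != 0. Proof. by rewrite /sg signr_eq0. Qed.

(** Under the reflection at level n - 1 the rows are reversed, so the Casoratian and [eta_diffs]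
    acquire the same sign. Their quotient is regular by [cdet_phi] and invariant, hence a polynomial
    in the coordinate of that level. *)
Lemma cdet_poly n F :
  exists P : {poly K}, eqv (casoratian n F) (fun u => eta_diffs n u * P.[et (level n.-1) u])
    /\ eqv (divided_det n F) (fun u => P.[et (level n.-1) u]).
Proof.
have we := wt_lv n.-1.
have [] := @reg_sym _ T (level n.-1) (divided_det n F) we (reg_ddet n F).
  apply: (@reg_eq_on _ T _ _ (eta_diffs n)); rewrite /=.
  - by apply: reg_io => //; apply: reg_ddet.
  - exact: reg_ddet.
  - exact: reg_phi.
  - exact: nz_phi.
  move=> u wu pu; have := cdet_io n F wu.
  rewrite !cdet_phi ?wt_io0 // phi_io // -mulrA => /(mulfI (sg_neq0 n)).
  exact: mulfI.
by move=> P PE; exists P; split => // u wu; rewrite cdet_phi // PE.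
Qed.

End Casoratian.

(** * The degree of a Casoratian quotient *)

Section Degree.
Variables (K : closedFieldType) (T : lattice K) (a b d : K).
Local Notation r := (lr T).
Local Notation k := (lk T).
Local Notation wt := (lwt T).
Local Notation sh := (lshift T).
Local Notation hs := (lshift_inv T).
Local Notation et := (leta T).
Local Notation nu := (lnum T).
Local Notation eqv := (eq_valid T).
Local Notation nz := (nonzero_fun T).
Local Notation am := (quad_down T a b d).
Local Notation lv := (level T d).
Local Notation qs := (divided_poly T a b d).
Local Notation ddet := (divided_det T a b d).
Local Notation dtab := (divided_diff T a b d).
Local Notation phi := (eta_diffs T d).

Let r0 : r != 0 := lr_neq0 T.
Let k0 : k != 0 := lk_neq0 T.

Hypotheses (wa : wt a != 0) (wb : wt b != 0) (wd : wt d != 0).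

(** [gauge_const] is the leading coefficient of [quad_down]. [gauge_node m] is chosen so that the
    divided differences of a gauged column have leading coefficients of the same shape as those of a
    plain one, with [nu m] replaced by [gauge_node m]. *)
Definition gauge_const : K := r * (wt a * wt b) / (k * wt d).
Definition gauge_node m : K :=
  (r * (wt a * wt b * nu m - r ^+ m * (a + b + (r - 1) * (a * b))) + r ^+ m * (d - 1))
  / (r * (wt a * wt b)).
Definition node (c : bool) m := if c then gauge_node m else nu m.

Lemma nuD i n : nu (i + n) = nu i + r ^+ i * nu n.
Proof.
elim: n => [|n IH]; first by rewrite addn0 nu0 mulr0 addr0.
by rewrite addnS !nuS IH exprD; ring.
Qed.

Lemma nu_subE m i : (i <= m)%N -> nu (m - i) = (nu m - nu i) / r ^+ i.
Proof.
move=> im; rewrite -{2}(subnKC im) nuD addrAC subrr add0r mulrC mulKf //.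
by rewrite expf_neq0.
Qed.

Lemma top_qs_plain p m c j : top m c p ->
  top m (c * \prod_(i < j) ((nu m - nu i) / (r ^+ i * nu i.+1))) ('X^j * qs (false, p) j).
Proof.
move=> tp; elim: j => [|j IH]; first by rewrite big_ord0 mulr1 mul1r.
have nz := nu_neq0 T (ltn0Sn j); have rj : r ^+ j != 0 by rewrite expf_neq0.
rewrite big_ord_recr /= [c * _]mulrA; set C := c * _ in IH *.
case: (topXn IH) => [[jm t]|[q0 C0]]; last first.
  rewrite q0 C0 mul0r /Dop size_poly0 big_ord0 scaler0 mulr0; exact: top0.
have := topZ (nu j.+1)^-1 (topDop T (lv j) t); rewrite nu_subE // => tt.
rewrite (_ : C * _ = (nu j.+1)^-1 * ((nu m - nu j) / r ^+ j * C)); last first.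
  by field; rewrite nz rj.
have tX : top j 1 ('X^j : {poly K}).
  by split; rewrite ?size_polyXn ?coefXn ?eqxx.
have := topM tX tt; rewrite mul1r subnKC // => H.
have E (q : {poly K}) : 'X^(j.+1) * ((nu j.+1)^-1 *: q) = 'X^j * ((nu j.+1)^-1 *: ('X * q)).
  by rewrite exprSr -mulrA scalerAr.
by rewrite E.
Qed.

Lemma top_qs_gauge p m c j : top m c p ->
  top m (c * \prod_(i < j) (gauge_const * (gauge_node m - nu i) / nu i.+1)) (qs (true, p) j).
Proof.
move=> tp; elim: j => [|j IH]; first by rewrite big_ord0 mulr1.
have nz := nu_neq0 T (ltn0Sn j); have rj : r ^+ j != 0 by rewrite expf_neq0.
rewrite big_ord_recr /= [c * _]mulrA; set C := c * _ in IH *.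
have := topAop T (lv j) (topQh T (lv j.+1) a b) (topQg T (lv j.+1) a b) IH.
rewrite add1n => /topXI /(topZ (nu j.+1)^-1).
set x := (X in top m X _ -> _); set y := (X in _ -> top m X _).
suff -> : x = y by [].
rewrite /x /y /Qg -/(iter j.+1 hs d) /level wt_hsn hsnE /gauge_const /gauge_node.
have wm : r ^+ m = 1 + (r - 1) * nu m := expE T m.
have rj1 : r ^+ j.+1 = r * (1 + (r - 1) * nu j) by rewrite exprS expE.
rewrite wm rj1 nuSl; move: nz rj; rewrite nuSl expE.
move: wa wb wd (l2_neq0 T) k0 r0; rewrite /lwt => wa' wb' wd' two k1 r1 nz rj.
by field; rewrite wa' wb' wd' two k1 r1 nz rj.
Qed.

Lemma L_am e l : wt e != 0 ->
  L T e 1 (gauge_const * r ^+ l) (fun u => am (iter l sh u)).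
Proof.
move=> we; set e' := lv l.+1; have we' : wt e' != 0 by rewrite wt_lv.
have rl : r ^+ l != 0 by rewrite expf_neq0.
apply: (@L_ext _ _ _ _ _ _ (fun u => wt a * wt b / wt e' *
  ((u - (e' - a) / wt a) * (u - (e' - b) / wt b) / wt u))).
  move=> u wu; rewrite am_shn // /quad_up wt_io // /lrefl -/e'.
  move: wa wb we' wu; rewrite /lwt => wa' wb' we1 wu; field.
  by rewrite wa' wb' we1 wu.
rewrite (_ : gauge_const * _ = wt a * wt b / wt e' * k^-1); last first.
  by rewrite /e' /level wt_hsn exprS /gauge_const; field; rewrite r0 rl k0 wd.
by apply: LZ; apply: L_quad.
Qed.

(** A divided difference lowers the order by one: in its polynomial part for a plain column, by the
    loss of one [quad_down] for a gauged column. The power of the coordinate makes up for this, so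
    that all rows have the same order. *)
Lemma L_dtab e n c m t i : wt e != 0 -> (i <= n)%N -> top m t c.2 ->
  L T e (if c.1 then m + n else m)
    ((if c.1 then t * gauge_const ^+ n * \prod_(l < n) r ^+ l else t) *
     (\prod_(s < i) (node c.1 m - nu s)) * \prod_(s < i) (r ^+ s * nu s.+1)^-1)
    (fun u => et e u ^+ i * dtab n c i 0 u).
Proof.
move=> we iN tp; case: c tp => -[] p /= tp; rewrite /divided_diff /=.
  have L1 : L T e (\sum_(i <= l < n) 1) (\prod_(i <= l < n) (gauge_const * r ^+ l))
     (fun u => \prod_(i <= l < n) am (iter l sh u)).
    by apply: L_prod => l; apply: L_am.
  have L2 := L_pet (lv i) we (top_qs_gauge i tp).
  have L3 := L_pet e we (_ : top i 1 'X^i).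
  have {}L3 := L3 (conj (eq_leq (size_polyXn _ i)) (_ : _ = 1)).
  have {}L3 : L T e i 1 (fun u => ('X^i).[et e u]).
    by apply: L3; rewrite coefXn eqxx.
  have := LM L3 (LM L1 L2); rewrite sum_nat_const_nat muln1 addnA subnKC // mul1r [(n + m)%N]addnC.
  set x := (X in L _ _ _ X _ -> _); set y := (X in _ -> L _ _ _ X _).
  suff -> : x = y.
    apply: L_ext => u wu; rewrite hornerXn big_ord0 mul1r; congr (_ * (_ * _)).
    by rewrite -[in RHS](add0n i) big_addn.
  rewrite /x /y; move: gauge_const (gauge_node m) => g X.
  have -> : \prod_(l < n) r ^+ l = \prod_(l < i) r ^+ l * \prod_(i <= l < n) r ^+ l.
    by rewrite -!(big_mkord xpredT (fun l => r ^+ l)) -big_cat_nat.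
  have -> : g ^+ n = g ^+ i * g ^+ (n - i) by rewrite -exprD subnKC.
  rewrite big_split /= prodr_const_nat !big_split /= prodr_const card_ord.
  rewrite !prodfV big_split /=.
  have rn : \prod_(s < i) r ^+ s != 0 by apply/prodf_neq0 => s _; rewrite expf_neq0.
  have nn : \prod_(s < i) nu s.+1 != 0 by apply/prodf_neq0 => s _; rewrite nu_neq0.
  by field; rewrite rn nn.
have tX : top i 1 ('X^i : {poly K}) by split; rewrite ?size_polyXn ?coefXn ?eqxx.
have := top_qs_plain i tp => tq.
set x := (X in L _ _ _ X _).
have -> : x = t * \prod_(s < i) ((nu m - nu s) / (r ^+ s * nu s.+1)).
  by rewrite /x -mulrA; congr (_ * _); rewrite big_split.
case: (topXn tq) => [[im tqi]|[q0 ->]].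
  have := LM (L_pet e we tX) (L_pet (lv i) we tqi); rewrite subnKC // mul1r.
  by apply: L_ext => u wu; rewrite hornerXn mul1r.
by apply: L_ext (L0 T e m) => u wu; rewrite q0 horner0 !mulr0.
Qed.

(* The leading coefficients form a Vandermonde matrix in the nodes. *)
Lemma size_ddet n (F : nat -> bool * {poly K}) (m : nat -> nat) P :
  (forall j, (j < n)%N -> size (F j).2 = (m j).+1) ->
  (forall i j, (i < j < n)%N -> node (F j).1 (m j) != node (F i).1 (m i)) ->
  eqv (ddet n F) (fun u => P.[et (lv n.-1) u]) ->
  (size P + 'C(n, 2) = (\sum_(j < n) (if (F j).1 then m j + n.-1 else m j)).+1)%N.
Proof.
move=> sF dn PE; set e := lv n.-1 in PE; have we : wt e != 0 by apply: wt_lv.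
pose N (j : 'I_n) := (if (F j).1 then m j + n.-1 else m j)%N.
pose C (j : 'I_n) : K := if (F j).1 then lead_coef (F j).2 * gauge_const ^+ n.-1 * \prod_(l < n.-1) r ^+ l
   else lead_coef (F j).2.
pose X (j : 'I_n) := node (F j).1 (m j).
pose H (i : 'I_n) : K := \prod_(s < i) (r ^+ s * nu s.+1)^-1.
have LT (i j : 'I_n) : L T e (N j) (C j * \prod_(s < i) (X j - nu s) * H i)
    (fun u => et e u ^+ i * dtab n.-1 (F j) i 0 u).
  by apply: L_dtab => //; [move: (ltn_ord i); lia | apply: top_size; apply: sF].
have := L_det LT; set c := (X in L _ _ _ X _) => Lc.
have c0 : c != 0.
  rewrite /c (_ : (\matrix_(i, j) _) = \matrix_(i, j) (H i * ((\prod_(s < i) (X j - nu s)) * C j))); last first.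
    by apply/matrixP => i j; rewrite !mxE; ring.
  rewrite det_scale_rows det_scale_cols det_newton_basis !mulf_neq0 //.
  - apply/prodf_neq0 => i _; apply/prodf_neq0 => s _; rewrite invr_eq0 mulf_neq0 ?expf_neq0 //.
    exact: nu_neq0.
  - apply/prodf_neq0 => i _; rewrite /C.
    have l0 : lead_coef (F i).2 != 0 by rewrite lead_coef_eq0 -size_poly_gt0 sF.
    case: (F i).1 => //; rewrite !mulf_neq0 // ?expf_neq0 //.
      by rewrite /gauge_const !mulf_neq0 ?invr_eq0 ?mulf_neq0.
    by apply/prodf_neq0 => l _; rewrite expf_neq0.
  apply/prodf_neq0 => i _; apply/prodf_neq0 => j ij; rewrite subr_eq0 /X.
  by apply: dn; rewrite ij ltn_ord.
(* Row i carries the i-th power of the coordinate, so the determinant is P times the power 0 + ... +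
   (n - 1) of 'X; this is the binomial in the statement. *)
have {Lc} : L T e (\sum_j N j) c (fun u => (P * 'X^(\sum_(i < n) i)).[et e u]).
  apply: L_ext Lc => u wu; rewrite det_scale_rows hornerM hornerXn.
  by rewrite -PE // mulrC; congr (_ * _); rewrite expr_sum.
move/(L_poly we) => t; have := topP t c0.
have P0 : P != 0.
  apply: contraNneq c0 => P0; move: t; rewrite P0 mul0r => -[_ <-].
  by rewrite coef0.
rewrite size_mulXn // => <-; rewrite addnC; congr (_ + _)%N.
by rewrite -bin2_sum big_mkord.
Qed.

End Degree.

(** * Multiplication by X *)

Lemma cramer_sum (R : comNzRingType) n (A : 'I_n -> 'I_n -> R) (b : 'I_n -> R) (i : 'I_n) :
  \sum_k A i k * \det (\matrix_(s, t) (if t == k then b s else A s t)) =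
  \det (\matrix_(s, t) A s t) * b i.
Proof.
set MA := \matrix_(s, t) A s t.
have E k : \det (\matrix_(s, t) (if t == k then b s else A s t)) = \sum_s b s * \adj MA k s.
  rewrite (expand_det_col _ k); apply: eq_bigr => s _.
  rewrite !mxE eqxx; congr (_ * (_ * _)); congr (\det _).
  by apply/matrixP => x y; rewrite !mxE eq_sym (negbTE (neq_lift _ _)).
rewrite (eq_bigr (fun k => \sum_s (b s * (A i k * \adj MA k s)))); last first.
  by move=> k _; rewrite E mulr_sumr; apply: eq_bigr => s _; rewrite mulrCA.
rewrite exchange_big /=.
rewrite (eq_bigr (fun s => b s * ((\det MA)%:M i s))); last first.
  move=> s _; rewrite -mulr_sumr -mul_mx_adj !mxE; congr (_ * _).
  by apply: eq_bigr => k _; rewrite !mxE.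
rewrite (bigD1 i) //= !mxE eqxx mulr1n mulrC big1 ?addr0 // => s si.
by rewrite !mxE eq_sym (negbTE si) mulr0n mulr0.
Qed.

Lemma det_last_col (R : comNzRingType) n (A : nat -> nat -> R) (b : nat -> R) (c : nat -> R) x :
  (forall i, (i <= n)%N -> b i = x * A i n - \sum_(k < n) A i k * c k) ->
  \det (\matrix_(i < n.+1, j < n.+1) (if (j < n)%N then A i j else b i)) =
  x * \det (\matrix_(i < n.+1, j < n.+1) A i j).
Proof.
move=> bE; pose U : 'M[R]_n.+1 := \matrix_(i, j)
  (if (j < n)%N then (i == j)%:R else if (i < n)%N then - c i else x).
rewrite (_ : (\matrix_(i, j) (if _ then _ else _)) = (\matrix_(i, j) A i j) *m U).
  rewrite det_mulmx mulrC; congr (_ * _); rewrite -det_tr det_trig.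
    rewrite big_ord_recr /= !mxE ltnn big1 ?mul1r // => i _.
    by rewrite !mxE /= ltn_ord eqxx.
  apply/is_trig_mxP => i j ij; rewrite !mxE.
  have -> : (i < n)%N by move: (ltn_ord j); lia.
  by case: eqP => // E; move: ij; rewrite E ltnn.
apply/matrixP => i j; rewrite !mxE; case: ltnP => jn.
  rewrite (bigD1 j) //= !mxE jn eqxx mulr1 big1 ?addr0 // => s sj.
  by rewrite !mxE jn (negbTE sj) mulr0.
rewrite big_ord_recr /= !mxE /= ltnNge jn /= ltnn mulrC.
rewrite bE; last by rewrite -ltnS.
rewrite addrC -sumrN; congr (_ + _); apply: eq_bigr => s _.
by rewrite !mxE /= ltnNge jn /= ltn_ord mulrN.
Qed.

(** * Solving first-order difference equations *)

Section Surjectivity.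
Variables (K : closedFieldType) (T : lattice K).
Local Notation r := (lr T).
Local Notation k := (lk T).
Local Notation wt := (lwt T).
Local Notation sh := (lshift T).
Local Notation hs := (lshift_inv T).
Local Notation et := (leta T).
Local Notation dl := (lwidth T).
Local Notation nu := (lnum T).

(** [Aop] raises the degree by exactly s, since its leading factors do not vanish, so top terms of f
    are removed one by one until the degree is below s. The equation is solvable exactly for s = 0
    and up to a constant for s = 1. *)
Lemma Aop_surj e (h g : {poly K}) s ch cg f : top s.+1 ch h -> top s.+1 cg ('X * g) ->
  (forall n, ch * nu n + cg / k * (1 + r ^+ n) != 0) ->
  exists z w : {poly K}, (size w <= s)%N /\ forall u, wt u != 0 ->
  (h.[et (hs e) u] + g.[et (hs e) u] * dl (hs e) u) * z.[et e (sh u)]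
  - (h.[et (hs e) u] - g.[et (hs e) u] * dl (hs e) u) * z.[et e u]
  = k * dl (hs e) u * (f - w).[et (hs e) u].
Proof.
move=> th tg ne; elim: {f}(size f) {-2}f (leqnn (size f)) => [|N IH] f sf.
  exists 0, 0; rewrite size_poly0; split => // u _; move: sf; rewrite leqn0 size_poly_eq0.
  by move/eqP ->; rewrite subr0 !horner0 !mulr0 subrr.
have [sN|Ns] := leqP N.+1 s.
  exists 0, f; split; first exact: leq_trans sN.
  by move=> u _; rewrite subrr !horner0 !mulr0 subrr.
have tf : top N f`_N f by [].
set l := ch * nu (N - s) + cg / k * (1 + r ^+ (N - s)).
have l0 : l != 0 by apply: ne.
pose z0 : {poly K} := (f`_N / l) *: 'X^(N - s).
have tz : top (N - s) (f`_N / l) z0.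
  rewrite -[f`_N / l]mulr1; apply: topZ.
  by split; rewrite ?size_polyXn ?coefXn ?eqxx.
have := topAop T e th tg tz; rewrite -/l mulrC mulfVK // => tA.
have {}tA : top N f`_N (Aop T e h g z0).
  by apply: topXI; move: tA; rewrite addSn subnKC.
have [|z [w [sw E]]] := IH (f - Aop T e h g z0).
  have [s1 c1] := topD tf (topN tA).
  rewrite leqNgt; apply/negP => s2; have sz : size (f - Aop T e h g z0) = N.+1.
    by apply/eqP; rewrite eqn_leq s1.
  have := lead_coef_eq0 (f - Aop T e h g z0); rewrite lead_coefE sz /= c1 subrr eqxx.
  by rewrite -size_poly_eq0 sz.
exists (z0 + z), w; split => // u wu.
have := AopE e h g z0 wu; have := E u wu; rewrite !hornerD !hornerN.
move: (h.[_]) (g.[_]) (z0.[et e u]) (z.[et e u]) (z0.[_]) (z.[_]) => H G a0 b0 a1 b1 E1 E2.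
transitivity (((H + G * dl (hs e) u) * a1 - (H - G * dl (hs e) u) * a0) +
   ((H + G * dl (hs e) u) * b1 - (H - G * dl (hs e) u) * b0)); first by ring.
by rewrite E1 E2 /Aop hornerD; ring.
Qed.

End Surjectivity.

(** * The Casoratian multiplied by X *)

Section Upper.
Variables (K : closedFieldType) (T : lattice K) (a b d : K).
Local Notation r := (lr T).
Local Notation k := (lk T).
Local Notation wt := (lwt T).
Local Notation sh := (lshift T).
Local Notation hs := (lshift_inv T).
Local Notation et := (leta T).
Local Notation io := (lrefl T).
Local Notation dl := (lwidth T).
Local Notation nu := (lnum T).
Local Notation reg := (regular_fun T).
Local Notation eqv := (eq_valid T).
Local Notation nz := (nonzero_fun T).
Local Notation ap := (quad_up T a b).
Local Notation am := (quad_down T a b d).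
Local Notation lv := (level T d).
Local Notation rf := (gauge_prod T a b d).
Local Notation colv := (casorati_entry T a b d).
Local Notation cdet := (casoratian T a b d).
Local Notation phi := (eta_diffs T d).

Let r0 : r != 0 := lr_neq0 T.

Variables (m : nat) (f : nat -> {poly K}).
Local Notation M := m.+1.

Definition plain_col (j : nat) : bool * {poly K} := (false, f j).
Definition last_gauge_col (p : {poly K}) (j : nat) := if (j < M)%N then (false, f j) else (true, p).
Definition Ncol (p : {poly K}) (i j : nat) := if j == i then (true, p) else (false, f j).

Hypotheses (wd : wt d != 0).

Variable Xi : {poly K}.
Hypothesis XiE : eqv (cdet M plain_col) (fun u => phi M u * Xi.[et (lv m) u]).

Hypothesis coprime_a : forall u i j, wt u != 0 ->
  am (iter i sh u) = 0 -> ap (iter j hs u) != 0.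

Let e' := lv M.+1.
Hypothesis zeta_lead : forall n,
  (wt e' + wt (hs a) * wt (hs b)) / (2 * wt e' * k) * nu n
  + Qg T e' (hs a) (hs b) / k * (1 + r ^+ n) != 0.

(** The two coefficients are exchanged by the reflection at e' and have order one, so [Aop_surj]
    leaves no remainder. The right-hand side fits because the level m coordinate at [sh y] is affine
    in the coordinate at e' ([et_shE]). *)
Lemma zeta_exists (g : {poly K}) : exists z : {poly K}, forall y, wt y != 0 ->
  ap (sh y) * z.[et (lv M) (sh y)] - am (iter m sh y) * z.[et (lv M) y]
  = k * dl e' y * g.[et (lv m) (sh y)].
Proof.
have we' : wt e' != 0 by apply: wt_lv.
pose G := r^-1 *: (g \Po (r *: 'X + (et (lv m) 1)%:P)).
have [z [w [sw E]]] := Aop_surj (lv M) G (topQh T e' (hs a) (hs b)) (topQg T e' (hs a) (hs b)) zeta_lead.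
exists z => y wy.
have wi : wt (io e' y) != 0 by apply: wt_io0.
have apE v : wt v != 0 -> ap (sh v) = r * ((v - hs a) * (v - hs b) / wt v).
  move=> wv; rewrite /quad_up wt_sh /lshift /lshift_inv; field; by rewrite wv r0.
have -> : am (iter m sh y) = ap (sh (io e' y)) by rewrite am_shn // -sh_io.
rewrite !apE // (QE _ _ we' wy) (QiE _ _ we' wy).
have := E y wy; rewrite -/e' -lvS -/e'.
have -> : w = 0 by apply/eqP; rewrite -size_poly_leq0.
have GE : G.[et e' y] = r^-1 * g.[et (lv m) (sh y)].
  by rewrite /G hornerZ horner_comp !horner_simpl (et_shE (lv m) wy).
rewrite subr0 GE => E2; set A := (X in r * X * _ - _); set B := (X in _ - r * X * _).
transitivity (r * (A * z.[et (lv M) (sh y)] - B * z.[et (lv M) y])); first by ring.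
by rewrite E2; field.
Qed.

(** The polynomial [n j] comes from the Casoratian whose j-th seed column is replaced by the gauged
    column of p; both sides of Cramer's rule then lose the factor [phi]. *)
Lemma cramerE p : exists n : 'I_M -> {poly K}, forall z i, wt z != 0 -> (i <= m)%N ->
  \sum_(j < M) (f j).[et d (iter i sh z)] * (n j).[et (lv m) z] =
  Xi.[et (lv m) z] * (rf m i z * p.[et d (iter i sh z)]).
Proof.
have /fin_all_exists [n nE] : forall j : 'I_M, exists P : {poly K},
    eqv (cdet M (Ncol p j)) (fun u => phi M u * P.[et (lv m) u]).
  by move=> j; have [P [PE _]] := cdet_poly a b wd M (Ncol p j); exists P.
exists n => z i wz im.
have rz q : reg (fun z => q.[et d (iter i sh z)]).
  by apply: (reg_shn i (f := fun v => q.[et d v])); apply: reg_pet.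
move: z wz; apply: (@reg_eq_on _ T
  (fun z => \sum_(j < M) (f j).[et d (iter i sh z)] * (n j).[et (lv m) z])
  (fun z => Xi.[et (lv m) z] * (rf m i z * p.[et d (iter i sh z)])) (phi M)).
- by apply: reg_sum => j _; apply: regM => //; apply: reg_pet.
- apply: regM; first exact: reg_pet.
  apply: regM => //; apply: regM; apply: reg_prod => l _; apply: reg_shn.
    exact: reg_ap.
  exact: reg_am.
- exact: reg_phi.
- exact: nz_phi.
move=> z wz pz; apply: (mulfI pz); rewrite mulrA -XiE // mulr_sumr.
have im' : (i < M)%N by [].
have := cramer_sum (fun s t : 'I_M => colv m (false, f t) s z)
  (fun s : 'I_M => colv m (true, p) s z) (Ordinal im').
rewrite [X in _ = _ * X -> _]/casorati_entry /= => <-; apply: eq_bigr => j _.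
rewrite {1}/casorati_entry /= mul1r mulrCA -nE //; congr (_ * _); rewrite /casoratian.
congr (\det _); apply/matrixP => s t; rewrite !mxE /Ncol.
by rewrite -(inj_eq val_inj); case: eqP.
Qed.

Lemma rfM_am i z : (i <= m)%N -> rf M i z = rf m i z * am (iter m sh z).
Proof. by move=> im; rewrite /gauge_prod big_nat_recr //= mulrA. Qed.

Lemma rf_sh j y : (j < M)%N ->
  rf M j.+1 y * am (iter M sh y) = ap y * rf M j (sh y).
Proof.
move=> jM; rewrite /gauge_prod big_ord_recl /=.
have -> : \prod_(j <= i < M) am (iter i sh (sh y)) =
   \prod_(j.+1 <= i < M) am (iter i sh y) * am (iter M sh y).
  have <- : \prod_(j.+1 <= i < M.+1) am (iter i sh y) =
     \prod_(j.+1 <= i < M) am (iter i sh y) * am (iter M sh y) by rewrite big_nat_recr.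
  by rewrite big_add1; apply: eq_bigr => i _; rewrite -iterSr.
have -> : \prod_(i < j) ap (iter i sh (sh y)) = \prod_(i < j) ap (sh (iter (0 + i) sh y)).
  by apply: eq_bigr => i _; rewrite -iterSr.
by rewrite !mulrA.
Qed.

Section StepT.
Variables (p X Y : {poly K}).
Hypothesis XE : forall y, wt y != 0 ->
  X.[et (lv M) (sh y)] - X.[et (lv M) y]
  = k * dl e' y * (Xi.[et (lv m) (sh y)] * Y.[et (lv m) (sh y)]).

Variables (n z : 'I_M -> {poly K}).
Hypothesis nE : forall z i, wt z != 0 -> (i <= m)%N ->
  \sum_(j < M) (f j).[et d (iter i sh z)] * (n j).[et (lv m) z] =
  Xi.[et (lv m) z] * (rf m i z * p.[et d (iter i sh z)]).
Hypothesis zE : forall j y, wt y != 0 ->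
  ap (sh y) * (z j).[et (lv M) (sh y)] - am (iter m sh y) * (z j).[et (lv M) y]
  = k * dl e' y * (n j * Y).[et (lv m) (sh y)].

Let S j y := \sum_(s < M) (f s).[et d (iter j sh y)] * (z s).[et (lv M) y].
(** The last column X r_j p reduced by a combination of the seed columns, with coefficients
    independent of the row j. The goal is that this equals r_j q for some polynomial q. *)
Let ej j y := X.[et (lv M) y] * (rf M j y * p.[et d (iter j sh y)])
  - ap y * am (iter m sh y) * S j y.

(** The gauge factors obey the same relation ([rf_sh]). The equation imposed on [z] is the one that
    makes the contribution of the difference of X cancel. *)
Lemma ej_rec j y : wt y != 0 -> (j < M)%N ->
  am (iter M sh y) * ej j.+1 y = ap y * ej j (sh y).
Proof.
move=> wy jM; rewrite /ej.
have wsy : wt (sh y) != 0 by rewrite wt_sh0.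
have -> : iter j.+1 sh y = iter j sh (sh y) by rewrite iterSr.
set P := p.[_].
have -> : am (iter m sh (sh y)) = am (iter M sh y) by rewrite -iterSr.
have E1 := rf_sh y jM; set R := rf M j.+1 y in E1 *.
have E2 : rf M j (sh y) = rf m j (sh y) * am (iter M sh y).
  by rewrite rfM_am // -iterSr.
have X2 := XE wy.
have SS : ap (sh y) * S j (sh y) - am (iter m sh y) * S j.+1 y =
   k * dl e' y * (Xi.[et (lv m) (sh y)] * (rf m j (sh y) * P)) * Y.[et (lv m) (sh y)].
  rewrite -nE // /S 2!mulr_sumr -sumrB mulr_sumr mulr_suml; apply: eq_bigr => s _.
  have -> : iter j.+1 sh y = iter j sh (sh y) by rewrite iterSr.
  transitivity ((f s).[et d (iter j sh (sh y))] * (ap (sh y) * (z s).[et (lv M) (sh y)]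
     - am (iter m sh y) * (z s).[et (lv M) y])); first by ring.
  by rewrite zE // hornerM; ring.
apply/eqP; rewrite -subr_eq0; apply/eqP.
transitivity (X.[et (lv M) y] * P * (R * am (iter M sh y))
  - X.[et (lv M) (sh y)] * P * (ap y * rf M j (sh y))
  + ap y * am (iter M sh y) * (ap (sh y) * S j (sh y) - am (iter m sh y) * S j.+1 y)); first by ring.
rewrite SS E1 E2.
transitivity (- (X.[et (lv M) (sh y)] - X.[et (lv M) y]) * P * (ap y * (rf m j (sh y) * am (iter M sh y)))
 + ap y * am (iter M sh y) *
  (k * dl e' y * (Xi.[et (lv m) (sh y)] * (rf m j (sh y) * P)) * Y.[et (lv m) (sh y)])); first by ring.
by rewrite X2; ring.
Qed.

Lemma ej_io y : wt y != 0 -> ej 0 (io (lv M) y) = ej M y.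
Proof.
move=> wy; have we : wt (lv M) != 0 by apply: wt_lv.
rewrite /ej et_io //; congr (_ * (_ * _) - _ * _).
- by rewrite rf_io // subn0.
- by rewrite shn_io_rev // subn0 et_io // wt_shn0.
- have E1 := ap_rev a b d wy (ltn0Sn m); have E2 := am_rev a b wd wy (ltnSn m).
  rewrite subn1 in E1; rewrite subnn in E2.
  by rewrite E2 mulrC; congr (_ * _); exact: E1.
rewrite /S; apply: eq_bigr => s _; rewrite et_io //.
by rewrite shn_io_rev // subn0 et_io // wt_shn0.
Qed.

(** For ej 0 to be a multiple of [rf M 0], a product of M values of [am], only A has to divide Q0:
    the factor of index m splits off at once ([ej0E]). B plays the same role at the other end. *)
Let A y := \prod_(i < m) am (iter i sh y).
Let B y := \prod_(i < m) ap (iter i.+1 sh y).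
Let Q0 y := A y * X.[et (lv M) y] * p.[et d y] - ap y * S 0 y.
Let Q1 y := B y * X.[et (lv M) y] * p.[et d (iter M sh y)] - am (iter m sh y) * S M y.

Lemma ej0E y : ej 0 y = am (iter m sh y) * Q0 y.
Proof.
rewrite /ej /Q0 /gauge_prod big_ord0 big_mkord big_ord_recr /= -/(A y); ring.
Qed.

Lemma ejME y : ej M y = ap y * Q1 y.
Proof.
by rewrite /ej /Q1 /gauge_prod [\prod_(_ <= _ < _) _]big_geq // big_ord_recl -/(B y) /=; ring.
Qed.

Lemma ej_iter j y : wt y != 0 -> (j <= M)%N ->
  (\prod_(i < j) am (iter (M + i) sh y)) * ej j y = (\prod_(i < j) ap (iter i sh y)) * ej 0 (iter j sh y).
Proof.
elim: j y => [|j IH] y wy jM; first by rewrite !big_ord0.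
rewrite big_ord_recl [in RHS]big_ord_recl addn0 /=.
have -> : \prod_(i < j) am (iter (M + bump 0 i) sh y) = \prod_(i < j) am (iter (M + i) sh (sh y)).
  by apply: eq_bigr => i _; rewrite /bump /= ?add1n addnS -iterSr.
have -> : \prod_(i < j) ap (sh (iter (0 + i) sh y)) = \prod_(i < j) ap (iter i sh (sh y)).
  by apply: eq_bigr => i _; rewrite -iterSr.
have -> : sh (iter j sh y) = iter j sh (sh y) by rewrite -iterSr.
have wsy : wt (sh y) != 0 by rewrite wt_sh0.
have IHy := IH (sh y) wsy (ltnW jM).
transitivity (\prod_(i < j) am (iter (M + i) sh (sh y)) * (am (iter M sh y) * ej j.+1 y)).
  by rewrite /=; ring.
rewrite ej_rec //.
transitivity (ap y * (\prod_(i < j) am (iter (M + i) sh (sh y)) * ej j (sh y))); first by ring.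
by rewrite IHy mulrA.
Qed.

Let regP q s : reg (fun y => q.[et d (iter s sh y)]).
Proof. by apply: (reg_shn s (f := fun v => q.[et d v])); apply: reg_pet. Qed.

Let reg_am' s : reg (fun y => am (iter s sh y)).
Proof. by apply: reg_shn; apply: reg_am. Qed.

Let reg_ap' s : reg (fun y => ap (iter s sh y)).
Proof. by apply: reg_shn; apply: reg_ap. Qed.

Let regS j : reg (S j).
Proof. by apply: reg_sum => s _; apply: regM => //; apply: reg_pet. Qed.

Let regA : reg A. Proof. by apply: reg_prod => i _. Qed.
Let regB' : reg B. Proof. by apply: reg_prod => i _. Qed.

Let regQ0 : reg Q0.
Proof.
apply: regB; last by apply: regM (regS _); apply: reg_ap.
by apply: regM; [apply: regM => //; apply: reg_pet | exact: (regP p 0)].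
Qed.

Let regQ1 : reg Q1.
Proof.
apply: regB; last by apply: regM.
by apply: regM => //; apply: regM => //; apply: reg_pet.
Qed.

Let nzA : nz A.
Proof.
by apply: nz_prod => i _ //; apply: nz_shn; apply: nz_am.
Qed.

(** Iterating [ej_rec] through all M steps links the first entry of the column to the last one. *)
Lemma Q01 y : wt y != 0 -> A (iter M sh y) * Q1 y = B y * Q0 (iter M sh y).
Proof.
move: y; apply: (@reg_eq_on _ T (fun y => A (iter M sh y) * Q1 y)
  (fun y => B y * Q0 (iter M sh y)) (fun y => ap y * am (iter (m + M) sh y))).
- by apply: regM => //; apply: reg_shn.
- by apply: regM => //; apply: reg_shn.
- by apply: regM; [apply: reg_ap | apply: reg_am'].
- apply: nzM; [exact: reg_ap | exact: reg_am' | exact: nz_ap | apply: nz_shn; exact: nz_am].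
move=> y wy ne; apply: (mulfI ne).
have E := ej_iter wy (leqnn M); rewrite ejME ej0E in E.
have P1 : \prod_(i < M) am (iter (M + i) sh y) = A (iter M sh y) * am (iter (m + M) sh y).
  rewrite big_ord_recr [(M + m)%N]addnC; congr (_ * _).
  by apply: eq_bigr => i _; rewrite -iterD addnC.
have P2 : \prod_(i < M) ap (iter i sh y) = ap y * B y by rewrite big_ord_recl.
have P3 : am (iter m sh (iter M sh y)) = am (iter (m + M) sh y) by rewrite -iterD.
rewrite P1 P2 P3 in E.
transitivity (A (iter M sh y) * am (iter (m + M) sh y) * (ap y * Q1 y)); first by ring.
by rewrite E; ring.
Qed.

(** By [Q01] and coprimality A divides Q0, so ej 0 is its gauge factor times a regular q0, and
    [ej_rec] carries this to every row. The symmetry [ej_io] makes q0 invariant under the reflection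
    at d, hence a polynomial, and a column operation finishes. *)
Lemma stepT_aux : exists q : {poly K}, forall y, wt y != 0 ->
  cdet M.+1 (last_gauge_col q) y = X.[et (lv M) y] * cdet M.+1 (last_gauge_col p) y.
Proof.
have [q0 rq0 Q0E] : exists2 q0, reg q0 & eqv Q0 (fun y => q0 y * A y).
  apply: (@coprime_div _ T A (fun y => B (iter M hs y)) Q0 (fun y => Q1 (iter M hs y))) => //.
  - exact: reg_hsn.
  - exact: reg_hsn.
  - move=> y wy /eqP; rewrite /A prodf_seq_eq0 => /hasP [i _ /= /eqP ai].
    rewrite /B; apply/prodf_neq0 => l _.
    have -> : iter l.+1 sh (iter M hs y) = iter (M - l.+1) hs y.
      have lM : (l.+1 <= M)%N by rewrite ltnW // ltnS.
      by rewrite -{1}(subnKC lM) iterD hsnK.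
    exact: coprime_a ai.
  move=> y wy; have wh : wt (iter M hs y) != 0 by rewrite wt_hsn0.
  by have := Q01 wh; rewrite hsnK => E; rewrite mulrC -E mulrC.
have ejE j y : wt y != 0 -> (j <= M)%N -> ej j y = rf M j y * q0 (iter j sh y).
  elim: j y => [|j IH] y wy jM.
    rewrite ej0E Q0E // /gauge_prod big_ord0 big_mkord big_ord_recr /= -/(A y); ring.
  move: y wy; apply: (@reg_eq_on _ T (ej j.+1) (fun y => rf M j.+1 y * q0 (iter j.+1 sh y))
     (fun y => am (iter M sh y))) => //.
  - apply: regB; last by apply: regM => //; apply: regM => //; apply: reg_ap.
    apply: regM; first exact: reg_pet.
    by apply: regM => //; apply: regM; apply: reg_prod.
  - by apply: regM; [apply: regM; apply: reg_prod | apply: reg_shn].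
  - by apply: nz_shn; apply: nz_am.
  move=> y wy ne; apply: (mulfI ne); rewrite ej_rec // IH ?wt_sh0 // 1?ltnW //.
  have -> : iter j.+1 sh y = iter j sh (sh y) by rewrite iterSr.
  by rewrite mulrA -rf_sh //; ring.
have [q qE] : exists q : {poly K}, eqv q0 (fun u => q.[et d u]).
  apply: reg_sym => // v wv; rewrite -(hsnK T M v).
  have : wt (iter M hs v) != 0 by rewrite wt_hsn0.
  move: (iter M hs v) => {wv}v; move: v.
  apply: (@reg_eq_on _ T (fun v => q0 (io d (iter M sh v))) (fun v => q0 (iter M sh v)) (rf M M)).
  - exact: (reg_shn M (f := fun v => q0 (io d v)) (reg_io wd rq0)).
  - exact: (reg_shn M rq0).
  - by apply: regM; apply: reg_prod.
  - apply: nzM; try by apply: reg_prod.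
      by apply: nz_prod => i _ //; apply: nz_shn; apply: nz_ap.
    by apply: nz_prod => i _ //; apply: nz_shn; apply: nz_am.
  move=> v wv ne; apply: (mulfI ne); rewrite -ejE // -ej_io // ejE ?wt_io0 ?wt_lv //.
  by rewrite rf_io // subn0 shn_io_rev // subn0.
exists q => y wy; rewrite /casoratian /=.
rewrite -(@det_last_col _ M (fun i j => colv M (last_gauge_col p j) i y)
  (fun i => colv M (true, q) i y)
  (fun s => ap y * am (iter m sh y) * (if insub s is Some s' then z s' else 0).[et (lv M) y])).
  congr (\det _); apply/matrixP => i j; rewrite !mxE /last_gauge_col; case: ltnP => // _.
move=> i iM; rewrite /casorati_entry /last_gauge_col ltnn /= -qE ?wt_shn0 // -ejE // /ej; congr (_ - _).
rewrite /S mulr_sumr; apply: eq_bigr => s _; rewrite ltn_ord /= mul1r.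
by rewrite valK; ring.
Qed.

End StepT.

(* Cramer's rule expresses Xi r_j p through the seed columns; a first-order
   difference equation for the coefficients then absorbs the difference of X. *)
Lemma stepT p X Y :
  (forall y, wt y != 0 -> X.[et (lv M) (sh y)] - X.[et (lv M) y]
    = k * dl e' y * (Xi.[et (lv m) (sh y)] * Y.[et (lv m) (sh y)])) ->
  exists q : {poly K}, forall y, wt y != 0 ->
  cdet M.+1 (last_gauge_col q) y = X.[et (lv M) y] * cdet M.+1 (last_gauge_col p) y.
Proof.
move=> XE; have [n nE] := cramerE p.
have /fin_all_exists [z zE] : forall j : 'I_M, exists z : {poly K}, forall y, wt y != 0 ->
    ap (sh y) * z.[et (lv M) (sh y)] - am (iter m sh y) * z.[et (lv M) y]
    = k * dl e' y * (n j * Y).[et (lv m) (sh y)].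
  by move=> j; apply: zeta_exists.
by have := stepT_aux XE nE zE.
Qed.

End Upper.

(** * The Darboux identity and nondegeneracy *)

Section Darboux.
Variables (R : comNzRingType) (m : nat).
Local Notation M := m.+1.
Variables (r : nat -> nat -> R) (B D U L : nat -> R).
Hypothesis rec : forall i c, (i <= M)%N -> (c <= M.+1)%N ->
  B i * r i.+2 c + D i * r i c = (U i - L c) * r i.+1 c.

Let minor t := \det (\matrix_(s < M.+1, c < M.+1) r s.+1 (bump t c)).
(** A linear form in v that vanishes on the rows 1, ..., M + 1 of r. *)
Let phi (v : nat -> R) := \det (\matrix_(s < M.+2, c < M.+2) (if (s < M.+1)%N then r s.+1 c else v c)).

Lemma phiE v : phi v = \sum_(c < M.+2) v c * ((-1) ^+ (M.+1 + c) * minor c).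
Proof.
rewrite /phi (expand_det_row _ ord_max); apply: eq_bigr => c _.
rewrite mxE /= ltnn /cofactor /=; congr (_ * (_ * \det _)).
by apply/matrixP => s t; rewrite !mxE lift_max ltn_ord.
Qed.

Lemma phi_row i : (i <= M)%N -> phi (r i.+1) = 0.
Proof.
move=> iM; have lt1 : (i < M.+2)%N by rewrite ltnW.
apply: (@determinant_alternate _ _ _ (Ordinal lt1) ord_max); first by rewrite neq_ltn /= ltnS iM.
by move=> c; rewrite !mxE /= ltnS iM ltnn.
Qed.

Lemma phi0 : phi (r 0) = (-1) ^+ M.+1 * \det (\matrix_(s < M.+2, c < M.+2) r s c).
Proof.
rewrite phiE (expand_det_row _ ord0) mulr_sumr; apply: eq_bigr => c _.
rewrite mxE /cofactor add0n exprD.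
have -> : \det (row' ord0 (col' c (\matrix_(s < M.+2, c < M.+2) r s c))) = minor c.
  by congr (\det _); apply/matrixP => s t; rewrite !mxE.
by rewrite /=; ring.
Qed.

Let colM t := if t == M :> nat then M.+1 else t.
Let g := \det (\matrix_(s < M.+1, c < M.+1) r s.+1 c).
Let g' := \det (\matrix_(s < M.+1, c < M.+1) r s.+1 (colM c)).
(** Cofactors along the last column: this combination of the rows 1, ..., M + 1 vanishes in the
    columns below M. *)
Let co (i : 'I_M.+1) := (-1) ^+ (i + M) *
  \det (\matrix_(s < M, c < M) r (bump i s).+1 c).

Lemma coE (f : nat -> R) :
  \sum_i co i * f i = \det (\matrix_(s < M.+1, c < M.+1) (if (c < M)%N then r s.+1 c else f s)).
Proof.
rewrite (expand_det_col _ ord_max); apply: eq_bigr => i _.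
rewrite mxE /= ltnn mulrC /cofactor /=; congr (_ * (_ * \det _)).
by apply/matrixP => s t; rewrite !mxE lift_max ltn_ord.
Qed.

Lemma co_col c : (c < M)%N -> \sum_i co i * r i.+1 c = 0.
Proof.
move=> cM; rewrite (coE (fun i => r i.+1 c)) -det_tr; have lt1 : (c < M.+1)%N by rewrite ltnW.
apply: (@determinant_alternate _ _ _ (Ordinal lt1) ord_max); first by rewrite neq_ltn /= cM.
by move=> s; rewrite !mxE /= cM ltnn.
Qed.

Lemma coM : \sum_i co i * r i.+1 M = g.
Proof.
rewrite (coE (fun i => r i.+1 M)); congr (\det _); apply/matrixP => s c; rewrite !mxE.
by case: ltnP => // cM; congr (r _ _); move: (ltn_ord c); lia.
Qed.

Lemma coM1 : \sum_i co i * r i.+1 M.+1 = g'.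
Proof.
rewrite (coE (fun i => r i.+1 M.+1)); congr (\det _); apply/matrixP => s c; rewrite !mxE /colM.
by case: ltnP => cM; [rewrite ltn_eqF | have -> : c = M :> nat by move: (ltn_ord c); lia]; rewrite ?eqxx.
Qed.

Lemma minorM1 : minor M.+1 = g.
Proof.
congr (\det _); apply/matrixP => s c; rewrite !mxE; congr (r _ _).
by rewrite /bump leqNgt ltn_ord.
Qed.

Lemma minorM : minor M = g'.
Proof.
congr (\det _); apply/matrixP => s c; rewrite !mxE /colM /bump; congr (r _ _).
by case: eqP (ltn_ord c) => [->|]; rewrite ?leqnn //; lia.
Qed.

(** The form [phi] is applied in two ways to the vector L c * y c, where y is the combination of
    rows given by [co]. Since y lives in the columns M and M + 1, the first way gives the left-hand
    side. By the recurrence each row is replaced by its two neighbours, on which [phi] vanishes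
    except at the two ends; these give the right-hand side. *)
Lemma darboux_identity :
  (L M.+1 - L M) * (g * g') =
  - (B M * \det (\matrix_(s < M, c < M) r s.+1 c) * \det (\matrix_(s < M.+2, c < M.+2) r s.+1 c))
  + D 0 * \det (\matrix_(s < M, c < M) r s.+2 c) * \det (\matrix_(s < M.+2, c < M.+2) r s c).
Proof.
have [y yE] : exists y, forall c, y c = \sum_i co i * r i.+1 c.
  by exists (fun c => \sum_i co i * r i.+1 c).
have -> : (L M.+1 - L M) * (g * g') = phi (fun c => L c * y c).
  rewrite phiE 2!big_ord_recr /= big1 ?add0r; last first.
    by move=> c _; rewrite yE co_col ?ltn_ord // mulr0 mul0r.
  rewrite minorM minorM1 !yE coM coM1.
  have s2 n : (-1) ^+ n.*2 = 1 :> R by rewrite -mul2n exprM sqrrN !expr1n.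
  by rewrite addnn s2 addSn addnn exprS s2; ring.
have -> : phi (fun c => L c * y c) = \sum_i co i * phi (fun c => L c * r i.+1 c).
  rewrite phiE (eq_bigr (fun c : 'I_M.+2 => \sum_i (co i * (L c * r i.+1 c * ((-1) ^+ (M.+1 + c) * minor c))))).
    by rewrite exchange_big; apply: eq_bigr => i _; rewrite phiE mulr_sumr.
  by move=> c _; rewrite yE mulr_sumr mulr_suml; apply: eq_bigr => i _; ring.
have E (i : 'I_M.+1) : phi (fun c => L c * r i.+1 c) = - (B i * phi (r i.+2)) - D i * phi (r i).
  have -> : phi (fun c => L c * r i.+1 c) = U i * phi (r i.+1) - B i * phi (r i.+2) - D i * phi (r i).
    rewrite !phiE !mulr_sumr -!sumrB; apply: eq_bigr => c _.
    have iM : (i <= M)%N by rewrite -ltnS.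
    have cM : (c <= M.+1)%N by rewrite -ltnS.
    have E := rec iM cM.
    have -> : L c * r i.+1 c = U i * r i.+1 c - (B i * r i.+2 c + D i * r i c) by rewrite E; ring.
    by ring.
  by rewrite phi_row ?mulr0 ?add0r // -ltnS.
rewrite (eq_bigr _ (fun i _ => congr1 _ (E i))) big_ord_recl big_ord_recr /=.
rewrite big1 ?add0r; last first.
  move=> i _; rewrite /bump /= !phi_row //; first by ring.
    by move: (ltn_ord i); lia.
  by move: (ltn_ord i); lia.
have bE : bump 0 m = M by [].
rewrite bE (phi_row (i := 1)) // (phi_row (i := m)) // phi0.
have -> : phi (r m.+3) = \det (\matrix_(s < M.+2, c < M.+2) r s.+1 c).
  congr (\det _); apply/matrixP => s c; rewrite !mxE; case: ltnP => // sM.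
  by have -> : s = M.+1 :> nat by move: (ltn_ord s); lia.
have -> : co (lift ord0 ord_max) = \det (\matrix_(s < M, c < M) r s.+1 c).
  rewrite /co /= /bump /= -signr_odd addnn odd_double mul1r; congr (\det _).
  apply/matrixP => s c; rewrite !mxE; congr (r _ _); move: (ltn_ord s); lia.
have -> : co ord0 = (-1) ^+ M * \det (\matrix_(s < M, c < M) r s.+2 c).
  by rewrite /co /= add0n; congr (_ * \det _); apply/matrixP => s c; rewrite !mxE.
set X := \det _; set Y := \det _; set Z := \det _; set V := \det _.
have S : (-1) ^+ M * (-1) ^+ M.+1 = -1 :> R.
  by rewrite -exprD addnS exprS addnn -mul2n exprM sqrrN !expr1n mulr1.
transitivity (- ((-1) ^+ M * (-1) ^+ M.+1) * (D 0 * X * Y) - B M * Z * V).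
  by ring.
by rewrite S; ring.
Qed.

End Darboux.

(** * Odd functions and antidifferences *)

Section Antidifference.
Variables (K : closedFieldType) (T : lattice K).
Local Notation k := (lk T).
Local Notation wt := (lwt T).
Local Notation sh := (lshift T).
Local Notation hs := (lshift_inv T).
Local Notation et := (leta T).
Local Notation io := (lrefl T).
Local Notation dl := (lwidth T).
Local Notation nu := (lnum T).

Lemma reg_antisym e f : wt e != 0 -> regular_fun T f ->
  (forall u, wt u != 0 -> f (io e u) = - f u) ->
  exists p : {poly K}, eq_valid T f (fun u => dl e u * p.[et e u]).
Proof.
move=> we fr fi; have [h [g E]] := reg_dec we fr.
exists (2^-1 *: g) => u wu; have := fi u wu.
rewrite hornerZ (E u wu) (E _ (wt_io0 we wu)) et_io // => F.
have two := l2_neq0 T.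
have -> : h.[et e u] = - (g.[et e u] * (u + io e u)) / 2.
  apply: (mulIf two); rewrite mulfVK //; apply/eqP; rewrite -subr_eq0; apply/eqP.
  transitivity ((h.[et e u] + g.[et e u] * io e u) + (h.[et e u] + g.[et e u] * u)); first by ring.
  by rewrite F; ring.
by rewrite /lwidth; field.
Qed.

(** [Dop] lowers the degree by exactly one because the [nu] do not vanish, so it is inverted from
    the top down; the free constant is spent on the value at 0. This provides the polynomial that
    [Imap] selects. *)
Lemma Dop_surj e (f : {poly K}) : wt e != 0 -> f != 0 ->
  exists p : {poly K}, [/\ p.[0] = 0, size p = (size f).+1 &
  forall u, wt u != 0 -> p.[et e (sh u)] - p.[et e u] = k * dl (hs e) u * f.[et (hs e) u]].
Proof.
move=> we f0.
have ex N (f1 : {poly K}) : (size f1 <= N)%N -> exists p : {poly K}, (size p <= N.+1)%N /\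
  forall u, wt u != 0 -> p.[et e (sh u)] - p.[et e u] = k * dl (hs e) u * f1.[et (hs e) u].
  clear f f0; elim: N f1 => [|N IH] f sf.
    exists 0; rewrite size_poly0; split => // u _; move: sf; rewrite leqn0 size_poly_eq0.
    by move/eqP ->; rewrite !horner0 mulr0 subrr.
  have nonzero_fun := nu_neq0 T (ltn0Sn N).
  pose z : {poly K} := (f`_N / nu N.+1) *: 'X^(N.+1).
  have tz : top N.+1 (f`_N / nu N.+1) z.
    rewrite -[f`_N / nu N.+1]mulr1; apply: topZ.
    by split; rewrite ?size_polyXn ?coefXn ?eqxx.
  have := topDop T e tz; rewrite mulrC mulfVK // => /topXI tD.
  have [|p [sp E]] := IH (f - Dop T e z).
    have [s1 c1] := topD (top_le sf) (topN tD).
    rewrite leqNgt; apply/negP => s2; have sz : size (f - Dop T e z) = N.+1.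
      by apply/eqP; rewrite eqn_leq s1.
    have := lead_coef_eq0 (f - Dop T e z); rewrite lead_coefE sz /= c1 subrr eqxx.
    by rewrite -size_poly_eq0 sz.
  exists (z + p); split.
    rewrite (leq_trans (size_polyD _ _)) // geq_max.
    by apply/andP; split; [case: tz | rewrite leqW].
  move=> u wu; have := DopE e z wu; have := E u wu; rewrite !hornerD !hornerN => E1 E2.
  by rewrite opprD addrACA E1 E2; ring.
have [p [sp E]] := ex _ f (leqnn _).
have DE : Dop T e p = f.
  apply/eqP; rewrite -subr_eq0; apply/eqP; apply: (@et_poly0 _ T (hs e)); first by rewrite wt_hs0.
  apply: (@reg_cancel _ T _ (dl (hs e))).
  - exact: reg_pet.
  - exact: reg_dl.
  - exact: nz_dl.
  move=> u wu du; have kd : k * dl (hs e) u != 0 by rewrite mulf_neq0 // (lk_neq0 T).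
  by apply: (mulfI kd); rewrite hornerD hornerN mulrBr -DopE // E // subrr mulr0.
have p0 : p != 0 by apply: contraNneq f0 => p0; rewrite -DE p0 /Dop size_poly0 big_ord0.
have sf : (size f < size p)%N.
  have [n sn] : exists n, size p = n.+1 by exists (size p).-1; rewrite prednK // size_poly_gt0.
  have [] := topDop T e (top_size sn); rewrite DE mulrC size_mulX // sn.
  by [].
have s1 : (1 < size p)%N by apply: leq_trans sf; rewrite ltnS size_poly_gt0.
exists (p - (p.[0])%:P); split.
- by rewrite hornerD hornerN hornerC subrr.
- rewrite size_polyDl; first by apply/eqP; rewrite eqn_leq sp.
  by rewrite size_polyN (leq_ltn_trans _ s1) // size_polyC_leq1.
by move=> u wu; rewrite !hornerD !hornerN !hornerC -E //; ring.
Qed.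
End Antidifference.

(** * Nondegeneracy of the reduced operator *)

Section Nondegenerate.
Variables (K : closedFieldType) (T : lattice K) (d : K).
Local Notation r := (lr T).
Local Notation k := (lk T).
Local Notation wt := (lwt T).
Local Notation sh := (lshift T).
Local Notation hs := (lshift_inv T).
Local Notation et := (leta T).
Local Notation io := (lrefl T).
Local Notation dl := (lwidth T).
Local Notation nu := (lnum T).
Local Notation reg := (regular_fun T).
Local Notation eqv := (eq_valid T).
Local Notation nz := (nonzero_fun T).
Local Notation lv := (level T d).

Hypothesis wd : wt d != 0.
Variables (M : nat) (N Ns : K -> K).
Hypotheses (rN : reg N) (nN : nz N).
Hypothesis NsE : forall u, wt u != 0 -> Ns u = N (io (lv M) u).
Hypothesis Ns0 : Ns 0 = 0.
Hypothesis NsN : forall u n, wt u != 0 -> Ns u = 0 -> N (iter n sh u) != 0.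
Variables (h g : nat -> {poly K}) (ch cg : nat -> K).
Hypothesis Ndec : forall s v, wt v != 0 ->
  N (iter s.+1 sh v) = (h s).[et (lv (M + s).+2) v] + (g s).[et (lv (M + s).+2) v] * dl (lv (M + s).+2) v.
Hypothesis toph : forall s, top 2 (ch s) (h s).
Hypothesis topg : forall s, top 2 (cg s) ('X * g s).
Hypothesis Nlead : forall s n, ch s * nu n + cg s / k * (1 + r ^+ n) != 0.

(** The index s counts the parameter shifts made by the descent in [nondegenerate]. *)
Definition twisted_diff s (c : K -> K) u := N (iter s sh u) * c u - Ns u * c (hs u).

Let wl s : wt (lv s) != 0. Proof. exact: wt_lv. Qed.

Lemma reg_Ns : reg Ns.
Proof. by apply: (reg_ext NsE); apply: reg_io. Qed.

Lemma Ns_sh s v : wt v != 0 -> Ns (sh v) = N (iter s.+1 sh (io (lv (M + s).+2) v)).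
Proof.
move=> wv; rewrite NsE ?wt_sh0 // io_sh // -lvS; congr N.
have -> : lv (M + s).+2 = iter s.+1 hs (lv M.+1) by rewrite /level -iterD addnS addSn addnC.
by rewrite shn_io.
Qed.

Lemma DN_sh s (p : {poly K}) v : wt v != 0 ->
  twisted_diff s (fun u => p.[et (lv (M + s).+1) u]) (sh v) =
  k * dl (lv (M + s).+2) v * (Aop T (lv (M + s).+1) (h s) (g s) p).[et (lv (M + s).+2) v].
Proof.
move=> wv; rewrite /twisted_diff shK (Ns_sh s wv) -iterSr Ndec // Ndec ?wt_io0 //.
by rewrite et_io // dl_io // mulrN -AopE.
Qed.

(** At the boundary point 0, where [Ns] vanishes, the equation forces c 0 = 0. It then forces c to
    vanish along the forward orbit of 0, because N has no zero there. *)
Lemma DN_null s c : reg c -> eqv (twisted_diff s c) (fun=> 0) -> eqv c (fun=> 0).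
Proof.
move=> rc E; have w0 : wt 0 != 0 by rewrite wt0 oner_neq0.
have numer0 i : N (iter i sh 0) != 0 by apply: NsN.
apply: (reg_orbit0 rc w0); elim=> [|i IH].
  have := E 0 w0; rewrite /twisted_diff Ns0 mul0r subr0 => /eqP.
  by rewrite mulf_eq0 (negbTE (numer0 s)) => /eqP.
have := E (iter i.+1 sh 0); rewrite wt_shn0 => /(_ w0).
rewrite /twisted_diff -iterD [hs _]shK IH mulr0 subr0 => /eqP.
by rewrite mulf_eq0 (negbTE (numer0 _)) => /eqP.
Qed.

Lemma DN_sym s c u : wt u != 0 ->
  twisted_diff s c (io (lv (M + s)) u) = - twisted_diff s (fun v => c (io (lv (M + s).+1) v)) u.
Proof.
move=> wu; rewrite /twisted_diff.
have E1 : io (lv (M + s)) u = io (lv M) (iter s sh u).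
  by rewrite io_shn // /level -iterD addnC.
have -> : N (iter s sh (io (lv (M + s)) u)) = Ns u.
  by rewrite NsE //; have -> : lv (M + s) = iter s hs (lv M); rewrite ?shn_io // /level -iterD addnC.
have -> : Ns (io (lv (M + s)) u) = N (iter s sh u).
  by rewrite NsE ?wt_io0 // E1 ioK // wt_shn0.
have -> : hs (io (lv (M + s)) u) = io (lv (M + s).+1) u by rewrite lvS -sh_io // shK.
have -> : io (lv (M + s)) u = io (lv (M + s).+1) (hs u) by rewrite lvS -io_sh ?wt_hs0 // hsK.
by ring.
Qed.

(** By [DN_sym] the reflection of c has the same image as c, so by injectivity c is invariant, hence
    a polynomial in the coordinate. Its degree is smaller than that of P because [Aop] raises
    degrees by exactly one here. *)
Lemma DN_poly s (P : {poly K}) c : P != 0 -> reg c ->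
  eqv (fun u => P.[et (lv (M + s)) u] * dl (lv (M + s)) u) (twisted_diff s c) ->
  exists p : {poly K}, [/\ p != 0, (size p < size P)%N &
    eqv c (fun u => p.[et (lv (M + s).+1) u])].
Proof.
move=> P0 rc E; have [p pE] : exists p : {poly K}, eqv c (fun u => p.[et (lv (M + s).+1) u]).
  apply: reg_sym => //.
  suff : eqv (fun u => c (io (lv (M + s).+1) u) - c u) (fun=> 0).
    by move=> H u wu; apply: subr0_eq; apply: H.
  apply: (@DN_null s); first by apply: regB => //; apply: reg_io.
  move=> u wu; have E1 := E u wu; have := E _ (wt_io0 (wl (M + s)) wu).
  rewrite et_io // dl_io // DN_sym // mulrN E1 => /oppr_inj E2.
  have -> : twisted_diff s (fun u => c (io (lv (M + s).+1) u) - c u) u =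
    twisted_diff s (fun u => c (io (lv (M + s).+1) u)) u - twisted_diff s c u by rewrite /twisted_diff; ring.
  by rewrite -E2 subrr.
have [e eE] : exists e, e = lv (M + s).+2 by eexists.
pose aff : {poly K} := r *: 'X + (et (lv (M + s)) 1)%:P.
have AE : Aop T (lv (M + s).+1) (h s) (g s) p = (r / k) *: (P \Po aff).
  apply/eqP; rewrite -subr_eq0; apply/eqP.
  apply: (@et_poly0 _ T (lv (M + s).+2)) => //.
  apply: (@reg_cancel _ T _ (dl (lv (M + s).+2))); [exact: reg_pet|exact: reg_dl|exact: nz_dl|].
  move=> v wv dv; have kd : k * dl (lv (M + s).+2) v != 0 by rewrite mulf_neq0 // (lk_neq0 T).
  apply: (mulfI kd); rewrite hornerD hornerN mulrBr -DN_sh // mulr0.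
  have wsv : wt (sh v) != 0 by rewrite wt_sh0.
  have -> : twisted_diff s (fun u => p.[et (lv (M + s).+1) u]) (sh v) = twisted_diff s c (sh v).
    by rewrite /twisted_diff -!pE // shK.
  rewrite -E // dl_sh // et_shE // hornerZ horner_comp /aff hornerD hornerZ hornerX hornerC.
  by field; apply: (lk_neq0 T).
have p0 : p != 0.
  apply: contraNneq P0 => p0; apply/eqP; apply: (@et_poly0 _ T (lv (M + s))) => //.
  apply: (@reg_cancel _ T _ (dl (lv (M + s)))); [exact: reg_pet|exact: reg_dl|exact: nz_dl|].
  move=> u wu du; apply: (mulIf du); rewrite (E u wu) /twisted_diff !pE ?wt_hs0 // p0.
  by rewrite !horner0 !mulr0 subrr mul0r.
have [n sn] : exists n, size p = n.+1 by exists (size p).-1; rewrite prednK // size_poly_gt0.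
have := topAop T (lv (M + s).+1) (toph s) (topg s) (top_size sn).
rewrite add2n => /topXI tA; have sA := topP tA _.
have {sA} : size (Aop T (lv (M + s).+1) (h s) (g s) p) = n.+2.
  by apply: sA; rewrite mulf_neq0 ?Nlead // lead_coef_eq0.
rewrite AE size_scale ?mulf_neq0 ?invr_eq0 ?(lk_neq0 T) ?(lr_neq0 T) // => sP.
exists p; split => //; rewrite sn; apply: leq_trans (_ : size (P \Po aff) <= size P)%N.
  by rewrite sP.
have sa : size aff = 2.
  rewrite /aff size_polyDl size_scale ?(lr_neq0 T) // size_polyX //.
  by rewrite (leq_ltn_trans (size_polyC_leq1 _)).
rewrite (leq_trans (size_comp_poly_leq _ _)) // sa muln1.
by case: (size P) (size_poly_gt0 P) => // ; rewrite P0.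
Qed.

(** Descent on the degree of P: the preimage of P dl is a polynomial p of smaller degree, and every
    multiple of p is in turn an image at stage s + 1. *)
Lemma nondegenerate s (P : {poly K}) : P != 0 ->
  ~ (forall t : {poly K}, exists2 c, reg c &
       eqv (fun u => (P * t).[et (lv (M + s)) u] * dl (lv (M + s)) u) (twisted_diff s c)).
Proof.
elim: {P}(size P) {-2}P (leqnn (size P)) s => [|n IH] P sP s P0.
  by move: P0; rewrite -size_poly_gt0 ltnNge sP.
move=> H; have [c rc E] := H 1; rewrite mulr1 in E.
have [p [p0 sp pE]] := DN_poly P0 rc E.
apply: (IH p _ s.+1 p0); first by rewrite -ltnS (leq_trans sp).
move=> t.
(* At stage s + 1 the multiple p t is reached up to a constant C; the rest of the proof shows C =
   0. *)
have [z [C zE]] : exists (z : {poly K}) (C : K), forall u, wt u != 0 ->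
    (p * t).[et (lv (M + s.+1)) u] * dl (lv (M + s.+1)) u =
    twisted_diff s.+1 (fun u => z.[et (lv (M + s.+1).+1) u]) u + C * dl (lv (M + s.+1)) u.
  pose aff : {poly K} := r *: 'X + (et (lv (M + s.+1)) 1)%:P.
  have [z [w [sw zE]]] := Aop_surj (lv (M + s.+1).+1) ((r / k) *: ((p * t) \Po aff)) (toph s.+1) (topg s.+1) (Nlead s.+1).
  exists z, (k * w`_0 / r) => u wu; rewrite -(hsK T u); set v := hs u.
  have wv : wt v != 0 by rewrite wt_hs0.
  have wC : w = (w`_0)%:P by apply: size1_polyC.
  rewrite {1}/twisted_diff shK (Ns_sh s.+1 wv) -iterSr Ndec // Ndec ?wt_io0 //.
  rewrite et_io // dl_io // mulrN; have := zE v wv; rewrite -lvS => ->.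
  rewrite dl_sh // et_shE // wC coefC /= hornerD hornerN hornerC hornerZ horner_comp.
  rewrite /aff hornerD hornerZ hornerX hornerC.
  by field; rewrite (lk_neq0 T) (lr_neq0 T).
suff C0 : C = 0.
  exists (fun u => z.[et (lv (M + s.+1).+1) u]); first exact: reg_pet.
  by move=> u wu; rewrite zE // C0 mul0r addr0.
have [->//|C0] := eqVneq C 0.
(* An antidifference Tp of t: the product rule for Tp times c brings t into play, while P Tp is
   itself an image at stage s. *)
have [Tp TE] : exists Tp : {poly K}, forall u, wt u != 0 ->
   Tp.[et (lv (M + s)) (sh u)] - Tp.[et (lv (M + s)) u] = k * dl (lv (M + s).+1) u * t.[et (lv (M + s).+1) u].
  have [->|t0] := eqVneq t 0.
    by exists 0 => u wu; rewrite !horner0 mulr0 subrr.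
  by have [q [_ _ qE]] := Dop_surj (wl (M + s)) t0; exists q.
have [cT rcT cTE] := H Tp.
(* By the product rule the first two terms have the image k N(sh ^ s u) p t dl, and the last has k
   N(sh ^ s u) times the stage s + 1 image of z. The difference is k C N(sh ^ s u) dl. *)
pose dd u := Tp.[et (lv (M + s)) (sh u)] * c u - cT u
   - k * (N (iter s.+1 sh u) * z.[et (lv (M + s.+1).+1) u]).
have rd : reg dd.
  apply: regB; last by apply: regMc; apply: regM; [apply: reg_shn | apply: reg_pet].
  by apply: regB => //; apply: regM => //; apply: (reg_sh (f := fun v => Tp.[et _ v])); apply: reg_pet.
have ddE u : wt u != 0 -> twisted_diff s dd u = k * C * N (iter s sh u) * dl (lv (M + s.+1)) u.
  move=> wu; have E1 := E u wu; have E2 := cTE u wu; have E3 := zE u wu.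
  have E4 := TE u wu; have E5 := pE u wu.
  rewrite /= hornerM in E2; rewrite hornerM addnS -E5 in E3.
  set DT := twisted_diff s cT u in E2; set Dc := twisted_diff s c u in E1.
  set Dz := twisted_diff s.+1 _ u in E3.
  transitivity ((Tp.[et (lv (M + s)) (sh u)] - Tp.[et (lv (M + s)) u]) * N (iter s sh u) * c u
    + Tp.[et (lv (M + s)) u] * Dc - DT - k * N (iter s sh u) * Dz).
    have e1 : iter s.+1 sh (hs u) = iter s sh u by rewrite iterSr hsK.
    by rewrite /dd /Dc /DT /Dz /twisted_diff e1 hsK addnS; ring.
  rewrite -E1 -E2 E4 -addnS.
  transitivity (k * N (iter s sh u) * (c u * t.[et (lv (M + s).+1) u] * dl (lv (M + s).+1) u - Dz)).
    by rewrite addnS; ring.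
  by rewrite E3 addnS; ring.
have nNs : nz (fun u => N (iter s sh u)) by apply: nz_shn.
have rNs' : reg (fun u => N (iter s sh u)) by apply: reg_shn.
(* N(sh ^ s u) divides Ns u * dd (hs u) and has no common zero with Ns. Cancelling it turns the
   equation of stage s into one of stage s + 1. *)
have [q rq qE] : exists2 q, reg q & eqv (fun u => dd (hs u)) (fun u => q u * N (iter s sh u)).
  apply: (@coprime_div _ T (fun u => N (iter s sh u)) Ns _ (fun u => dd u - k * C * dl (lv (M + s.+1)) u)) => //.
  - exact: reg_Ns.
  - exact: reg_hs.
  - by apply: regB => //; apply: regMc; apply: reg_dl.
  - move=> u wu Nu; apply/negP => /eqP Nsu.
    by have := NsN s wu Nsu; rewrite Nu eqxx.
  move=> u wu; have := ddE u wu; rewrite /twisted_diff => E1.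
  transitivity (N (iter s sh u) * dd u - (N (iter s sh u) * dd u - Ns u * dd (hs u))); first by ring.
  by rewrite E1; ring.
pose q' u := q (sh u).
have rq' : reg q' by apply: reg_sh.
have key : eqv (fun u => (k * C)%:P.[et (lv (M + s.+1)) u] * dl (lv (M + s.+1)) u) (twisted_diff s.+1 q').
  apply: (@reg_eq_on _ T _ _ (fun u => N (iter s sh u))) => //.
  - by apply: regM; [apply: reg_pet | apply: reg_dl].
  - apply: regB; first by apply: regM => //; apply: reg_shn.
    by apply: regM; [apply: reg_Ns | apply: (reg_hs (f := q'))].
  move=> u wu Nu; apply: (mulfI Nu); rewrite hornerC.
  have := ddE u wu; rewrite {1}/twisted_diff (qE u wu).
  have wsu : wt (sh u) != 0 by rewrite wt_sh0.
  have := qE _ wsu; rewrite shK -iterSr => -> E1.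
  rewrite /twisted_diff /q' hsK; transitivity (k * C * N (iter s sh u) * dl (lv (M + s.+1)) u); first by ring.
  by rewrite -E1 iterSr; ring.
(* A nonzero constant would have a nonzero preimage of degree smaller than its own. *)
have [|p' [p'0 sp' _]] := DN_poly _ rq' key.
  by rewrite polyC_eq0 mulf_neq0 // (lk_neq0 T).
move: sp'; rewrite size_polyC mulf_neq0 ?(lk_neq0 T) // ltnS leqn0 size_poly_eq0.
by rewrite (negbTE p'0).
Qed.

End Nondegenerate.

(** * Expansion of X times a Casoratian quotient *)

Lemma poly_basis (K : fieldType) (p : nat -> {poly K}) (q : {poly K}) :
  (forall n, size (p n) = n.+1) ->
  exists c : nat -> K, q = \sum_(j < size q) c j *: p j.
Proof.
move=> sp; suff ex N (q1 : {poly K}) : (size q1 <= N)%N ->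
    exists c : nat -> K, q1 = \sum_(j < N) c j *: p j by apply: ex.
elim: N q1 => [|N IH] q1 s1.
  by exists (fun=> 0); rewrite big_ord0; apply/eqP; rewrite -size_poly_leq0.
have l0 : lead_coef (p N) != 0 by rewrite lead_coef_eq0 -size_poly_gt0 sp.
pose x := q1`_N / lead_coef (p N).
have [|c E] := IH (q1 - x *: p N).
  have s2 : (size (q1 - x *: p N)%R <= N.+1)%N.
    by rewrite (leq_trans (size_polyD _ _)) // geq_max s1 size_polyN (leq_trans (size_scale_leq _ _)) ?sp.
  rewrite leqNgt; apply/negP => s3; have sz : size (q1 - x *: p N) = N.+1.
    by apply/eqP; rewrite eqn_leq s2.
  have := lead_coef_eq0 (q1 - x *: p N); rewrite lead_coefE sz /= coefB coefZ.
  have -> : (p N)`_N = lead_coef (p N) by rewrite lead_coefE sp.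
  by rewrite /x mulfVK // subrr eqxx -size_poly_eq0 sz.
exists (fun j => if j == N then x else c j); rewrite big_ord_recr /= eqxx.
rewrite -[LHS](subrK (x *: p N)) E; congr (_ + _); apply: eq_bigr => j _.
by rewrite ltn_eqF.
Qed.

(** The degrees l + j increase with j, so coefficients beyond the degree of q vanish one by one from
    the top; missing ones are filled with 0. *)
Lemma sum_top_zero (K : fieldType) (g : nat -> {poly K}) l (c : nat -> K) N q n :
  (forall j, size (g j) = (l + j).+1) -> q = \sum_(j < N) c j *: g j ->
  (size q <= l + n)%N -> q = \sum_(j < n) (if (j < N)%N then c j else 0) *: g j.
Proof.
move=> sg; elim: N => [|N IH] qE sq.
  by rewrite qE big_ord0 big1 // => j _; rewrite scale0r.
have [nN|Nn] := leqP n N.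
  have cN : c N = 0.
    have l0 : lead_coef (g N) != 0 by rewrite lead_coef_eq0 -size_poly_gt0 sg.
    have := congr1 (fun p : {poly K} => p`_(l + N)) qE.
    rewrite nth_default; last by rewrite (leq_trans sq) // leq_add2l.
    rewrite big_ord_recr /= coefD coefZ coef_sum big1 ?add0r; last first.
      by move=> j _; rewrite coefZ [(g j)`__]nth_default ?mulr0 // sg ltn_add2l.
    have -> : (g N)`_(l + N) = lead_coef (g N) by rewrite lead_coefE sg.
    by move/esym/eqP; rewrite mulf_eq0 (negbTE l0) orbF => /eqP.
  rewrite big_ord_recr /= cN scale0r addr0 in qE.
  rewrite IH //; apply: eq_bigr => j _; rewrite ltnS.
  by have jN := leq_trans (ltn_ord j) nN; rewrite jN ltnW.
rewrite qE (big_ord_widen n (fun j => c j *: g j)) // big_mkcond.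
by apply: eq_bigr => j _; case: ifP => // _; rewrite scale0r.
Qed.

Section Abstract.
Variables (K : closedFieldType) (T : lattice K) (a b c d : K).
Local Notation r := (lr T).
Local Notation k := (lk T).
Local Notation wt := (lwt T).
Local Notation sh := (lshift T).
Local Notation hs := (lshift_inv T).
Local Notation et := (leta T).
Local Notation io := (lrefl T).
Local Notation dl := (lwidth T).
Local Notation nu := (lnum T).
Local Notation eqv := (eq_valid T).
Local Notation ap := (quad_up T a b).
Local Notation am := (quad_down T a b d).
Local Notation lv := (level T d).
Local Notation colv := (casorati_entry T a b d).
Local Notation cdet := (casoratian T a b d).
Local Notation phi := (eta_diffs T d).

Let k0 : k != 0 := lk_neq0 T.

Variables (m : nat) (f : nat -> {poly K}) (dg : nat -> nat) (p : nat -> {poly K}).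
Local Notation M := m.+1.
Local Notation Wcol := (plain_col f).
Local Notation Fcol := (last_gauge_col m f).

(** In the Racah case this is (x + c)(x + d), and [coef_up] is (x + c)(x + d) / ((2 x + d)(2 x + 1 +
    d)), the part of the forward coefficient unaffected by the twist. [numerM] is the forward
    coefficient once Xi and the gauge are removed. *)
Definition numer0 u := (u - c) * (u - d) / wt u.
Definition coef_up u := numer0 u / (dl d u * dl (lv 1) u).
Definition coef_down u := numer0 (io d u) / (dl d u * dl (lv 1) (hs u)).
Definition numerM u := numer0 (iter M sh u) * ap u.

Variables (U : K -> K) (Lf E : nat -> K).

Hypotheses (wa : wt a != 0) (wb : wt b != 0) (wd : wt d != 0).
Hypothesis fsize : forall j, (j < M)%N -> size (f j) = (dg j).+1.
Hypothesis psize : forall n, size (p n) = n.+1.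
Let good u := [&& dl d u != 0, dl (lv 1) u != 0 & dl (lv 1) (hs u) != 0].
Hypothesis frec : forall j u, (j < M)%N -> wt u != 0 -> good u ->
  am u * coef_up u * (f j).[et d (sh u)] + ap (hs u) * coef_down u * (f j).[et d (hs u)]
  = (U u - Lf j) * (f j).[et d u].
Hypothesis prec : forall n u, wt u != 0 -> good u ->
  ap u * coef_up u * (p n).[et d (sh u)] + am (hs u) * coef_down u * (p n).[et d (hs u)]
  = (U u - E n) * (p n).[et d u].
Hypothesis E_inj : injective E.
Hypothesis nu_dg : forall i j, (i < j < M)%N -> nu (dg j) != nu (dg i).
Hypothesis gauge_dg : forall n i, (i < M)%N -> gauge_node T a b d n != nu (dg i).
Hypothesis coprime_a : forall u i j, wt u != 0 ->
  am (iter i sh u) = 0 -> ap (iter j hs u) != 0.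
Hypothesis zeta_lead : forall n,
  wt (hs a) * wt (hs b) * nu n
  + (lv M.+1 - hs a - hs b - (r - 1) * (hs a * hs b)) * r ^+ n != 0.
Hypothesis NsN : forall u n, wt u != 0 -> numerM (io (lv M) u) = 0 -> numerM (iter n sh u) != 0.
Hypothesis NNs : forall u n, wt u != 0 -> numerM u = 0 -> numerM (io (lv M) (iter n sh u)) != 0.
Let kap e x y := e - x - y - (r - 1) * (x * y).
Hypothesis N_lead : forall s n, let e := lv (M + s).+2 in
  let x1 := iter (M + s.+1) hs c in let y1 := iter (M + s.+1) hs d in
  let x2 := iter s.+1 hs a in let y2 := iter s.+1 hs b in
  wt e ^+ 2 * nu n + wt e * kap e x2 y2 + wt x2 * wt y2 * kap e x1 y1 != 0.

Lemma plain_casoratian_poly : exists Xi : {poly K},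
  eqv (cdet M Wcol) (fun u => phi M u * Xi.[et (lv m) u]) /\
  (size Xi + 'C(M, 2) = (\sum_(j < M) dg j).+1)%N.
Proof.
have [Xi [E1 E2]] := cdet_poly a b wd M Wcol; exists Xi; split => //.
exact: (size_ddet wa wb wd (m := dg) (F := Wcol) fsize nu_dg E2).
Qed.

Lemma gauge_casoratian_poly n : exists g : {poly K},
  eqv (cdet M.+1 (Fcol (p n))) (fun u => phi M.+1 u * g.[et (lv M) u]) /\
  (size g + 'C(M.+1, 2) = (\sum_(j < M) dg j + n + M).+1)%N.
Proof.
have [g [E1 E2]] := cdet_poly a b wd M.+1 (Fcol (p n)); exists g; split => //.
have := @size_ddet _ T a b d wa wb wd M.+1 (Fcol (p n)) (fun j => if (j < M)%N then dg j else n) g.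
rewrite big_ord_recr /= ltnn => ->.
- have -> : (Fcol (p n) M).1 = true by rewrite /last_gauge_col ltnn.
  congr (_.+1); rewrite -addnA; congr (_ + _)%N; apply: eq_bigr => j _.
  by rewrite /last_gauge_col ltn_ord.
- move=> j jM; rewrite /last_gauge_col; case: ifP => jM'; first exact: fsize.
  exact: psize.
- move=> i j /andP [ij jM]; rewrite /last_gauge_col /node.
  have iM : (i < M)%N by lia.
  rewrite iM; case: ltnP => jM' /=; last exact: gauge_dg.
  by apply: nu_dg; rewrite ij.
exact: E2.
Qed.

Lemma cdet_linear N (x : nat -> K) (q : nat -> {poly K}) u :
  cdet M.+1 (Fcol (\sum_(j < N) x j *: q j)) u = \sum_(j < N) x j * cdet M.+1 (Fcol (q j)) u.
Proof.
have [C CE] : exists C : 'I_M.+1 -> K, forall q1,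
    cdet M.+1 (Fcol q1) u = \sum_(i < M.+1) colv M (true, q1) i u * C i.
  pose A q1 := \matrix_(i < M.+1, j < M.+1) colv M (Fcol q1 j) i u.
  exists (fun i => cofactor (A 0) i ord_max) => q1.
  rewrite /casoratian (expand_det_col _ ord_max); apply: eq_bigr => i _.
  rewrite mxE /= {1}/last_gauge_col ltnn; congr (_ * (_ * \det _)).
  apply/matrixP => s t; rewrite !mxE /last_gauge_col.
  by have -> : (lift ord_max t < M)%N by rewrite lift_max.
rewrite CE (eq_bigr (fun j : 'I_N => \sum_(i < M.+1) x j * (colv M (true, q j) i u * C i))); last first.
  by move=> j _; rewrite CE mulr_sumr.
rewrite exchange_big; apply: eq_bigr => i _; rewrite /casorati_entry /= horner_sum mulr_sumr mulr_suml.
by apply: eq_bigr => j _; rewrite hornerZ; ring.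
Qed.

Variables (Xi : {poly K}) (gh : nat -> {poly K}) (l : nat).
Hypothesis XiE : eqv (cdet M Wcol) (fun u => phi M u * Xi.[et (lv m) u]).
Hypothesis Xi0 : Xi != 0.
Hypothesis ghE : forall n, eqv (cdet M.+1 (Fcol (p n))) (fun u => phi M.+1 u * (gh n).[et (lv M) u]).
Hypothesis ghs : forall n, size (gh n) = (l + n).+1.

Let weM s : wt (lv s) != 0. Proof. exact: wt_lv. Qed.

Lemma span_mul X Y n : (forall y, wt y != 0 -> X.[et (lv M) (sh y)] - X.[et (lv M) y]
    = k * dl (lv M.+1) y * (Xi.[et (lv m) (sh y)] * Y.[et (lv m) (sh y)])) ->
  exists x : nat -> K, X * gh n = \sum_(j < n + size X) x j *: gh j.
Proof.
move=> XE; have zl j : (wt (lv M.+1) + wt (hs a) * wt (hs b)) / (2 * wt (lv M.+1) * k) * nu j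
  + Qg T (lv M.+1) (hs a) (hs b) / k * (1 + r ^+ j) != 0.
  have two := l2_neq0 T; have we := weM M.+1.
  have := zeta_lead j; set z := (X in X != 0) => z0.
  set y := (X in X != 0); have -> : y = z / (wt (lv M.+1) * k).
    rewrite /y /z /Qg expE; move: we; rewrite /lwt => we; field.
    by rewrite k0 two we.
  by rewrite mulf_neq0 // invr_eq0 mulf_neq0.
have [q qE] := stepT wd XiE coprime_a zl (p n) XE.
have [x xE] := poly_basis q psize.
have E1 : X * gh n = \sum_(j < size q) x j *: gh j.
  apply/eqP; rewrite -subr_eq0; apply/eqP; apply: (et_poly0 (weM M)).
  apply: (@reg_cancel _ T _ (phi M.+1)); [exact: reg_pet|exact: reg_phi|exact: nz_phi|].
  move=> u wu pu; apply: (mulfI pu); rewrite mulr0 hornerD hornerN mulrBr hornerM.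
  rewrite mulrCA -ghE // -qE // {1}xE cdet_linear horner_sum mulr_sumr -sumrB big1 // => j _.
  by rewrite hornerZ ghE // mulrCA subrr.
have := @sum_top_zero _ gh l x _ _ (n + size X)%N ghs E1.
move=> H; exists (fun j => if (j < size q)%N then x j else 0); apply: H.
have [->|X0] := eqVneq X 0; first by rewrite mul0r size_poly0.
have g0 : gh n != 0 by rewrite -size_poly_gt0 ghs.
by rewrite size_mul // ghs addnS /= addnC addnA.
Qed.

End Abstract.

(** * Products of two polynomials as first-order differences *)

Section PhiRelations.
Variables (K : closedFieldType) (T : lattice K) (d : K).
Local Notation r := (lr T).
Local Notation k := (lk T).
Local Notation wt := (lwt T).
Local Notation sh := (lshift T).
Local Notation hs := (lshift_inv T).
Local Notation et := (leta T).
Local Notation dl := (lwidth T).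
Local Notation nu := (lnum T).
Local Notation lv := (level T d).
Local Notation phi := (eta_diffs T d).

Let r0 : r != 0 := lr_neq0 T.

Lemma phi_recr n u : phi n.+1 u =
  phi n u * \prod_(j < n) (et d (iter n sh u) - et d (iter j sh u)).
Proof.
have E N : phi N u = \prod_(i < N) \prod_(j < i) (et d (iter i sh u) - et d (iter j sh u)).
  apply: eq_bigr => i _.
  by rewrite (big_ord_widen N (fun j => et d (iter i sh u) - et d (iter j sh u))) // ltnW.
by rewrite !E big_ord_recr.
Qed.

Lemma phi_recl n u : phi n.+1 u =
  phi n (sh u) * \prod_(i < n) (et d (iter i.+1 sh u) - et d u).
Proof.
have E N v : phi N v = \prod_(i < N) \prod_(j < i) (et d (iter i sh v) - et d (iter j sh v)).
  apply: eq_bigr => i _.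
  by rewrite (big_ord_widen N (fun j => et d (iter i sh v) - et d (iter j sh v))) // ltnW.
rewrite !E big_ord_recl big_ord0 mul1r -big_split; apply: eq_bigr => i _ /=.
rewrite big_ord_recl /= mulrC; congr (_ * _); apply: eq_bigr => j _.
by rewrite /bump /= !add0n -!iterSr.
Qed.

Definition phi_ratio n : K := nu n.+1 * k / r ^+ n.

(** With [phi_rel_r] this cancels the Vandermonde products in the Darboux identity against the
    denominators of [coef_down] and [coef_up]. That the constant is the same in both relations
    allows it to be absorbed into one function G. *)
Lemma phi_rel_l n u : wt u != 0 ->
  phi n (sh u) * phi n.+2 (hs u) * dl (lv n) u =
  phi_ratio n * phi n.+1 u ^+ 2 * (dl d u * dl (lv 1) (hs u)).
Proof.
move=> wu; have wh : wt (hs u) != 0 by rewrite wt_hs0.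
rewrite [phi n.+2 _]phi_recl hsK [phi n.+1 u]phi_recl.
pose P N v := \prod_(i < N) (nu i.+1 * (k * dl (lv i.+1) v)).
have PE N v : wt v != 0 -> \prod_(i < N) (et d (iter i.+1 sh v) - et d v) = P N v.
  by move=> wv; apply: eq_bigr => i _; rewrite et_diffn.
rewrite !PE //.
suff H : P n.+1 (hs u) * dl (lv n) u = phi_ratio n * P n u * (dl d u * dl (lv 1) (hs u)).
  transitivity (phi n (sh u) * (phi n (sh u) * P n u) * (P n.+1 (hs u) * dl (lv n) u)).
    by ring.
  by rewrite H; ring.
elim: n => [|n IH].
  by rewrite /P big_ord_recr !big_ord0 /phi_ratio expr0 divr1 /level /=; ring.
rewrite [P n.+2 _]big_ord_recr /= -/(P n.+1 (hs u)).
have -> : dl (lv n.+2) (hs u) = dl (lv n) u / r.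
  by rewrite -{2}(hsK T u) dl_sh // -!lvS mulrC mulKf.
rewrite mulrAC [P n.+1 u]big_ord_recr /= -/(P n u).
transitivity (P n.+1 (hs u) * dl (lv n) u * (dl (lv n.+1) u * (nu n.+2 * k / r))).
  by field.
rewrite IH /phi_ratio exprS; field.
by rewrite r0 expf_neq0.
Qed.

Lemma phi_rel_r n u : wt u != 0 ->
  phi n u * phi n.+2 u * dl (lv n) u =
  phi_ratio n * phi n.+1 u ^+ 2 * (dl d (iter n sh u) * dl (lv 1) (iter n sh u)).
Proof.
move=> wu; rewrite [phi n.+2 _]phi_recr [phi n.+1 u]phi_recr.
pose Q N v := \prod_(j < N) (et d (iter N sh v) - et d (iter j sh v)).
rewrite -/(Q n.+1 u) -/(Q n u).
suff H : Q n.+1 u * dl (lv n) u = phi_ratio n * Q n u * (dl d (iter n sh u) * dl (lv 1) (iter n sh u)).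
  transitivity (phi n u * (phi n u * Q n u) * (Q n.+1 u * dl (lv n) u)); first by ring.
  by rewrite H; ring.
have QS N v : wt v != 0 -> Q N.+1 v = nu N.+1 * (k * dl (lv N.+1) v) * Q N (sh v).
  move=> wv; rewrite /Q big_ord_recl /= -[sh (iter N sh v)]/(iter N.+1 sh v).
  rewrite et_diffn //; congr (_ * _); apply: eq_bigr => i _.
  by rewrite /bump /= ?add0n -!iterSr.
elim: n u wu => [|n IH] u wu.
  by rewrite QS // /Q !big_ord0 /phi_ratio expr0 divr1 /level /=; ring.
have ws : wt (sh u) != 0 by rewrite wt_sh0.
rewrite QS // [Q n.+1 u]QS //.
have -> : dl (lv n.+2) u = dl (lv n) (sh u) / r by rewrite dl_sh // -!lvS mulrC mulKf.
transitivity (Q n.+1 (sh u) * dl (lv n) (sh u) * (dl (lv n.+1) u * (nu n.+2 * k / r))).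
  by field.
rewrite IH // -iterSr /phi_ratio exprS; field.
by rewrite r0 expf_neq0.
Qed.
End PhiRelations.

(** P, f0, f2, f0' and f2' are Vandermonde products, x1 x2 and y1 y2 the denominators of [coef_up]
    and [coef_down]. The two relations between them leave just a first-order difference of kp / e
    times G. *)
Lemma darboux_elim (F : fieldType) (e A B gi gj P n1 n2 x1 x2 y1 y2 D f0 f2 f0' f2' X X' G G' kp : F) :
  e * (A * B * (A * B) * (P * gi * (P * gj))) =
  - (B * (n1 / (x1 * x2)) * (f0 * X) * (A * A * (f2 * G))) +
  A * (n2 / (y1 * y2)) * (f0' * X') * (B * B * (f2' * G')) ->
  f0 * f2 * D = kp * P ^+ 2 * (x1 * x2) -> f0' * f2' * D = kp * P ^+ 2 * (y1 * y2) ->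
  x1 != 0 -> x2 != 0 -> y1 != 0 -> y2 != 0 -> A != 0 -> B != 0 -> P != 0 -> e != 0 ->
  gi * gj * D * (A * B) = n1 * A * X * (- kp / e * G) - n2 * B * X' * (- kp / e * G').
Proof.
move=> H R1 R2 x10 x20 y10 y20 A0 B0 P0 e0.
apply: (mulfI (mulf_neq0 e0 (mulf_neq0 (mulf_neq0 A0 B0) (expf_neq0 2 P0)))).
transitivity (D * (e * (A * B * (A * B) * (P * gi * (P * gj))))); first by ring.
rewrite H.
transitivity (- (B * n1 / (x1 * x2) * X * A * A * G) * (f0 * f2 * D) +
  A * n2 / (y1 * y2) * X' * B * B * G' * (f0' * f2' * D)).
  by field; rewrite x10 x20 y10 y20.
by rewrite R1 R2; field; rewrite x10 x20 y10 y20 e0.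
Qed.

Section DarbouxApplication.
Variables (K : closedFieldType) (T : lattice K) (a b c d : K).
Local Notation wt := (lwt T).
Local Notation sh := (lshift T).
Local Notation hs := (lshift_inv T).
Local Notation et := (leta T).
Local Notation io := (lrefl T).
Local Notation dl := (lwidth T).
Local Notation reg := (regular_fun T).
Local Notation eqv := (eq_valid T).
Local Notation nz := (nonzero_fun T).
Local Notation ap := (quad_up T a b).
Local Notation am := (quad_down T a b d).
Local Notation lv := (level T d).
Local Notation rf := (gauge_prod T a b d).
Local Notation colv := (casorati_entry T a b d).
Local Notation cdet := (casoratian T a b d).
Local Notation phi := (eta_diffs T d).
Local Notation N0 := (numer0 T c d).
Local Notation bb := (coef_up T c d).
Local Notation bs := (coef_down T c d).

Variables (m : nat) (f : nat -> {poly K}) (p : nat -> {poly K}).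
Local Notation M := m.+1.
Local Notation Wcol := (plain_col f).
Local Notation Fcol := (last_gauge_col m f).
Variables (U : K -> K) (Lf E : nat -> K).
Hypothesis wd : wt d != 0.
Let good u := [&& dl d u != 0, dl (lv 1) u != 0 & dl (lv 1) (hs u) != 0].
Hypothesis frec : forall j u, (j < M)%N -> wt u != 0 -> good u ->
  am u * bb u * (f j).[et d (sh u)] + ap (hs u) * bs u * (f j).[et d (hs u)]
  = (U u - Lf j) * (f j).[et d u].
Hypothesis prec : forall n u, wt u != 0 -> good u ->
  ap u * bb u * (p n).[et d (sh u)] + am (hs u) * bs u * (p n).[et d (hs u)]
  = (U u - E n) * (p n).[et d u].

Definition two_gauge_col (q1 q2 : {poly K}) (j : nat) :=
  if (j < M)%N then (false, f j) else (true, if j == M then q1 else q2).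

Lemma rf_first n j z : (j <= n)%N ->
  rf n.+1 j.+1 z = ap z * rf n j (sh z).
Proof.
move=> jn; rewrite /gauge_prod big_ord_recl -mulrA; congr (_ * (_ * _)).
  by apply: eq_bigr => i _; rewrite -iterSr.
by rewrite big_add1; apply: eq_bigr => i _; rewrite -iterSr.
Qed.

Lemma rf_up n j z : (j < n)%N ->
  am (iter j sh z) * rf n j.+1 z = ap (iter j sh z) * rf n j z.
Proof.
move=> jn; rewrite /gauge_prod big_ord_recr /= [in RHS]big_ltn //=; ring.
Qed.

Section Pair.
Variables (i j : nat) (z : K).
Hypothesis wz : wt z != 0.
Hypothesis gz : forall s, (s <= M)%N -> good (iter s.+1 sh z).

Let R s t := colv M.+2 (two_gauge_col (p i) (p j) t) s z.
Let Lc t := if (t < M)%N then Lf t else if t == M then E i else E j.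

(** By [rf_up] the gauge factor trades [ap] for [am] and turns the operator of the [p n] into that
    of the seeds. All columns then satisfy one recurrence and differ in the eigenvalue only, as the
    Darboux identity requires. *)
Lemma casorati_rec s t : (s <= M)%N -> (t <= M.+1)%N ->
  am (iter s.+1 sh z) * bb (iter s.+1 sh z) * R s.+2 t + ap (iter s sh z) * bs (iter s.+1 sh z) * R s t
  = (U (iter s.+1 sh z) - Lc t) * R s.+1 t.
Proof.
move=> sM tM; set v := iter s.+1 sh z.
have wv : wt v != 0 by rewrite wt_shn0.
have hv : hs v = iter s sh z by rewrite /v /= shK.
have gv := gz sM; rewrite -/v in gv.
rewrite /R /Lc /casorati_entry /two_gauge_col; case: ltnP => tM' /=.
  by rewrite !mul1r; have := frec tM' wv gv; rewrite hv.
have [n [-> ->]] : exists n, (if t == M then p i else p j) = p n /\ (if t == M then E i else E j) = E n.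
  by case: eqP => _; [exists i | exists j].
have := prec n wv gv; rewrite hv.
rewrite -[sh (sh (iter s sh z))]/(sh v).
set x2 := (p n).[et d (sh v)]; set x0 := (p n).[et d (iter s sh z)]; set x1 := (p n).[_].
move=> H; have E1 := @rf_up M.+2 s.+1 z sM; have E0 := @rf_up M.+2 s z (leqW sM).
rewrite -/v in E1.
transitivity (am v * rf M.+2 s.+2 z * bb v * x2 + ap (iter s sh z) * rf M.+2 s z * bs v * x0).
  by ring.
rewrite E1 -E0.
transitivity (rf M.+2 s.+1 z * (ap v * bb v * x2 + am (iter s sh z) * bs v * x0)); first by ring.
by rewrite H; ring.
Qed.

Let u := sh z.
Let A := ap z.
Let Bm := am (iter M sh u).

Lemma det_last_scale N (F G : nat -> nat -> K) (x : K) s0 :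
  (forall s t, (s < N)%N -> (t < N)%N -> F s t = G s t * (if (t < s0)%N then 1 else x)) ->
  (s0 <= N)%N ->
  \det (\matrix_(s < N, t < N) F s t) = x ^+ (N - s0) * \det (\matrix_(s < N, t < N) G s t).
Proof.
move=> FG s0N; have := @det_scale_cols K N (fun t => if (t < s0)%N then 1 else x) (fun s t => G s t).
have -> : \prod_(t < N) (if (t < s0)%N then 1 else x) = x ^+ (N - s0).
  rewrite -(big_mkord xpredT (fun t => if (t < s0)%N then 1 else x)) (@big_cat_nat _ _ _ s0) //=.
  rewrite big_nat big1 ?mul1r => [|t /andP [_ ->] //].
  rewrite big_nat (eq_bigr (fun=> x)) => [|t /andP [st _]]; last by rewrite ltnNge st.
  by rewrite -big_nat prodr_const_nat.
by move=> <-; congr (\det _); apply/matrixP => s t; rewrite !mxE FG.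
Qed.

(** The determinants of the identity are windows of one table starting at z, u or sh u, while each
    [casoratian] has the gauge factors of its own window. A gauged column thus differs by A (bottom
    row dropped), by Bm (top row dropped) or by both. *)
Lemma casorati_pair :
  (E j - E i) * (A * Bm * (A * Bm) * (cdet M.+1 (Fcol (p i)) u * cdet M.+1 (Fcol (p j)) u)) =
  - (Bm * bb (iter M sh u) * cdet M Wcol u * (A * A * cdet M.+2 (two_gauge_col (p i) (p j)) u))
  + A * bs u * cdet M Wcol (sh u) * (Bm * Bm * cdet M.+2 (two_gauge_col (p i) (p j)) z).
Proof.
have H := darboux_identity casorati_rec.
have MM2 : (M <= M.+2)%N by rewrite leqW.
have L1 : Lc M.+1 = E j by rewrite /Lc ltnNge leqnSn /= gtn_eqF.
have L0 : Lc M = E i by rewrite /Lc ltnn eqxx.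
have uE s : iter s.+1 sh z = iter s sh u by rewrite /u iterSr.
have zM : iter M.+1 sh z = iter M sh u by rewrite /u iterSr.
rewrite L1 L0 zM in H.
have D1 : \det (\matrix_(s < M.+1, t < M.+1) R s.+1 t) = A * Bm * cdet M.+1 (Fcol (p i)) u.
  rewrite (@det_last_scale M.+1 (fun s t => R s.+1 t) (fun s t => colv M (Fcol (p i) t) s u) (A * Bm) M) //.
    by rewrite subSnn expr1.
  move=> s t sM tM; rewrite /R /casorati_entry uE /two_gauge_col /last_gauge_col; case: ltnP => tM' /=; rewrite ?mulr1 //.
  have -> : t == M by rewrite eqn_leq tM' andbT.
  by rewrite rf_first 1?leqW // rfM_am // -/u -/A -/Bm; ring.
have D2 : \det (\matrix_(s < M.+1, t < M.+1) R s.+1 (if t == M :> nat then M.+1 else t)) =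
    A * Bm * cdet M.+1 (Fcol (p j)) u.
  rewrite (@det_last_scale M.+1 (fun s t => R s.+1 (if t == M then M.+1 else t)) (fun s t => colv M (Fcol (p j) t) s u) (A * Bm) M) //.
    by rewrite subSnn expr1.
  move=> s t sM tM; rewrite /R /casorati_entry uE /two_gauge_col /last_gauge_col; have [tM'|tM'] := ltnP t M.
    by rewrite ltn_eqF // tM' /= mulr1.
  have -> : t == M by rewrite eqn_leq tM' andbT.
  rewrite ltnNge leqnSn /= gtn_eqF //.
  by rewrite rf_first 1?leqW // rfM_am // -/u -/A -/Bm; ring.
have D3 : \det (\matrix_(s < M, t < M) R s.+1 t) = cdet M Wcol u.
  by congr (\det _); apply/matrixP => s t; rewrite !mxE /R /casorati_entry uE /two_gauge_col ltn_ord.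
have D4 : \det (\matrix_(s < M, t < M) R s.+2 t) = cdet M Wcol (sh u).
  congr (\det _); apply/matrixP => s t; rewrite !mxE /R /casorati_entry /two_gauge_col ltn_ord /=.
  by rewrite -!iterSr.
have D5 : \det (\matrix_(s < M.+2, t < M.+2) R s.+1 t) = A * A * cdet M.+2 (two_gauge_col (p i) (p j)) u.
  rewrite (@det_last_scale M.+2 (fun s t => R s.+1 t) (fun s t => colv M.+1 (two_gauge_col (p i) (p j) t) s u) A M) // ?MM2 //.
    by have -> : (M.+2 - M = 2)%N by lia.
  move=> s t sM tM; rewrite /R /casorati_entry uE /two_gauge_col; case: ltnP => tM' /=; rewrite ?mulr1 //.
  by rewrite rf_first // -/u -/A; ring.
have D6 : \det (\matrix_(s < M.+2, t < M.+2) R s t) = Bm * Bm * cdet M.+2 (two_gauge_col (p i) (p j)) z.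
  rewrite (@det_last_scale M.+2 (fun s t => R s t) (fun s t => colv M.+1 (two_gauge_col (p i) (p j) t) s z) Bm M) // ?MM2 //.
    by have -> : (M.+2 - M = 2)%N by lia.
  move=> s t sM tM; rewrite /R /casorati_entry /two_gauge_col; case: ltnP => tM' /=; rewrite ?mulr1 //.
  by rewrite rfM_am // zM -/Bm; ring.
move: H; rewrite D1 D2 D3 D4 D5 D6 => H.
transitivity ((E j - E i) * (A * Bm * cdet M.+1 (Fcol (p i)) u * (A * Bm * cdet M.+1 (Fcol (p j)) u))).
  by ring.
by rewrite H.
Qed.

End Pair.

Lemma reg_N0 : reg N0. Proof. exact: (reg_ap T c d). Qed.
Lemma nz_N0 : nz N0. Proof. exact: (nz_ap T c d). Qed.

(** The algebraic substitute for orthogonality to 1: F times the width is the image of G under a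
    first-order operator. The equation is multiplied by [ap (hs u)] and [am (iter M sh u)], the
    denominators of its coefficients. *)
Definition null_poly (Xi F : {poly K}) := exists2 G, reg G & forall u, wt u != 0 ->
  F.[et (lv M) u] * dl (lv M) u * (ap (hs u) * am (iter M sh u)) =
  N0 (iter M sh u) * ap (hs u) * Xi.[et (lv m) u] * G u
  - N0 (io d u) * am (iter M sh u) * Xi.[et (lv m) (sh u)] * G (hs u).

(** Up to a constant, G is the quotient of the Casoratian of the seeds and both gauged columns. The
    Darboux identity is available where the denominators of the recurrence are nonzero, and
    [reg_eq_on] extends the conclusion. *)
Lemma null_pair (Xi : {poly K}) (gh : nat -> {poly K}) i j :
  eqv (cdet M Wcol) (fun u => phi M u * Xi.[et (lv m) u]) ->
  (forall n, eqv (cdet M.+1 (Fcol (p n))) (fun u => phi M.+1 u * (gh n).[et (lv M) u])) ->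
  E i != E j -> null_poly Xi (gh i * gh j).
Proof.
move=> XiE ghE Eij; have e0 : E j - E i != 0 by rewrite subr_eq0 eq_sym.
have [Ga [GE _]] := cdet_poly a b wd M.+2 (two_gauge_col (p i) (p j)); rewrite /= in GE.
have rs (h : K -> K) s : reg h -> reg (fun u => h (iter s sh u)) by apply: reg_shn.
have rX (q : {poly K}) e : reg (fun u => q.[et e u]) by apply: reg_pet.
have rGh : reg (fun u => Ga.[et (lv M.+1) (hs u)]) by apply: (reg_hs (f := fun v => Ga.[et _ v])).
have rXs : reg (fun u => Xi.[et (lv m) (sh u)]) by apply: (reg_sh (f := fun v => Xi.[et _ v])).
have rA : reg (fun u => ap (hs u)) by apply: reg_hs; apply: reg_ap.
have rB : reg (fun u => am (iter M sh u)) by apply: rs; apply: reg_am.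
pose gd u := dl d u * dl (lv 1) u * dl (lv 1) (hs u).
have rgd : reg gd.
  by apply: regM; [apply: regM|apply: reg_hs]; apply: reg_dl.
have ngd : nz gd.
  apply: nzM; [by apply: regM; apply: reg_dl | by apply: reg_hs; apply: reg_dl | | by apply: nz_hs; apply: nz_dl].
  by apply: nzM; try exact: reg_dl; apply: nz_dl.
exists (fun u => - phi_ratio T M / (E j - E i) * Ga.[et (lv M.+1) u]).
  by apply: regMc.
apply: (@reg_eq_on _ T
 (fun u => (gh i * gh j).[et (lv M) u] * dl (lv M) u * (ap (hs u) * am (iter M sh u)))
 (fun u => N0 (iter M sh u) * ap (hs u) * Xi.[et (lv m) u] * (- phi_ratio T M / (E j - E i) * Ga.[et (lv M.+1) u])
  - N0 (io d u) * am (iter M sh u) * Xi.[et (lv m) (sh u)] * (- phi_ratio T M / (E j - E i) * Ga.[et (lv M.+1) (hs u)]))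
 (fun u => (phi M.+1 u * (ap (hs u) * am (iter M sh u))) * \prod_(s < M.+1) gd (iter s sh u))).
- by apply: regM; [apply: regM => //; apply: reg_dl | apply: regM].
- apply: regB; apply: regM; try exact: regMc.
    by apply: regM => //; apply: regM => //; apply: rs; apply: reg_N0.
  by apply: regM => //; apply: regM => //; apply: reg_io => //; apply: reg_N0.
- by apply: regM; [apply: regM; [apply: reg_phi | apply: regM] | apply: reg_prod => s _; apply: rs].
- apply: nzM.
  + by apply: regM; [apply: reg_phi | apply: regM].
  + by apply: reg_prod => s _; apply: rs.
  + apply: nzM; [exact: reg_phi | exact: regM | exact: nz_phi |].
    by apply: nzM => //; [apply: nz_hs; apply: nz_ap | apply: nz_shn; apply: nz_am].
  by apply: nz_prod => s _; [apply: rs | apply: nz_shn].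
move=> u wu; rewrite mulf_eq0 negb_or => /andP [].
rewrite mulf_eq0 negb_or => /andP [P0]; rewrite mulf_eq0 negb_or => /andP [A0 B0] /prodf_neq0 gn.
have gn' s : (s <= M)%N -> good (iter s sh u).
  move=> sM; have sM' : (s < M.+1)%N by []; have := gn (Ordinal sM') isT; rewrite /gd !mulf_eq0 !negb_or.
  by rewrite -andbA.
have wh : wt (hs u) != 0 by rewrite wt_hs0.
have H : (E j - E i) * (ap (hs u) * am (iter M sh u) * (ap (hs u) * am (iter M sh u)) *
    (cdet M.+1 (Fcol (p i)) u * cdet M.+1 (Fcol (p j)) u)) =
  - (am (iter M sh u) * bb (iter M sh u) * cdet M Wcol u * (ap (hs u) * ap (hs u) * cdet M.+2 (two_gauge_col (p i) (p j)) u))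
  + ap (hs u) * bs u * cdet M Wcol (sh u) *
    (am (iter M sh u) * am (iter M sh u) * cdet M.+2 (two_gauge_col (p i) (p j)) (hs u)).
  have := @casorati_pair i j (hs u) wh; rewrite hsK; apply => s sM.
  by rewrite iterSr hsK; apply: gn'.
have [x1 x2 _] := and3P (gn' M (leqnn M)).
have [y1 _ y2] := and3P (gn' 0%N (leq0n M)).
have R1 := phi_rel_r d M wu; have R2 := phi_rel_l d M wu.
rewrite !ghE // GE // (GE _ wh) !XiE ?wt_sh0 // /coef_up /coef_down in H.
rewrite hornerM.
exact: (darboux_elim H R1 R2 x1 x2 y1 y2 A0 B0 P0 e0).
Qed.

End DarbouxApplication.

(** * The lower bound on the indices *)

Section LowerBound.
Variables (K : closedFieldType) (T : lattice K) (a b c d : K).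
Local Notation r := (lr T).
Local Notation k := (lk T).
Local Notation wt := (lwt T).
Local Notation sh := (lshift T).
Local Notation hs := (lshift_inv T).
Local Notation et := (leta T).
Local Notation io := (lrefl T).
Local Notation dl := (lwidth T).
Local Notation nu := (lnum T).
Local Notation reg := (regular_fun T).
Local Notation eqv := (eq_valid T).
Local Notation nz := (nonzero_fun T).
Local Notation ap := (quad_up T a b).
Local Notation am := (quad_down T a b d).
Local Notation lv := (level T d).
Local Notation N0 := (numer0 T c d).

Let r0 : r != 0 := lr_neq0 T.
Let k0 : k != 0 := lk_neq0 T.

Variable m : nat.
Local Notation M := m.+1.
Local Notation NM := (numerM T a b c d m).
Local Notation NullX := (null_poly T a b c d m).

Hypotheses (wa : wt a != 0) (wb : wt b != 0) (wd : wt d != 0).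
Hypothesis NsN : forall u n, wt u != 0 -> NM (io (lv M) u) = 0 -> NM (iter n sh u) != 0.
Hypothesis NNs : forall u n, wt u != 0 -> NM u = 0 -> NM (io (lv M) (iter n sh u)) != 0.
Let kap e x y := e - x - y - (r - 1) * (x * y).
Hypothesis N_lead : forall s n, let e := lv (M + s).+2 in
  let x1 := iter (M + s.+1) hs c in let y1 := iter (M + s.+1) hs d in
  let x2 := iter s.+1 hs a in let y2 := iter s.+1 hs b in
  wt e ^+ 2 * nu n + wt e * kap e x2 y2 + wt x2 * wt y2 * kap e x1 y1 != 0.

Let Ns u := N0 (io d u) * am (iter m sh u).

Lemma NsE u : wt u != 0 -> Ns u = NM (io (lv M) u).
Proof.
by move=> wu; rewrite /Ns /numerM shn_io // am_shn.
Qed.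

Lemma quad_shn n x y v : wt v != 0 -> (iter n sh v - x) * (iter n sh v - y) / wt (iter n sh v)
  = r ^+ n * ((v - iter n hs x) * (v - iter n hs y) / wt v).
Proof.
move=> wv; rewrite wt_shn -{1}(hsnK T n x) -{1}(hsnK T n y).
have E z : iter n sh v - iter n sh z = r ^+ n * (v - z) by rewrite !shnE expE /lwt; ring.
by rewrite !E; field; rewrite wv expf_neq0.
Qed.

Let DD e : {poly K} := (((r - 1) / k) *: 'X + e%:P) ^+ 2 + (4 / k) *: 'X.

Lemma DDE e v : wt v != 0 -> (DD e).[et e v] = dl e v ^+ 2.
Proof. by move=> wv; rewrite dl_sqr // /DD !horner_simpl; ring. Qed.

Lemma topDD e : top 2 (((r - 1) / k) ^+ 2) (DD e).
Proof.
rewrite -[X in top _ X _]addr0; apply: topD; last exact: topW (topZ _ (topX _)).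
rewrite !expr2; have t : top 1 ((r - 1) / k) (((r - 1) / k) *: 'X + e%:P).
  rewrite -[X in top _ X _]addr0; apply: topD; last exact: topW (topC _).
  by rewrite -[X in top _ X _]mulr1; apply: topZ; apply: topX.
exact: (topM t t).
Qed.

Let e_ s := lv (M + s).+2.
Let x1 s := iter (M + s.+1) hs c.
Let y1 s := iter (M + s.+1) hs d.
Let x2 s := iter s.+1 hs a.
Let y2 s := iter s.+1 hs b.
Let Rs s := r ^+ (M + s.+1) * r ^+ s.+1.
Let hp s := Rs s *: (Qh T (e_ s) (x1 s) (y1 s) * Qh T (e_ s) (x2 s) (y2 s)
   + (Qg T (e_ s) (x1 s) (y1 s) * Qg T (e_ s) (x2 s) (y2 s)) *: DD (e_ s)).
Let gp s := Rs s *: ((Qg T (e_ s) (x1 s) (y1 s)) *: Qh T (e_ s) (x2 s) (y2 s)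
   + (Qg T (e_ s) (x2 s) (y2 s)) *: Qh T (e_ s) (x1 s) (y1 s)).
Let lc e x y := (wt e + wt x * wt y) / (2 * wt e * k).
Let ch s := Rs s * (lc (e_ s) (x1 s) (y1 s) * lc (e_ s) (x2 s) (y2 s)
   + (Qg T (e_ s) (x1 s) (y1 s) * Qg T (e_ s) (x2 s) (y2 s)) * ((r - 1) / k) ^+ 2).
Let cg s := Rs s * (Qg T (e_ s) (x1 s) (y1 s) * lc (e_ s) (x2 s) (y2 s)
   + Qg T (e_ s) (x2 s) (y2 s) * lc (e_ s) (x1 s) (y1 s)).

Let we s : wt (e_ s) != 0. Proof. exact: wt_lv. Qed.

Lemma N_dec s v : wt v != 0 ->
  NM (iter s.+1 sh v) = (hp s).[et (e_ s) v] + (gp s).[et (e_ s) v] * dl (e_ s) v.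
Proof.
move=> wv; rewrite /numerM /numer0 /quad_up -iterD !quad_shn //.
rewrite (QE (iter (M + s.+1) hs c) (iter (M + s.+1) hs d) (we s) wv).
rewrite (QE (iter s.+1 hs a) (iter s.+1 hs b) (we s) wv) !hornerC.
rewrite /hp /gp -/(x1 s) -/(y1 s) -/(x2 s) -/(y2 s) /Rs.
move: (Qg _ _ _ _) (Qg _ _ _ _) (Qh _ _ _ _) (Qh _ _ _ _) (DD _) (DDE (e_ s) wv) => g1 g2 h1 h2 D DE.
rewrite !hornerZ !hornerD !hornerM !hornerZ DE; ring.
Qed.

Lemma top_hp s : top 2 (ch s) (hp s).
Proof.
apply: topZ; apply: topD; first exact: (topM (topQh _ _ _ _) (topQh _ _ _ _)).
by apply: topZ; apply: topDD.
Qed.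

Lemma top_gp s : top 2 (cg s) ('X * gp s).
Proof.
by apply: topXr; apply: topZ; apply: topD; apply: topZ; apply: topQh.
Qed.

Lemma N_lead' s n : ch s * nu n + cg s / k * (1 + r ^+ n) != 0.
Proof.
have two := l2_neq0 T; have R0 : Rs s != 0 by rewrite mulf_neq0 // expf_neq0.
pose z := wt (e_ s) ^+ 2 * nu n + wt (e_ s) * kap (e_ s) (x2 s) (y2 s)
  + wt (x2 s) * wt (y2 s) * kap (e_ s) (x1 s) (y1 s).
have z0 : z != 0 by exact: N_lead.
suff -> : ch s * nu n + cg s / k * (1 + r ^+ n) = Rs s * z / (wt (e_ s) * k) ^+ 2.
  by apply: mulf_neq0; [apply: mulf_neq0 | rewrite invr_eq0 expf_neq0 // mulf_neq0 // we].
rewrite /ch /cg /lc /Qg /z /kap expE; move: (we s).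
move: (Rs s) (e_ s) (x1 s) (x2 s) (y1 s) (y2 s) => R e u1 u2 v1 v2.
rewrite /lwt => w0; field.
by rewrite k0 two w0.
Qed.

Lemma reg_NM : reg NM.
Proof.
apply: regM; last exact: reg_ap.
by apply: reg_shn; apply: reg_N0.
Qed.

Lemma nz_NM : nz NM.
Proof.
apply: nzM; last exact: nz_ap; last by apply: nz_shn; apply: nz_N0.
  by apply: reg_shn; apply: reg_N0.
exact: reg_ap.
Qed.

Variable Xi : {poly K}.
Hypothesis Xi0 : Xi != 0.

Lemma NullXD F G : NullX Xi F -> NullX Xi G -> NullX Xi (F + G).
Proof.
move=> [g1 r1 E1] [g2 r2 E2]; exists (fun u => g1 u + g2 u); first exact: regD.
move=> u wu; rewrite hornerD; have := E1 u wu; have := E2 u wu.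
move: (ap _) (am _) (dl _ _) => A B D e2 e1.
transitivity (F.[et (lv M) u] * D * (A * B) + G.[et (lv M) u] * D * (A * B)); first by ring.
by rewrite e1 e2; ring.
Qed.

Lemma NullXZ x F : NullX Xi F -> NullX Xi (x *: F).
Proof.
move=> [g1 h1 E1]; exists (fun u => x * g1 u); first exact: regMc.
move=> u wu; rewrite hornerZ; have := E1 u wu.
move: (ap _) (am _) (dl _ _) => A B D e1.
transitivity (x * (F.[et (lv M) u] * D * (A * B))); first by ring.
by rewrite e1; ring.
Qed.

Lemma NullX0 : NullX Xi 0.
Proof. by exists (fun=> 0) => [|u wu]; [apply: regC | rewrite horner0; ring]. Qed.

Lemma NullX_sum n (F : nat -> {poly K}) (x : nat -> K) :
  (forall i, (i < n)%N -> x i != 0 -> NullX Xi (F i)) -> NullX Xi (\sum_(i < n) x i *: F i).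
Proof.
elim: n => [|n IH] H; first by rewrite big_ord0; apply: NullX0.
rewrite big_ord_recr; apply: NullXD.
  by apply: IH => i iN; apply: H; apply: leqW.
have [->|x0] := eqVneq (x n) 0; first by rewrite scale0r; apply: NullX0.
by apply: NullXZ; apply: H.
Qed.

Definition diff_divisible (X Y : {poly K}) := forall y, wt y != 0 ->
  X.[et (lv M) (sh y)] - X.[et (lv M) y]
  = k * dl (lv M.+1) y * (Xi.[et (lv m) (sh y)] * Y.[et (lv m) (sh y)]).

Let nzX (q : {poly K}) e : wt e != 0 -> q != 0 -> nz (fun u => q.[et e u]).
Proof.
move=> w q0; have [E|//] := reg_zero (reg_pet T q e).
by move: q0; rewrite (et_poly0 w E) eqxx.
Qed.

Let Xi_sh_reg : reg (fun u => Xi.[et (lv m) (sh u)]).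
Proof. by apply: (reg_sh (f := fun v => Xi.[et _ v])); apply: reg_pet. Qed.

Lemma pi_exists : exists pi : {poly K}, forall u, wt u != 0 ->
  pi.[et (lv M) u] = Xi.[et (lv m) u] * Xi.[et (lv m) (sh u)].
Proof.
have [||pi E] := @reg_sym _ T (lv M) (fun u => Xi.[et (lv m) u] * Xi.[et (lv m) (sh u)]) (wt_lv wd M).
- by apply: regM => //; apply: reg_pet.
- move=> u wu; rewrite lvS sh_io // et_io ?wt_lv // -io_sh // et_io ?wt_lv ?wt_sh0 //.
  by rewrite mulrC.
by exists pi => u wu; rewrite E.
Qed.

(** The values of pi at y and sh y share the factor Xi(sh y). The difference of the cofactors is odd
    under the reflection at level M + 1, so it is a multiple of the width of that level. *)
Lemma pi_XEq (pi t : {poly K}) : (forall u, wt u != 0 ->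
  pi.[et (lv M) u] = Xi.[et (lv m) u] * Xi.[et (lv m) (sh u)]) -> exists Y, diff_divisible (pi * t) Y.
Proof.
move=> piE.
pose F y := Xi.[et (lv m) (sh (sh y))] * t.[et (lv M) (sh y)] - Xi.[et (lv m) y] * t.[et (lv M) y].
have rF : reg F.
  apply: regB; apply: regM; try exact: reg_pet.
    by apply: (reg_shn 2 (f := fun v => Xi.[et _ v])); apply: reg_pet.
  by apply: (reg_sh (f := fun v => t.[et _ v])); apply: reg_pet.
have [|q qE] := @reg_antisym _ T (lv M.+1) F (wt_lv wd _) rF.
  move=> u wu; rewrite /F opprB.
  have E1 : sh (io (lv M.+1) u) = io (lv M) u by rewrite lvS sh_io.
  have E2 : sh (io (lv M) u) = io (lv m) u by rewrite lvS sh_io.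
  rewrite E1 E2 !et_io ?wt_lv //.
  have -> : io (lv M.+1) u = io (lv m) (sh (sh u)) by rewrite !io_sh ?wt_sh0 // -!lvS.
  rewrite et_io ?wt_lv ?wt_sh0 //; congr (_ - _ * _.[_]).
  have -> : io (lv m) (sh (sh u)) = io (lv M) (sh u) by rewrite io_sh ?wt_sh0 // -lvS.
  by rewrite et_io ?wt_lv ?wt_sh0.
exists (k^-1 *: (q \Po (r^-1 *: ('X - (et (lv m) 1)%:P)))) => y wy.
have ws : wt (sh y) != 0 by rewrite wt_sh0.
have CE : (q \Po (r^-1 *: ('X - (et (lv m) 1)%:P))).[et (lv m) (sh y)] = q.[et (lv M.+1) y].
  by rewrite horner_comp !horner_simpl et_shE // -!lvS addrK mulKf.
rewrite !hornerM !piE // hornerZ CE; have := qE y wy; rewrite /F => H.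
transitivity (Xi.[et (lv m) (sh y)] * (dl (lv M.+1) y * q.[et (lv M.+1) y])).
  by rewrite -H; ring.
by field.
Qed.

(** Thanks to the factor pi, [chain] applies with H = Xi(sh u) am(sh ^ M u) ap(u): G is a multiple
    of H, and the factors of H then cancel from the whole equation. *)
Lemma null_DN (P pi t : {poly K}) : (forall u, wt u != 0 ->
    pi.[et (lv M) u] = Xi.[et (lv m) u] * Xi.[et (lv m) (sh u)]) ->
  NullX Xi (P * pi * t) ->
  exists2 g, reg g & eqv (fun u => (P * t).[et (lv M) u] * dl (lv M) u) (twisted_diff T NM Ns 0 g).
Proof.
move=> piE [G rG GE].
pose A u := (P * t).[et (lv M) u] * dl (lv M) u.
pose H u := Xi.[et (lv m) (sh u)] * am (iter M sh u) * ap u.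
have rA : reg A by apply: regM; [apply: reg_pet | apply: reg_dl].
have ram n : reg (fun u => am (iter n sh u)) by apply: reg_shn; apply: reg_am.
have rH : reg H by apply: regM (reg_ap _ _ _); apply: regM.
have nH : nz H.
  apply: nzM; [by apply: regM | exact: reg_ap | | exact: nz_ap].
  apply: nzM => //; last by apply: nz_shn; apply: nz_am.
  by apply: (nz_sh (f := fun v => Xi.[et _ v])); apply: nzX; rewrite ?wt_lv.
have rN := reg_NM.
have rNs : reg Ns.
  by apply: regM => //; apply: reg_io => //; apply: reg_N0.
have AE : eqv (fun u => A u * H u * H (hs u)) (fun u => NM u * G u * H (hs u) - Ns u * G (hs u) * H u).
  move=> u wu; have := GE u wu.
  have em : iter M sh (hs u) = iter m sh u by rewrite iterSr hsK.
  rewrite /A /H em hsK /Ns /numerM !hornerM piE // => E.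
  transitivity (P.[et (lv M) u] * (Xi.[et (lv m) u] * Xi.[et (lv m) (sh u)]) * t.[et (lv M) u] *
    dl (lv M) u * (ap (hs u) * am (iter M sh u)) * (ap u * am (iter m sh u))); first by ring.
  by rewrite E; ring.
have [|g rg gE] := chain rA rG rH rN rNs nH _ AE.
  by move=> u n wu Nu; rewrite NsE ?wt_shn0 //; apply: NNs.
exists g => //; apply: (@reg_eq_on _ T A (twisted_diff T NM Ns 0 g) (fun u => H u * H (hs u))) => //.
- apply: regB; apply: regM => //; exact: reg_hs.
- by apply: regM => //; apply: reg_hs.
- by apply: nzM => //; [apply: reg_hs | apply: nz_hs].
move=> u wu hu; apply: (mulIf hu); rewrite mulrA AE // !gE ?wt_hs0 // /twisted_diff /=; ring.
Qed.

Variables (gh : nat -> {poly K}) (l : nat).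
Hypothesis ghs : forall n, size (gh n) = (l + n).+1.
Hypothesis null : forall i j, i != j -> NullX Xi (gh i * gh j).
Hypothesis up : forall X Y n, diff_divisible X Y ->
  exists x : nat -> K, X * gh n = \sum_(j < n + size X) x j *: gh j.

(** For j <> n0 the product is null anyway, so the assumption refuted here amounts to the square of
    [gh n0] being null. *)
Lemma no_square_null n0 : ~ (forall j, NullX Xi (gh n0 * gh j)).
Proof.
move=> H; have [pi piE] := pi_exists.
have gn0 n : gh n != 0 by rewrite -size_poly_gt0 ghs.
have Ns0 : Ns 0 = 0.
  by rewrite /Ns /numer0 /lrefl subr0 wt0 divr1 subrr mulr0 !mul0r.
apply: (nondegenerate wd reg_NM nz_NM NsE Ns0 _ N_dec top_hp top_gp N_lead' (s := 0)
  (P := gh n0 * gh 0)).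
- by move=> u n wu; rewrite NsE //; apply: NsN.
- by rewrite mulf_neq0.
move=> t; rewrite addn0; apply: (null_DN piE).
have [Y XE] := pi_XEq t piE; have [x xE] := up 0 XE.
have -> : gh n0 * gh 0%N * pi * t = \sum_(j < 0 + size (pi * t)%R) x j *: (gh n0 * gh j).
  transitivity (gh n0 * (pi * t * gh 0%N)); first by ring.
  by rewrite xE mulr_sumr; apply: eq_bigr => j _; rewrite scalerAr.
by apply: (@NullX_sum _ (fun j => gh n0 * gh j)).
Qed.

Theorem recurrence X Y n : diff_divisible X Y -> exists x : nat -> K,
  X * gh n = \sum_(j < n + size X) x j *: gh j /\
  forall j, (j + (size X).-1 < n)%N -> x j = 0.
Proof.
move=> XE; have [X0|X0] := eqVneq X 0.
  by exists (fun=> 0); split=> //; rewrite X0 mul0r big1 // => j _; rewrite scale0r.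
have [x xE] := up n XE; exists x; split=> // n0 n0n.
apply/eqP/negPn/negP => x0; apply: (@no_square_null n0).
have n0N : (n0 < n + size X)%N by rewrite ltn_addr // (leq_ltn_trans _ n0n) // leq_addr.
have [y yE] := up n0 XE.
(* As n0 + deg X < n, the expansion of X * gh n0 stops before gh n, so only products of distinct
   members occur. Expanding X * gh n instead isolates the square of gh n0. *)
have N1 : NullX Xi (X * gh n * gh n0).
  have -> : X * gh n * gh n0 = \sum_(j < n0 + size X) y j *: (gh n * gh j).
    transitivity (gh n * (X * gh n0)); first by ring.
    by rewrite yE mulr_sumr; apply: eq_bigr => j _; rewrite scalerAr.
  apply: (@NullX_sum _ (fun j => gh n * gh j)) => j jn _; apply: null.
  by rewrite gtn_eqF // (leq_trans _ n0n) //; move: jn (size_poly_gt0 X); rewrite X0; lia.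
have N2 : NullX Xi (gh n0 * gh n0).
  have -> : gh n0 * gh n0 = (x n0)^-1 *: (X * gh n * gh n0 +
     \sum_(j < n + size X) (if j == n0 :> nat then 0 else - x j) *: (gh j * gh n0)).
    rewrite xE mulr_suml -big_split /= (bigD1 (Ordinal n0N)) //= eqxx scale0r addr0.
    rewrite big1 ?addr0 => [|j]; last first.
      by rewrite -(inj_eq val_inj) /= => /negbTE ->; rewrite -scalerAl scaleNr subrr.
    by rewrite -scalerAl scalerA mulVf // scale1r.
  apply: NullXZ; apply: NullXD => //.
  apply: (@NullX_sum _ (fun j => gh j * gh n0) (fun j => if j == n0 then 0 else - x j)) => j jn.
  by case: ifP => [_|jn0 _]; [rewrite eqxx | apply: null; rewrite jn0].
by move=> j; have [->//|nj] := eqVneq j n0; apply: null; rewrite eq_sym.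
Qed.
End LowerBound.

(** * Racah polynomials as eigenfunctions *)

Section Eigen.
Variables (K : closedFieldType) (T : lattice K) (a b c d : K).
Local Notation r := (lr T).
Local Notation k := (lk T).
Local Notation wt := (lwt T).
Local Notation sh := (lshift T).
Local Notation hs := (lshift_inv T).
Local Notation et := (leta T).
Local Notation io := (lrefl T).
Local Notation dl := (lwidth T).
Local Notation nu := (lnum T).

Let r0 : r != 0 := lr_neq0 T.
Let k0 : k != 0 := lk_neq0 T.
Hypotheses (wa : wt a != 0) (wb : wt b != 0) (wc : wt c != 0) (wd : wt d != 0).

Definition numer_red u := (u - a) * (u - b) * (u - c) / wt u.
(** In the group of points this is a + b + c - d, and [sh energy_pt] is the point of [dtilde]
    ([pE_zp]). [newton_ratio] is the quotient of consecutive coefficients of the hypergeometric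
    series in the Newton basis. *)
Definition energy_pt := io a (io (io d b) c).
Definition energy_val n := nu n * (nu n - sh energy_pt) / r ^+ n.
Definition newton_basis i : {poly K} := \prod_(j < i) ((et d (nu j))%:P - 'X).
Definition newton_ratio n i := (nu i - nu n) * (nu i - io (sh energy_pt) (nu n)) * r ^+ i
  / (k * nu i.+1 * ((nu i - a) * (nu i - b) * (nu i - c))).
Definition racah_poly n : {poly K} := \sum_(j < n.+1) (\prod_(i < j) newton_ratio n i) *: newton_basis j.

Lemma et_pt e x y : wt x != 0 -> wt y != 0 ->
  et e x - et e y = k * (x - y) * (x - io e y) / wt x.
Proof.
by rewrite /leta /lrefl /lwt => wx wy; field; rewrite wx wy.
Qed.

Lemma wt_nu0 j : wt (nu j) != 0. Proof. by rewrite wt_nu expf_neq0. Qed.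

Lemma eeS j u : wt u != 0 -> (newton_basis j.+1).[et d u] =
  (newton_basis j).[et d u] * (k * (nu j - u) * (nu j - io d u) / r ^+ j).
Proof.
move=> wu; rewrite /newton_basis big_ord_recr /= hornerM hornerD hornerN hornerC hornerX.
by rewrite et_pt ?wt_nu0 // wt_nu.
Qed.

Lemma ee0 x : (newton_basis 0).[x] = 1. Proof. by rewrite /newton_basis big_ord0 hornerC. Qed.

Lemma io_sh_hs u : wt u != 0 -> io d (sh u) = hs (io d u).
Proof. by move=> wu; rewrite io_sh // -(sh_io d wu) shK. Qed.

Lemma io_hs_sh u : wt u != 0 -> io d (hs u) = sh (io d u).
Proof.
by move=> wu; rewrite -{2}(hsK T u) io_sh_hs ?wt_hs0 // hsK.
Qed.

(** A step of x moves both chains of linear factors of the basis element by one place, so only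
    factors at their ends change; the prefactor cancels the one that would be a denominator. *)
Lemma ee_sh j u : wt u != 0 ->
  - io d u * (newton_basis j.+1).[et d (sh u)] =
  (newton_basis j).[et d u] * (k / r ^+ j) * ((hs 0 - u) * (nu j - io d u) * (nu j.+1 - io d u)).
Proof.
move=> wu; have ws : wt (sh u) != 0 by rewrite wt_sh0.
elim: j => [|j IH].
  rewrite eeS // !ee0 io_sh_hs // nu0 nu1 /lshift_inv /lshift expr0 !divr1; field; exact: r0.
rewrite (eeS j.+1 ws) io_sh_hs // mulrA IH (eeS j wu) exprS.
rewrite (nuSl T j.+1) (nuSl T j) /lshift_inv /lshift; field.
by rewrite r0 expf_neq0.
Qed.

Lemma ee_hs j u : wt u != 0 ->
  - u * (newton_basis j.+1).[et d (hs u)] =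
  (newton_basis j).[et d u] * (k / r ^+ j) * ((hs 0 - io d u) * (nu j - u) * (nu j.+1 - u)).
Proof.
move=> wu; have wi : wt (io d u) != 0 by rewrite wt_io0.
have := ee_sh j wi; rewrite ioK // et_io // => <-.
by rewrite -io_hs_sh // et_io ?wt_hs0.
Qed.

Lemma Nred_diff v u : wt v != 0 -> wt u != 0 ->
  numer_red u * (v - io d u) - numer_red (io d u) * (v - u) =
  (u - io d u) * (numer_red v - (v - energy_pt) / wt v * (v - u) * (v - io d u)).
Proof.
move=> wv wu; have wi := wt_io0 wd wu.
rewrite /numer_red wt_io // /energy_pt /lrefl.
move: wa wb wc wd wv wu; rewrite /lwt => ha hb hc hd hv hu; field.
rewrite hb hc hv hu /=.
by have -> // : (1 + (r - 1) * b) * (1 + (r - 1) * c) +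
  (r - 1) * (d - b + - c * (1 + (r - 1) * b)) = 1 + (r - 1) * d by ring.
Qed.

Definition eigen_up u := - io d u * numer_red u / (dl d u * dl (hs d) u).
Definition eigen_down u := - u * numer_red (io d u) / (dl d u * dl (hs d) (hs u)).

(** The operator is bidiagonal in the Newton basis at the nodes eta(0), eta(1), ..., with the
    eigenvalues on the diagonal. *)
Lemma eigen_ee j u : wt u != 0 -> dl d u != 0 -> dl (hs d) u != 0 -> dl (hs d) (hs u) != 0 ->
  eigen_up u * ((newton_basis j.+1).[et d (sh u)] - (newton_basis j.+1).[et d u])
  + eigen_down u * ((newton_basis j.+1).[et d (hs u)] - (newton_basis j.+1).[et d u]) =
  energy_val j.+1 * (newton_basis j.+1).[et d u] - nu j.+1 * k / r ^+ j * numer_red (nu j) * (newton_basis j).[et d u].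
Proof.
move=> wu D0 D1 D2; have wv := wt_nu0 j.
have rj : r ^+ j != 0 by rewrite expf_neq0.
have d1 : dl (hs d) u = u - hs (io d u) by rewrite /lwidth -io_sh // io_sh_hs.
have d2 : dl (hs d) (hs u) = hs u - io d u.
  by rewrite /lwidth -io_sh ?wt_hs0 // hsK.
have H1 := ee_sh j wu; have H2 := ee_hs j wu; have H3 := Nred_diff wv wu.
have SE : - u * ((newton_basis j.+1).[et d (hs u)] - (newton_basis j.+1).[et d u]) =
    (newton_basis j).[et d u] * k / r ^+ j * (nu j - u) * nu j.+1 * dl (hs d) (hs u).
  rewrite mulrBr H2 eeS // d2 nuSl /lshift_inv; field.
  by rewrite r0 rj.
have SE' : - io d u * ((newton_basis j.+1).[et d (sh u)] - (newton_basis j.+1).[et d u]) =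
    - ((newton_basis j).[et d u] * k / r ^+ j * (nu j - io d u) * nu j.+1 * dl (hs d) u).
  rewrite mulrBr H1 eeS // d1 nuSl /lshift_inv; field.
  by rewrite r0 rj.
transitivity (numer_red u / (dl d u * dl (hs d) u) * (- io d u * ((newton_basis j.+1).[et d (sh u)] - (newton_basis j.+1).[et d u]))
  + numer_red (io d u) / (dl d u * dl (hs d) (hs u)) * (- u * ((newton_basis j.+1).[et d (hs u)] - (newton_basis j.+1).[et d u]))).
  by rewrite /eigen_up /eigen_down; ring.
rewrite SE SE'.
transitivity (- ((newton_basis j).[et d u] * k / r ^+ j * nu j.+1 *
   (numer_red u * (nu j - io d u) - numer_red (io d u) * (nu j - u))) / dl d u).
  by field; rewrite D0 D1 D2 rj.
rewrite H3 -/(dl d u) eeS // /energy_val exprS /lshift nuSl wt_nu; field.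
by rewrite D0 r0 rj.
Qed.

Hypothesis nk : forall j, [&& nu j != a, nu j != b & nu j != c].

Lemma energy_diff i j : energy_val i - energy_val j = (nu i - nu j) * (nu i - io (sh energy_pt) (nu j)) / r ^+ i.
Proof.
have := et_pt (sh energy_pt) (wt_nu0 i) (wt_nu0 j); rewrite /leta !wt_nu => E.
apply: (mulfI k0); transitivity (k * (nu i * (nu i - sh energy_pt)) / r ^+ i -
  k * (nu j * (nu j - sh energy_pt)) / r ^+ j); first by rewrite /energy_val; ring.
by rewrite E; ring.
Qed.

Lemma cfac_rec n j : newton_ratio n j * (nu j.+1 * k / r ^+ j * numer_red (nu j)) = energy_val j - energy_val n.
Proof.
have /and3P [na nb nc] : [&& nu j - a != 0, nu j - b != 0 & nu j - c != 0].
  by rewrite !subr_eq0; apply: nk.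
have nz := nu_neq0 T (ltn0Sn j).
rewrite energy_diff /newton_ratio /numer_red wt_nu; move: (io _ _) => w.
have rj : r ^+ j != 0 by rewrite expf_neq0.
by field; rewrite na nb nc nz k0 rj.
Qed.

Lemma Pn_eigen n u : wt u != 0 -> dl d u != 0 -> dl (hs d) u != 0 -> dl (hs d) (hs u) != 0 ->
  eigen_up u * ((racah_poly n).[et d (sh u)] - (racah_poly n).[et d u])
  + eigen_down u * ((racah_poly n).[et d (hs u)] - (racah_poly n).[et d u]) = energy_val n * (racah_poly n).[et d u].
Proof.
move=> wu D0 D1 D2; pose cf j := \prod_(i < j) newton_ratio n i.
pose H (q : {poly K}) := eigen_up u * (q.[et d (sh u)] - q.[et d u]) + eigen_down u * (q.[et d (hs u)] - q.[et d u]).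
(* By [eigen_ee] and [cfac_rec] the partial sums telescope to a single boundary term, whose
   coefficient vanishes at N = n. *)
have HS N : \sum_(j < N.+1) (cf j * H (newton_basis j) - energy_val n * (cf j * (newton_basis j).[et d u])) =
    (energy_val N - energy_val n) * (cf N * (newton_basis N).[et d u]).
  elim: N => [|N IH].
    by rewrite big_ord_recr big_ord0 /H !ee0 /energy_val nu0 /=; ring.
  rewrite big_ord_recr /= IH /H eigen_ee // -(cfac_rec n N).
  have -> : cf N.+1 = cf N * newton_ratio n N by rewrite /cf big_ord_recr.
  by ring.
have := HS n; rewrite subrr mul0r sumrB => /eqP; rewrite subr_eq0 => /eqP E.
have horner_simpl q : (racah_poly n).[q] = \sum_(j < n.+1) cf j * (newton_basis j).[q].
  by rewrite /racah_poly horner_sum; apply: eq_bigr => j _; rewrite hornerZ.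
rewrite !horner_simpl -!sumrB !mulr_sumr -E -big_split; apply: eq_bigr => j _.
by rewrite /H /=; ring.
Qed.

Lemma size_Pn n : (forall i, (i < n)%N -> nu i != nu n /\ nu i != io (sh energy_pt) (nu n)) ->
  size (racah_poly n) = n.+1.
Proof.
move=> ne; have se j : size (newton_basis j) = j.+1.
  rewrite /newton_basis; have -> : \prod_(i < j) ((et d (nu i))%:P - 'X) =
      (-1) ^+ j *: \prod_(i < j) ('X - (et d (nu i))%:P) :> {poly K}.
    rewrite -[X in (-1) ^+ X](card_ord j) -mul_polyC rmorphXn /= rmorphN rmorph1.
    by rewrite -prodrN; apply: eq_bigr => i _; rewrite opprB.
  by rewrite size_scale ?signr_eq0 // size_prod_XsubC /index_enum -enumT size_enum_ord.
have c0 : \prod_(i < n) newton_ratio n i != 0.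
  apply/prodf_neq0 => i _; have [n1 n2] := ne i (ltn_ord i); have /and3P [na nb nc] := nk i.
  by rewrite /newton_ratio !mulf_neq0 ?invr_eq0 ?subr_eq0 ?expf_neq0 ?mulf_neq0 ?subr_eq0 ?nu_neq0.
rewrite /racah_poly big_ord_recr /= addrC size_polyDl size_scale // se // ltnS.
rewrite (leq_trans (size_sum _ _ _)) //; apply/bigmax_leqP => i _.
by rewrite (leq_trans (size_scale_leq _ _)) // se.
Qed.
End Eigen.

(** * The twist of the parameters *)

Section Twist.
Variables (K : closedFieldType) (T : lattice K) (a b c d : K).
Local Notation wt := (lwt T).
Local Notation hs := (lshift_inv T).
Local Notation io := (lrefl T).
Local Notation dl := (lwidth T).
Local Notation ap := (quad_up T).
Local Notation am := (quad_down T).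
Local Notation lv := (level T d).
Local Notation bb := (coef_up T c d).
Local Notation bs := (coef_down T c d).

Hypotheses (wa : wt a != 0) (wb : wt b != 0) (wd : wt d != 0).

Lemma Bf_E u : wt u != 0 -> ap a b u * bb u = eigen_up T a b c d u.
Proof.
move=> wu; rewrite /quad_up /coef_up /numer0 /eigen_up /numer_red -/(lv 1) invfM.
by rewrite /lrefl; ring.
Qed.

Lemma am_hs u : wt u != 0 -> am a b d (hs u) = ap a b (io d u).
Proof. by move=> wu; rewrite /quad_down -io_sh ?wt_hs0 // hsK. Qed.

Lemma Df_E u : wt u != 0 -> am a b d (hs u) * bs u = eigen_down T a b c d u.
Proof.
move=> wu; rewrite am_hs // /quad_up /coef_down /numer0 /eigen_down /numer_red -/(lv 1) invfM.
have E : - u = (io d u - d) / wt (io d u).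
  by rewrite -{1}(ioK wd wu) {1}/lrefl; ring.
by rewrite E; ring.
Qed.

(** The point of d - a + 1, resp. d q / a, for x the point of a; [twist_scale] is the constant
    alpha. *)
Definition twist_pt x := io (hs d) x.
Definition twist_scale := wt a * wt b / wt (hs d).

Let wh : wt (hs d) != 0. Proof. by rewrite wt_hs0. Qed.

Lemma am_twist u : wt u != 0 -> am a b d u = twist_scale * ap (twist_pt a) (twist_pt b) u.
Proof.
move=> wu; rewrite /quad_down /quad_up wt_io // /twist_scale /twist_pt /lrefl.
move: (hs d) wh wa wb wu => e; rewrite /lwt => h1 h2 h3 h4; field.
by rewrite h1 h2 h3 h4.
Qed.

Lemma ap_twist u : wt u != 0 -> ap a b u = twist_scale * am (twist_pt a) (twist_pt b) d u.
Proof.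
by move=> wu; rewrite -{1}(ioK wh wu) -/(am a b d (io (hs d) u)) am_twist ?wt_io0.
Qed.

(** Split into even and odd parts, the diagonal terms of the operator and of its twist differ only
    by a product of two odd parts, which is constant. The seeds are therefore eigenfunctions for the
    same U with a shifted eigenvalue. *)
Lemma U_diff u : wt u != 0 -> dl d u != 0 -> dl (lv 1) u != 0 -> dl (lv 1) (hs u) != 0 ->
  ap a b u * bb u + am a b d (hs u) * bs u
  = am a b d u * bb u + ap a b (hs u) * bs u + 4 * Qg T (hs d) a b * Qg T d c d.
Proof.
move=> wu D0 D1 D2; have whu : wt (hs u) != 0 by rewrite wt_hs0.
rewrite /quad_down /quad_up (QE a b wh wu) (QiE a b wh wu) (QE a b wh whu) (QiE a b wh whu).
rewrite /coef_up /coef_down /numer0 (QE c d wd wu) (QiE c d wd wu) !hornerC -/(lv 1).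
move: D0 D1 D2; move: (dl d u) (dl (lv 1) u) (dl (lv 1) (hs u)) (_.[_]) (_.[_]) (_.[_]) (Qg _ _ _ _) (Qg _ _ _ _).
move=> x y z h1 h2 h3 g1 g2 x0 y0 z0; field.
by rewrite x0 y0 z0.
Qed.
End Twist.

(** * Nonvanishing conditions in the group of points *)

Section Points.
Variables (K : closedFieldType) (T : lattice K).
Local Notation r := (lr T).
Local Notation k := (lk T).
Local Notation wt := (lwt T).
Local Notation sh := (lshift T).
Local Notation hs := (lshift_inv T).
Local Notation et := (leta T).
Local Notation io := (lrefl T).
Local Notation dl := (lwidth T).
Local Notation nu := (lnum T).

(* The points with nonzero weight form a group under [u + v * wt u], in which
   [io e u] is [e - u] and [sh u] is [u + 1]; [pt i j k l n] stands for
   [i a + j b + k c + l d + n]. *)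
Variable pt : int -> int -> int -> int -> int -> K.
Hypothesis pt_sh : forall i j k l n, sh (pt i j k l n) = pt i j k l (n + 1).
Hypothesis pt_io : forall i j k l n i' j' k' l' n',
  io (pt i j k l n) (pt i' j' k' l' n') = pt (i - i') (j - j') (k - k') (l - l') (n - n').
Hypothesis pt0 : pt 0 0 0 0 0 = 0.
Hypothesis pt_wt : forall i j k l n, wt (pt i j k l n) != 0.
Hypothesis pt_inj : forall i j k l n i' j' k' l' n',
  pt i j k l n = pt i' j' k' l' n' -> [/\ i = i', j = j', k = k', l = l' & n = n'].

Local Notation a := (pt 1 0 0 0 0).
Local Notation b := (pt 0 1 0 0 0).
Local Notation c := (pt 0 0 1 0 0).
Local Notation d := (pt 0 0 0 1 0).
Local Notation a' := (twist_pt T d a).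
Local Notation b' := (twist_pt T d b).
Local Notation lv := (level T d).
Local Notation ap := (quad_up T a b).
Local Notation am := (quad_down T a b d).

Let r0 : r != 0 := lr_neq0 T.
Let k0 : k != 0 := lk_neq0 T.

Lemma pt_hs i j k l n : hs (pt i j k l n) = pt i j k l (n - 1).
Proof. by rewrite -[n in LHS](subrK 1) -pt_sh shK. Qed.

Lemma pt_shn s i j k l n : iter s sh (pt i j k l n) = pt i j k l (n + s%:Z).
Proof.
elim: s => [|s IH] /=; first by rewrite addr0.
by rewrite IH pt_sh; congr (pt _ _ _ _ _); lia.
Qed.

Lemma pt_hsn s i j k l n : iter s hs (pt i j k l n) = pt i j k l (n - s%:Z).
Proof. by rewrite -[n in LHS](subrK s%:Z) -pt_shn shnK. Qed.

Lemma pt_nu n : nu n = pt 0 0 0 0 n%:Z.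
Proof. by rewrite -(shn0 T n) -[X in iter _ _ X]pt0 pt_shn add0r. Qed.

Lemma pt_lv s : lv s = pt 0 0 0 1 (- s%:Z).
Proof. by rewrite /level pt_hsn add0r. Qed.

Lemma pt_tw_a : a' = pt (-1) 0 0 1 (-1).
Proof. by rewrite /twist_pt pt_hs pt_io. Qed.

Lemma pt_tw_b : b' = pt 0 (-1) 0 1 (-1).
Proof. by rewrite /twist_pt pt_hs pt_io. Qed.

Let ptE := (pt_tw_a, pt_tw_b, pt_lv, pt_nu, pt_sh, pt_hs, pt_shn, pt_hsn, pt_io).

Ltac pt_neq := apply/eqP; rewrite ?ptE => /pt_inj []; lia.

Lemma quad_zero x y u : wt u != 0 -> (u - x) * (u - y) / wt u = 0 -> u = x \/ u = y.
Proof.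
move=> wu /eqP; rewrite !mulf_eq0 invr_eq0 (negbTE wu) orbF !subr_eq0.
by case/orP => /eqP; [left | right].
Qed.

Lemma am_zero u : wt u != 0 -> am u = 0 -> u = a' \/ u = b'.
Proof.
move=> wu; rewrite am_twist //.
have tg0 : twist_scale T a b d != 0 by rewrite /twist_scale !mulf_neq0 ?invr_eq0 // wt_hs0.
by move/eqP; rewrite mulf_eq0 (negbTE tg0) => /eqP; apply: quad_zero.
Qed.

Lemma pt_coprime u i j : wt u != 0 -> am (iter i sh u) = 0 -> ap (iter j hs u) != 0.
Proof.
move=> wu /am_zero; rewrite wt_shn0 => /(_ wu) H; apply/eqP => /quad_zero.
rewrite wt_hsn0 => /(_ wu); rewrite -(shnK T i u).
by case: H => ->; rewrite !ptE => -[] /pt_inj []; lia.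
Qed.

Variable m : nat.
Local Notation M := m.+1.
Local Notation NM := (numerM T a b c d m).

Lemma NM_zero u : wt u != 0 -> NM u = 0 ->
  [\/ u = iter M hs c, u = iter M hs d, u = a | u = b].
Proof.
move=> wu /eqP; rewrite mulf_eq0 => /orP [] /eqP /quad_zero; rewrite ?wt_shn0 => /(_ wu).
  by rewrite -{3 4}(shnK T M u) => -[] ->; [apply: Or41 | apply: Or42].
by case=> ->; [apply: Or43 | apply: Or44].
Qed.

Lemma pt_NsN u n : wt u != 0 -> NM (io (lv M) u) = 0 -> NM (iter n sh u) != 0.
Proof.
move=> wu; have wl : wt (lv M) != 0 by rewrite wt_lv.
move=> /NM_zero; rewrite wt_io0 // => /(_ isT) H.
have {H} : [\/ u = io (lv M) (iter M hs c), u = io (lv M) (iter M hs d),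
   u = io (lv M) a | u = io (lv M) b].
  by rewrite -{1 2 3 4}(ioK wl wu); case: H => ->; [apply: Or41|apply: Or42|apply: Or43|apply: Or44].
move=> H; apply/eqP => /NM_zero; rewrite wt_shn0 => /(_ wu).
by case: H => ->; rewrite !ptE => -[] /pt_inj []; lia.
Qed.

Lemma pt_NNs u n : wt u != 0 -> NM u = 0 -> NM (io (lv M) (iter n sh u)) != 0.
Proof.
move=> wu; have wl : wt (lv M) != 0 by rewrite wt_lv.
move=> /(NM_zero wu) H; apply/eqP => /NM_zero; rewrite wt_io0 ?wt_shn0 // => /(_ isT).
by case: H => ->; rewrite !ptE => -[] /pt_inj []; lia.
Qed.

Let kap e x y := e - x - y - (r - 1) * (x * y).

(** The right-hand side is a nonzero weight times the group element 2 e + n - x1 - y1 - x2 - y2, so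
    nonvanishing becomes a statement about exponents. *)
Lemma N_lead_group (e x1 y1 x2 y2 : K) n :
  wt e != 0 -> wt x1 != 0 -> wt y1 != 0 -> wt x2 != 0 -> wt y2 != 0 ->
  wt e ^+ 2 * nu n + wt e * kap e x2 y2 + wt x2 * wt y2 * kap e x1 y1 =
  wt x1 * wt y1 * wt x2 * wt y2 * io (io (io e x1) y1) (io x2 (io (iter n sh e) y2)).
Proof.
move=> we wx1 wy1 wx2 wy2; set E := iter n sh e.
have wE : wt E != 0 by rewrite wt_shn0.
have io2 A B C : wt B != 0 -> wt C != 0 -> io A (io B C) = (A * wt C - B + C) / wt B.
  rewrite /lrefl /lwt => wB wC; by field; rewrite wC wB.
rewrite io2 ?wt_io0 // wt_io // /E wt_shn shnE expE /kap /lrefl.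
move: we wx1 wy1 wx2 wy2; rewrite /lwt => h h1 h2 h3 h4; field.
by rewrite h1 h2 h3 h4.
Qed.

Lemma pt_N_lead s n : let e := lv (M + s).+2 in
  let x1 := iter (M + s.+1) hs c in let y1 := iter (M + s.+1) hs d in
  let x2 := iter s.+1 hs a in let y2 := iter s.+1 hs b in
  wt e ^+ 2 * nu n + wt e * kap e x2 y2 + wt x2 * wt y2 * kap e x1 y1 != 0.
Proof.
lazy zeta; rewrite N_lead_group ?ptE //.
rewrite !mulf_neq0 ?ptE // -pt0; pt_neq.
Qed.

Lemma pt_zeta_lead n :
  wt (hs a) * wt (hs b) * nu n + (lv M.+1 - hs a - hs b - (r - 1) * (hs a * hs b)) * r ^+ n != 0.
Proof.
have -> : wt (hs a) * wt (hs b) * nu n + (lv M.+1 - hs a - hs b - (r - 1) * (hs a * hs b)) * r ^+ n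
  = wt (hs a) * wt (hs b) * io (io (iter n sh (lv M.+1)) (hs a)) (hs b).
  have : wt (hs a) != 0 by rewrite !ptE.
  have : wt (hs b) != 0 by rewrite !ptE.
  move: (hs a) (hs b) (lv M.+1) => x y e; rewrite shnE expE /lrefl /lwt => wx wy.
  by field; rewrite wx wy.
by apply: mulf_neq0; [apply: mulf_neq0; rewrite wt_hs0 | rewrite !ptE -pt0; pt_neq].
Qed.

(** As the group element n + d - 1 - a - b, the node of a gauged column never meets the nodes [nu i]
    of the plain ones. *)
Lemma pt_gauge n : gauge_node T a b d n = io (io (iter n sh (hs d)) a) b.
Proof.
rewrite /gauge_node shnE expE /lrefl /lshift_inv; have := pt_wt 1 0 0 0 0; have := pt_wt 0 1 0 0 0.
by rewrite /lwt => wy wx; field; rewrite r0 wx wy.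
Qed.

Variable dg : nat -> nat.
Hypothesis dg_lt : forall i j, (i < j < M)%N -> (dg i < dg j)%N.

Definition seed_poly j := racah_poly T a' b' c d (dg j).
Definition main_poly n := racah_poly T a b c d n.

Lemma nu_neq i j : i <> j -> nu i != nu j.
Proof. move=> ij; pt_neq. Qed.

Lemma ppoly_size n : size (main_poly n) = n.+1.
Proof.
apply: size_Pn; first by move=> j; apply/and3P; split; pt_neq.
by move=> i ni; split; [pt_neq | rewrite /energy_pt; pt_neq].
Qed.

Lemma fpoly_size j : size (seed_poly j) = (dg j).+1.
Proof.
apply: size_Pn; first by move=> i; apply/and3P; split; pt_neq.
by move=> i ni; split; [pt_neq | rewrite /energy_pt; pt_neq].
Qed.

Let Uf u := ap u * coef_up T c d u + am (hs u) * coef_down T c d u.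
Let E n := - energy_val T a b c d n.
Let Lf j := 4 * Qg T (hs d) a b * Qg T d c d - twist_scale T a b d * energy_val T a' b' c d (dg j).

Lemma ppoly_rec n u : wt u != 0 ->
  [&& dl d u != 0, dl (lv 1) u != 0 & dl (lv 1) (hs u) != 0] ->
  ap u * coef_up T c d u * (main_poly n).[et d (sh u)] + am (hs u) * coef_down T c d u * (main_poly n).[et d (hs u)]
  = (Uf u - E n) * (main_poly n).[et d u].
Proof.
move=> wu /and3P [D0 D1 D2].
have nk j : [&& nu j != a, nu j != b & nu j != c] by apply/and3P; split; pt_neq.
have := @Pn_eigen _ T a b c d (pt_wt _ _ _ _ _) (pt_wt _ _ _ _ _) (pt_wt _ _ _ _ _)
  (pt_wt _ _ _ _ _) nk n u wu D0 D1 D2.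
rewrite -Bf_E // -Df_E // /Uf /E opprK -/(main_poly n) => H.
by rewrite mulrDl -H; ring.
Qed.

Lemma fpoly_rec j u : wt u != 0 ->
  [&& dl d u != 0, dl (lv 1) u != 0 & dl (lv 1) (hs u) != 0] ->
  am u * coef_up T c d u * (seed_poly j).[et d (sh u)] + ap (hs u) * coef_down T c d u * (seed_poly j).[et d (hs u)]
  = (Uf u - Lf j) * (seed_poly j).[et d u].
Proof.
move=> wu /and3P [D0 D1 D2].
have nk i : [&& nu i != a', nu i != b' & nu i != c] by apply/and3P; split; pt_neq.
have wa' : wt a' != 0 by rewrite ptE.
have wb' : wt b' != 0 by rewrite ptE.
have := @Pn_eigen _ T a' b' c d wa' wb' (pt_wt _ _ _ _ _)
  (pt_wt _ _ _ _ _) nk (dg j) u wu D0 D1 D2.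
rewrite -Bf_E // -Df_E // -/(seed_poly j) /Uf U_diff // /Lf => H.
have whu : wt (hs u) != 0 by rewrite wt_hs0.
rewrite (@am_twist _ T a b d (pt_wt _ _ _ _ _) (pt_wt _ _ _ _ _) (pt_wt _ _ _ _ _) u wu).
rewrite (@ap_twist _ T a b d (pt_wt _ _ _ _ _) (pt_wt _ _ _ _ _) (pt_wt _ _ _ _ _) _ whu).
move: H; move: (quad_up _ _ _ u) (quad_down _ _ _ _ (hs u)) (twist_scale _ _ _ _) => x y g.
move: (coef_up _ _ _ _) (coef_down _ _ _ _) (seed_poly j).[_] (seed_poly j).[_] (seed_poly j).[_] (energy_val _ _ _ _ _ _) => B D q2 q3 q1 e H.
transitivity (g * (x * B * (q1 - q3) + y * D * (q2 - q3)) + g * (x * B + y * D) * q3); first by ring.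
by rewrite H; ring.
Qed.

Lemma E_inj i j : i != j -> E i != E j.
Proof.
move=> ij; rewrite /E eqr_opp -subr_eq0 energy_diff.
rewrite mulf_neq0 ?invr_eq0 ?expf_neq0 // mulf_neq0 // subr_eq0.
  by apply: nu_neq; apply/eqP.
by rewrite /energy_pt; pt_neq.
Qed.

Theorem uniform_recurrence : exists (Xi : {poly K}) (gh : nat -> {poly K}) (l : nat),
  [/\ (l + 'C(M, 2) = \sum_(j < M) dg j)%N, size Xi = l.+1, forall n, size (gh n) = (l + n).+1,
    eq_valid T (casoratian T a b d M (plain_col seed_poly)) (fun u => eta_diffs T d M u * Xi.[et (lv m) u]) &
    (forall n, eq_valid T (casoratian T a b d M.+1 (last_gauge_col m seed_poly (main_poly n)))
       (fun u => eta_diffs T d M.+1 u * (gh n).[et (lv M) u])) /\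
    forall X Y n, diff_divisible T d m Xi X Y -> exists x : nat -> K,
      X * gh n = \sum_(j < n + size X) x j *: gh j /\
      forall j, (j + (size X).-1 < n)%N -> x j = 0].
Proof.
have wa := pt_wt 1 0 0 0 0; have wb := pt_wt 0 1 0 0 0; have wd := pt_wt 0 0 0 1 0.
have nu_dg i j : (i < j < M)%N -> nu (dg j) != nu (dg i).
  by move/dg_lt => ij; apply: nu_neq; lia.
have fs j : (j < M)%N -> size (seed_poly j) = (dg j).+1 by move=> _; apply: fpoly_size.
have gd n i : (i < M)%N -> gauge_node T a b d n != nu (dg i).
  by move=> _; rewrite pt_gauge; pt_neq.
have [Xi [XiE Xis]] := plain_casoratian_poly wa wb wd fs nu_dg.
have /boolp.choice [gh ghP] := gauge_casoratian_poly wa wb wd fs ppoly_size nu_dg gd.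
have dgi i : (i < M)%N -> (i <= dg i)%N.
  elim: i => // i IH iM; rewrite (leq_ltn_trans (IH (ltnW iM))) // dg_lt // iM.
  by rewrite ltnSn.
have le : ('C(M, 2) <= \sum_(j < M) dg j)%N.
  rewrite -bin2_sum big_mkord; apply: leq_sum => j _; exact: dgi.
have bS : 'C(M.+1, 2) = ('C(M, 2) + M)%N by rewrite binS bin1.
pose l := (\sum_(j < M) dg j - 'C(M, 2))%N.
have ghs n : size (gh n) = (l + n).+1 by have [_] := ghP n; rewrite bS /l; lia.
have ghE n := proj1 (ghP n).
have Xs : size Xi = l.+1 by move: Xis; rewrite /l; lia.
have X0 : Xi != 0 by rewrite -size_poly_gt0 Xs.
exists Xi, gh, l; split => //; first by rewrite /l; lia.
split=> // X Y n XE; refine (recurrence wa wb wd pt_NsN pt_NNs pt_N_lead X0 ghs _ _ n XE).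
  move=> i j ij; apply: (null_pair wd (U := Uf) (Lf := Lf) (E := E) _ ppoly_rec XiE ghE).
    by move=> s u _; apply: fpoly_rec.
  exact: E_inj.
move=> X1 Y1 n1 XE1.
exact: (span_mul wd ppoly_size pt_coprime pt_zeta_lead XiE ghE ghs n1 XE1).
Qed.
End Points.

(** * The Racah and q-Racah lattices *)

Section Qpow.
Variables (R : realType) (q : R).
Hypothesis q0 : 0 < q.

Lemma qpowD x y : qpow q (x + y) = qpow q x * qpow q y.
Proof.
case: x y => [x1 x2] [y1 y2]; rewrite /qpow /= mulrDl cosD sinD powRD; last first.
  by rewrite (gt_eqF q0) implybT.
by rewrite rmorphM /=; apply/eqP; rewrite eq_complex /=; apply/andP; split; apply/eqP; ring.
Qed.

Lemma qpow0 : qpow q 0 = 1.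
Proof. by rewrite /qpow /= mul0r cos0 sin0 powRr0 mul1r. Qed.

Lemma qpow1 : qpow q 1 = q%:C.
Proof. by rewrite /qpow /= mul0r cos0 sin0 powRr1 ?ltW // mulr1. Qed.

Lemma qpow_neq0 x : qpow q x != 0.
Proof.
have := qpowD x (- x); rewrite subrr qpow0 => /esym; apply: contra_eq_neq => ->.
by rewrite mul0r eq_sym oner_eq0.
Qed.

Lemma qpowN x : qpow q (- x) = (qpow q x)^-1.
Proof.
apply: (mulfI (qpow_neq0 x)); rewrite -qpowD subrr qpow0 divff //.
exact: qpow_neq0.
Qed.

Lemma qpowS x : qpow q (x + 1) = qpow q x * q%:C.
Proof. by rewrite qpowD qpow1. Qed.

Lemma qpow_addn x n : qpow q (x + n%:R) = qpow q x * q%:C ^+ n.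
Proof.
elim: n => [|n IH]; first by rewrite addr0 mulr1.
by rewrite -addn1 natrD addrA qpowS IH exprD mulrA.
Qed.

Lemma qpow_muln x n : qpow q (n%:R * x) = qpow q x ^+ n.
Proof.
elim: n => [|n IH]; first by rewrite mul0r qpow0.
by rewrite -addn1 natrD mulrDl mul1r qpowD IH exprD.
Qed.
End Qpow.
Section Lattices.
Variables (R : realType) (m : model R).
Hypothesis hm : model_ok m.
Local Notation C := R[i].

Definition latr : C := match m with Racah => 1 | qRacah q => q%:C^-1 end.
Definition latk : C := match m with Racah => 1 | qRacah q => (q%:C^-1 - 1) ^+ 2 end.
Definition par_point (x : C) : C := match m with Racah => - x | qRacah q => (x - 1) / (q%:C^-1 - 1) end.
Definition pos_point (x : C) : C :=
  match m with Racah => x | qRacah q => (qpow q (- x) - 1) / (q%:C^-1 - 1) end.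

Lemma q_facts q : m = qRacah q -> [/\ 0 < q, q%:C != 0 & q%:C^-1 - 1 != 0].
Proof.
move=> E; move: hm; rewrite E /= => /andP [q0 q1]; split=> //.
  by rewrite fmorph_eq0 gt_eqF.
by rewrite subr_eq0 -(inj_eq invr_inj) invrK invr1 fmorph_eq1 lt_eqF.
Qed.

Lemma sub1q_neq0 q : m = qRacah q -> 1 - q%:C != 0.
Proof. by move=> E; move: hm; rewrite E /= => /andP [q0 q1]; rewrite subr_eq0 eq_sym fmorph_eq1 lt_eqF. Qed.

Lemma latr_neq0 : latr != 0.
Proof.
rewrite /latr; case E: m => [|q]; first exact: oner_neq0.
by have [_ q0 _] := q_facts E; rewrite invr_neq0.
Qed.

Lemma latk_neq0 : latk != 0.
Proof.
rewrite /latk; case E: m => [|q]; first exact: oner_neq0.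
by have [_ _ q0] := q_facts E; rewrite expf_neq0.
Qed.

Lemma lat2_neq0 : 2 != 0 :> C. Proof. by rewrite pnatr_eq0. Qed.

Lemma latnu_neq0 n : \sum_(i < n.+1) latr ^+ i != 0.
Proof.
rewrite gt_eqF // big_ord_recl expr0 ltr_pwDl ?ltr01 // sumr_ge0 // => i _.
rewrite exprn_ge0 // /latr; case E: m => [|q] //.
by have [q0 _ _] := q_facts E; rewrite invr_ge0 ler0c ltW.
Qed.

Definition lat : lattice C := Lattice latr_neq0 latk_neq0 lat2_neq0 latnu_neq0.

Local Notation wt := (lwt lat).
Local Notation sh := (lshift lat).
Local Notation hs := (lshift_inv lat).
Local Notation et := (leta lat).
Local Notation io := (lrefl lat).

Lemma wt_ux x : wt (pos_point x) != 0.
Proof.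
rewrite /lwt /= /latr /pos_point; case E: m => [|q]; first by rewrite subrr mul0r addr0 oner_neq0.
have [q0 _ q1] := q_facts E; rewrite mulrC mulfVK // addrC subrK.
exact: qpow_neq0.
Qed.

Lemma ux0 : pos_point 0 = 0.
Proof. by rewrite /pos_point; case: m => // q; rewrite oppr0 qpow0 subrr mul0r. Qed.

Lemma uxS x : pos_point (x + 1) = sh (pos_point x).
Proof.
rewrite /lshift /= /latr /pos_point; case E: m => [|q]; first by rewrite mul1r.
have [q0 qn q1] := q_facts E; rewrite opprD qpowD // [qpow q (- 1)]qpowN // qpow1 //.
have q2 := sub1q_neq0 E.
move: (q%:C) qn q1 q2 => z z0 z1 z2.
by field; rewrite ?mulN1r z0 z2.
Qed.

Lemma ux_addn x n : pos_point (x + n%:R) = iter n sh (pos_point x).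
Proof.
elim: n => [|n IH]; first by rewrite addr0.
by rewrite -addn1 natrD addrA uxS IH addn1.
Qed.

Lemma ux_nat n : pos_point n%:R = lnum lat n.
Proof. by rewrite -(shn0 lat) -ux0 -ux_addn add0r. Qed.

Lemma etaE x l : eta m x l = et (par_point (pd l)) (pos_point x).
Proof.
rewrite /leta /lwt /eta /= /latr /latk /pos_point /par_point; case E: m => [|q].
  by rewrite subrr mul0r addr0 divr1 mul1r opprK.
have [q0 qn q1] := q_facts E; rewrite qpowN //.
have qx := qpow_neq0 q0 x; move: (qpow q x) qx => y y0.
have -> : 1 + (q%:C^-1 - 1) * ((y^-1 - 1) / (q%:C^-1 - 1)) = y^-1.
  by rewrite mulrC mulfVK // addrC subrK.
set t := q%:C^-1 - 1 in q1 *; field.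
by rewrite y0 q1.
Qed.

Lemma zp_shift l n : par_point (pd (shift m l n%:Z)) = iter n hs (par_point (pd l)).
Proof.
elim: n => [|n IH].
  by rewrite /par_point /shift; case: m => [|q] /=; rewrite ?addr0 ?mulr1.
rewrite iterS -IH /lshift_inv /par_point /shift /= /latr; case E: m => [|q] /=.
  by rewrite divr1 -!pmulrn -addn1 natrD; ring.
have [q0 qn q1] := q_facts E; rewrite -!exprnP exprS; move: (q%:C ^+ n) => y.
have q2 := sub1q_neq0 E.
move: (q%:C) qn q1 q2 => z z0 z1 z2.
by field; rewrite ?mulN1r z0 z2.
Qed.

Lemma zp_shiftN l : par_point (pd (shift m l (- 1))) = sh (par_point (pd l)).
Proof.
rewrite /lshift /par_point /shift /= /latr; case E: m => [|q] /=; first by rewrite opprD opprK mul1r.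
have [q0 qn q1] := q_facts E; have q2 := sub1q_neq0 E; rewrite exprN1.
move: (q%:C) qn q1 q2 => z z0 z1 z2.
by field; rewrite ?mulN1r z0 z2.
Qed.

Lemma wt_zp_q q x : m = qRacah q -> wt (par_point x) = x.
Proof.
move=> E; rewrite /lwt /par_point /= /latr E; have [_ _ q1] := q_facts E.
by rewrite mulrC mulfVK // addrC subrK.
Qed.

(** Unit, membership and division of the group in which parameters live: the complex numbers under
    addition, or the nonzero ones under multiplication. *)
Definition par_unit : C := match m with Racah => 0 | qRacah _ => 1 end.
Definition par_ok (x : C) : bool := match m with Racah => true | qRacah _ => x != 0 end.
Definition par_div (x y : C) : C := match m with Racah => x - y | qRacah _ => x / y end.

Lemma zp_io x y : par_ok y -> io (par_point x) (par_point y) = par_point (par_div x y).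
Proof.
rewrite /lrefl /lwt /par_div /par_point /par_ok /= /latr; case E: m => [|q] => [_|y0].
  by rewrite subrr mul0r addr0 divr1; ring.
have [_ _ q1] := q_facts E.
have -> : 1 + (q%:C^-1 - 1) * ((y - 1) / (q%:C^-1 - 1)) = y.
  by rewrite mulrC mulfVK // addrC subrK.
by move: (_ - 1) q1 => t t0; field; rewrite y0 t0.
Qed.

Lemma wt_zp0 x : par_ok x -> wt (par_point x) != 0.
Proof.
rewrite /par_ok; case E: m => [|q] x0; last by rewrite (wt_zp_q _ E).
by rewrite /lwt /= /latr E subrr mul0r addr0 oner_neq0.
Qed.

Lemma zp_sh x : sh (par_point x) = par_point (match m with Racah => x - 1 | qRacah q => x / q%:C end).
Proof.
rewrite /lshift /par_point /= /latr; case E: m => [|q] /=; first by ring.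
have [_ qn q1] := q_facts E; have q2 := sub1q_neq0 E.
move: (q%:C) qn q1 q2 => z z0 z1 z2.
by field; rewrite ?mulN1r z0 z2.
Qed.

Lemma zp_hs x : hs (par_point x) = par_point (match m with Racah => x + 1 | qRacah q => x * q%:C end).
Proof.
rewrite /lshift_inv /par_point /= /latr; case E: m => [|q] /=; first by rewrite divr1; ring.
have [_ qn q1] := q_facts E; have q2 := sub1q_neq0 E.
move: (q%:C) qn q1 q2 => z z0 z1 z2.
by field; rewrite ?mulN1r z0 z2.
Qed.

Lemma zp_twist_a l : par_ok (pa l) -> par_point (pa (twist m l)) = twist_pt lat (par_point (pd l)) (par_point (pa l)).
Proof.
move=> ga; rewrite /twist_pt zp_hs zp_io //; congr par_point; rewrite /twist /par_div.
by case: (m) => //=; ring.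
Qed.

Lemma zp_twist_b l : par_ok (pb l) -> par_point (pb (twist m l)) = twist_pt lat (par_point (pd l)) (par_point (pb l)).
Proof.
move=> ga; rewrite /twist_pt zp_hs zp_io //; congr par_point; rewrite /twist /par_div.
by case: (m) => //=; ring.
Qed.
End Lattices.

(** The variables t, y, z, X and p stand for q, q ^ i, q ^ n, q ^ x and q ^ -1 - 1, so that [field]
    sees no powers. *)
Lemma cfac_alg (F : fieldType) (dt y z X t a b c d p : F) :
  t != 0 -> p != 0 -> X != 0 -> y != 0 -> z != 0 -> ((t * y)^-1 - 1) / p != 0 ->
  [&& (y^-1 - 1) / p != (a - 1) / p, (y^-1 - 1) / p != (b - 1) / p & (y^-1 - 1) / p != (c - 1) / p] ->
  ((y^-1 - 1) / p - (z^-1 - 1) / p) * ((y^-1 - 1) / p - (dt * z - 1) / p) / y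
  / (p ^+ 2 * (((t * y)^-1 - 1) / p) * (((y^-1 - 1) / p - (a - 1) / p) *
     ((y^-1 - 1) / p - (b - 1) / p) * ((y^-1 - 1) / p - (c - 1) / p)))
  * ((y^-1 - 1) * (1 - d * y) - (X^-1 - 1) * (1 - d * X)) =
  (1 - z^-1 * y) * (1 - dt * z * y) * (1 - X^-1 * y) * (1 - d * X * y)
  / ((1 - a * y) * (1 - b * y) * (1 - c * y) * (1 - t * y)) * t.
Proof.
move=> t0 p0 X0 y0 z0 n1.
have inj u v : (u - 1) / p != (v - 1) / p -> u != v by apply: contraNneq => ->.
case/and3P => /inj na /inj nb /inj nc.
have D u : y^-1 != u -> 1 - u * y != 0.
  by apply: contraNneq => /subr0_eq H; rewrite -[y^-1]mul1r H mulfK.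
move: (D _ na) (D _ nb) (D _ nc) => a0 b0 c0.
have n2 : 1 - t * y != 0.
  by apply: contraNneq n1 => /subr0_eq H; rewrite -H invr1 subrr mul0r.
by field; rewrite ?mulN1r t0 X0 y0 z0 p0 ?a0 ?b0 ?c0 ?n2.
Qed.

Lemma ap_alg (F : fieldType) (a b X y t : F) : t != 0 -> X != 0 -> y != 0 ->
  (((X * y)^-1 - 1) / t - (a - 1) / t) * (((X * y)^-1 - 1) / t - (b - 1) / t) / (X * y)^-1 =
  X^-1 * (y^-1 / t ^+ 2) * ((1 - a * X * y) * (1 - b * X * y)).
Proof. by move=> t0 X0 y0; rewrite invrK; field; rewrite t0 X0 y0. Qed.

(** * Matching with the hypergeometric definitions *)

Section Matching.
Variables (R : realType) (m : model R).
Hypothesis hm : model_ok m.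
Local Notation C := R[i].
Local Notation T := (lat hm).
Local Notation wt := (lwt T).
Local Notation sh := (lshift T).
Local Notation et := (leta T).
Local Notation nu := (lnum T).
Local Notation zp := (par_point m).
Local Notation ux := (pos_point m).

Lemma nu_zp n : nu n = zp (match m with Racah => - n%:R | qRacah q => q%:C ^- n end).
Proof.
rewrite -ux_nat /pos_point /par_point; case E: m => [|q]; first by rewrite opprK.
have [q0 _ _] := q_facts hm E.
by have := qpow_addn q0 0 n; rewrite add0r qpow0 mul1r qpowN // => ->.
Qed.

Variable l : params R.
Local Notation za := (zp (pa l)).
Local Notation zb := (zp (pb l)).
Local Notation zc := (zp (pc l)).
Local Notation zd := (zp (pd l)).
Hypotheses (ga : par_ok m (pa l)) (gb : par_ok m (pb l)) (gc : par_ok m (pc l)) (gd : par_ok m (pd l)).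

Lemma pE_zp : sh (energy_pt T za zb zc zd) = zp (dtilde m l).
Proof.
rewrite /energy_pt !(zp_io hm) ?zp_sh //.
  congr zp; move: ga gb gc gd; rewrite /par_div /dtilde /par_ok; case E: m => [|q] a0 b0 c0 d0.
    by ring.
  by have [_ qn _] := q_facts hm E; field; rewrite ?a0 ?b0 ?c0 ?d0 ?qn.
move: gb gc gd; rewrite /par_div /par_ok; case E: m => [|q] // b0 c0 d0.
by rewrite !mulf_neq0 ?invr_eq0.
Qed.

Hypothesis nk : forall j, [&& nu j != za, nu j != zb & nu j != zc].

Lemma cfac_racah n i x : m = Racah ->
  newton_ratio T za zb zc zd n i * (et zd (nu i) - et zd (ux x)) =
  (- n%:R + i%:R) * (n%:R + dtilde m l + i%:R) * (- x + i%:R) * (x + pd l + i%:R)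
  / ((pa l + i%:R) * (pb l + i%:R) * (pc l + i%:R) * i.+1%:R).
Proof.
move=> E; rewrite /newton_ratio pE_zp -[in et _ (nu i)]ux_nat -!etaE.
have := nk i; rewrite !nu_zp zp_io; last by rewrite /par_ok E.
rewrite /= /latr /latk /par_div /par_point /eta E expr1n.
rewrite !opprK => /and3P [na nb nc].
have n1 : i.+1%:R != 0 :> C by rewrite pnatr_eq0.
have na' : pa l + i%:R != 0 by rewrite addrC addr_eq0.
have nb' : pb l + i%:R != 0 by rewrite addrC addr_eq0.
have nc' : pc l + i%:R != 0 by rewrite addrC addr_eq0.
move: n1 na' nb' nc'; rewrite -addn1 natrD; move: (i%:R) (n%:R) => y z n1 na' nb' nc'.
by field; rewrite nc' nb' na' n1.
Qed.

Lemma cfac_qracah q n i x : m = qRacah q ->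
  newton_ratio T za zb zc zd n i * (et zd (nu i) - et zd (ux x)) =
  (1 - q%:C ^- n * q%:C ^+ i) * (1 - dtilde m l * q%:C ^+ n * q%:C ^+ i)
   * (1 - qpow q (- x) * q%:C ^+ i) * (1 - pd l * qpow q x * q%:C ^+ i)
   / ((1 - pa l * q%:C ^+ i) * (1 - pb l * q%:C ^+ i) * (1 - pc l * q%:C ^+ i)
     * (1 - q%:C * q%:C ^+ i)) * q%:C.
Proof.
move=> E; have [q0 qn q1] := q_facts hm E.
rewrite /newton_ratio pE_zp -[in et _ (nu i)]ux_nat -!etaE.
have := nk i; have := nu_neq0 T (ltn0Sn i); rewrite !nu_zp zp_io; last by rewrite /par_ok E invr_neq0 // expf_neq0.
rewrite /= /latr /latk /par_div /par_point /eta E invrK.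
have qi : qpow q i%:R = q%:C ^+ i by have := qpow_addn q0 0 i; rewrite add0r qpow0 mul1r.
rewrite !qpowN // qi exprS exprVn.
have x0 := qpow_neq0 q0 x; have y0 : q%:C ^+ i != 0 by rewrite expf_neq0.
have n0 : q%:C ^+ n != 0 by rewrite expf_neq0.
exact: cfac_alg.
Qed.

Lemma pochS (z : C) n : poch z n.+1 = poch z n * (z + n%:R).
Proof. by rewrite /poch big_ord_recr. Qed.

Lemma qpochS (q : R) (z : C) n : qpoch q z n.+1 = qpoch q z n * (1 - z * q%:C ^+ n).
Proof. by rewrite /qpoch big_ord_recr. Qed.

(** The two sums agree term by term: the first terms are 1 and the quotients of consecutive terms
    coincide. *)
Lemma Pcheck_Pn n x : Pcheck m n x l = (racah_poly T za zb zc zd n).[et zd (ux x)].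
Proof.
rewrite /racah_poly horner_sum.
have TE (t : nat -> C) : t 0%N = 1 ->
    (forall i, t i.+1 = t i * (newton_ratio T za zb zc zd n i * (et zd (nu i) - et zd (ux x)))) ->
    \sum_(j < n.+1) t j = \sum_(j < n.+1) (\prod_(i < j) newton_ratio T za zb zc zd n i *: newton_basis T zd j).[et zd (ux x)].
  move=> t0 tS; apply: eq_bigr => j _; rewrite hornerZ /newton_basis horner_prod -big_split /=.
  elim: (nat_of_ord j) => [|i IH]; first by rewrite big_ord0.
  by rewrite tS IH big_ord_recr /= hornerD hornerN hornerC hornerX.
have [E|[q E]] : m = Racah \/ exists q, m = qRacah q by case: (m) => [|q]; [left | right; exists q].
  rewrite {1}E; pose t k := poch (- n%:R) k * poch (n%:R + dtilde m l) k * poch (- x) k * poch (x + pd l) k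
      / (poch (pa l) k * poch (pb l) k * poch (pc l) k * k`!%:R).
  rewrite -(TE t) => [||i].
  - by rewrite /t E.
  - by rewrite /t /poch !big_ord0 !mulr1 divr1.
  by rewrite (cfac_racah n i x E) /t !pochS factS natrM !invfM; ring.
rewrite {1}E; pose t k := qpoch q (q%:C ^- n) k * qpoch q (dtilde m l * q%:C ^+ n) k
   * qpoch q (qpow q (- x)) k * qpoch q (pd l * qpow q x) k
   / (qpoch q (pa l) k * qpoch q (pb l) k * qpoch q (pc l) k * qpoch q q%:C k) * q%:C ^+ k.
rewrite -(TE t) => [||i].
- by rewrite /t E.
- by rewrite /t /qpoch !big_ord0 !mulr1 divr1.
by rewrite (cfac_qracah n i x E) /t !qpochS exprSr !invfM; ring.
Qed.

Let wza : wt za != 0. Proof. exact: wt_zp0. Qed.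
Let wzb : wt zb != 0. Proof. exact: wt_zp0. Qed.
Let wzd : wt zd != 0. Proof. exact: wt_zp0. Qed.

(** The factor F common to [quad_up] and [quad_down] contributes a product independent of j. In the
    q case it is the origin of q ^ (- M x) in r_j, and g is the origin of the power of alpha. *)
Lemma rf_prod M j u (F al be : nat -> C) (g : C) : (j <= M)%N ->
  (forall i, quad_up T za zb (iter i sh u) = F i * al i) ->
  (forall i, quad_down T za zb zd (iter i sh u) = g * (F i * be i)) ->
  gauge_prod T za zb zd M j u =
  g ^+ (M - j) * (\prod_(i < M) F i) * (\prod_(i < j) al i * \prod_(i < M - j) be (i + j)%N).
Proof.
move=> jM H1 H2; rewrite /gauge_prod.
have -> : \prod_(i < j) quad_up T za zb (iter i sh u) = \prod_(i < j) F i * \prod_(i < j) al i.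
  by rewrite -big_split; apply: eq_bigr => i _; apply: H1.
have -> : \prod_(j <= i < M) quad_down T za zb zd (iter i sh u) =
    g ^+ (M - j) * (\prod_(j <= i < M) F i * \prod_(i < M - j) be (i + j)%N).
  transitivity (\prod_(j <= i < M) (g * (F i * be i))).
    by apply: eq_bigr => i _; apply: H2.
  rewrite !big_split /= prodr_const_nat; congr (_ * (_ * _)).
  by rewrite -{1}(add0n j) big_addn big_mkord.
rewrite -(big_mkord xpredT F) -(big_mkord xpredT F) [in RHS](@big_cat_nat _ _ _ j) //=; ring.
Qed.

Lemma rfactor_racah M : m = Racah -> (forall i, quad_down T za zb zd (nu i) != 0) ->
  exists2 x0 : C, x0 != 0 & forall x j, (j <= M)%N ->
  rfactor m M j x l = x0 * gauge_prod T za zb zd M j (ux x).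
Proof.
move=> E am0.
pose al x (i : nat) := (x + pa l + i%:R) * (x + pb l + i%:R).
pose be x (i : nat) := (x + pd l - pa l + 1 + i%:R) * (x + pd l - pb l + 1 + i%:R).
have wtR z : wt z = 1 by rewrite /lwt /= /latr E subrr mul0r addr0.
have apR a1 b1 x i : quad_up T (zp a1) (zp b1) (iter i sh (ux x)) = 1 * ((x + a1 + i%:R) * (x + b1 + i%:R)).
  rewrite -ux_addn /quad_up wtR /par_point /pos_point E divr1; ring.
have H1 x i : quad_up T za zb (iter i sh (ux x)) = 1 * al x i by apply: apR.
have H2 x i : quad_down T za zb zd (iter i sh (ux x)) = 1 * (1 * be x i).
  rewrite am_twist ?wt_shn0 ?wt_ux // -(zp_twist_a hm ga) -(zp_twist_b hm gb) apR.
  by rewrite /twist_scale !wtR /twist E /be /=; field.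
have W0 : \prod_(i < M) be 0 i != 0.
  apply/prodf_neq0 => i _; have := am0 i; have := H2 0 i; rewrite (ux0 m) shn0 => ->.
  by rewrite !mul1r.
have WE : poch (pd l - pa l + 1) M * poch (pd l - pb l + 1) M = \prod_(i < M) be 0 i.
  by rewrite /poch -big_split; apply: eq_bigr => i _; rewrite /be add0r.
exists (\prod_(i < M) be 0 i)^-1; first by rewrite invr_eq0.
move=> x j jM; rewrite (rf_prod jM (H1 x) (H2 x)) {1}E /rfactor WE mulrC; congr (_ * _).
rewrite expr1n mul1r big1 // mul1r /poch -!mulrA -big_split mulrA -big_split /=.
by congr (_ * _); apply: eq_bigr => i _; rewrite /be natrD -addn1 natrD; congr (_ * _); ring.
Qed.

Lemma rfactor_qracah q M : m = qRacah q -> (forall i, quad_down T za zb zd (nu i) != 0) ->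
  exists2 x0 : C, x0 != 0 & forall x j, (j <= M)%N ->
  rfactor m M j x l = x0 * gauge_prod T za zb zd M j (ux x).
Proof.
move=> E am0; have [q0 qn q1] := q_facts hm E.
have [a0 b0 c0 d0] : [/\ pa l != 0, pb l != 0, pc l != 0 & pd l != 0].
  by move: ga gb gc gd; rewrite /par_ok E.
pose g := pa l * pb l * (pd l)^-1 * q%:C^-1.
have g0 : g != 0 by rewrite !mulf_neq0 // invr_eq0.
pose t := q%:C^-1 - 1; have t0 : t != 0 := q1.
pose al x (i : nat) := (1 - pa l * qpow q x * q%:C ^+ i) * (1 - pb l * qpow q x * q%:C ^+ i).
pose be x (i : nat) := (1 - (pa l)^-1 * pd l * qpow q (x + 1) * q%:C ^+ i)
  * (1 - (pb l)^-1 * pd l * qpow q (x + 1) * q%:C ^+ i).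
pose F x (i : nat) := (qpow q x)^-1 * (q%:C ^- i / t ^+ 2).
have apq a1 b1 x i : quad_up T (zp a1) (zp b1) (iter i sh (ux x)) =
    F x i * ((1 - a1 * qpow q x * q%:C ^+ i) * (1 - b1 * qpow q x * q%:C ^+ i)).
  rewrite -ux_addn /quad_up; have -> : wt (ux (x + i%:R)) = (qpow q x * q%:C ^+ i)^-1.
    rewrite /lwt /= /latr /pos_point E mulrC mulfVK // addrC subrK.
    by rewrite qpowN // qpow_addn.
  rewrite /pos_point /par_point E qpowN // qpow_addn // -/t /F.
  by apply: ap_alg => //; [apply: qpow_neq0 | rewrite expf_neq0].
have H1 x i : quad_up T za zb (iter i sh (ux x)) = F x i * al x i by apply: apq.
have H2 x i : quad_down T za zb zd (iter i sh (ux x)) = g * (F x i * be x i).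
  rewrite am_twist ?wt_shn0 ?wt_ux // -(zp_twist_a hm ga) -(zp_twist_b hm gb) apq.
  congr (_ * (_ * _)).
    rewrite /twist_scale zp_hs !(wt_zp_q hm _ E) E /g; field; by rewrite qn d0.
  by rewrite /be qpowS // /twist E /=; congr (_ * _); ring.
have W0 : \prod_(i < M) be 0 i != 0.
  apply/prodf_neq0 => i _; have := am0 i; have := H2 0 i; rewrite (ux0 m) shn0 => ->.
  by apply: contraNneq => ->; rewrite !mulr0.
have WE : qpoch q ((pa l)^-1 * pd l * q%:C) M * qpoch q ((pb l)^-1 * pd l * q%:C) M = \prod_(i < M) be 0 i.
  by rewrite /qpoch -big_split; apply: eq_bigr => i _; rewrite /be add0r qpow1.
pose kp := \prod_(i < M) (q%:C ^- i / t ^+ 2).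
have kp0 : kp != 0.
  by apply/prodf_neq0 => i _; rewrite mulf_neq0 ?invr_eq0 ?expf_neq0.
exists (g ^+ M * kp * \prod_(i < M) be 0 i)^-1.
  by rewrite invr_eq0 !mulf_neq0 // expf_neq0.
move=> x j jM; rewrite (rf_prod jM (H1 x) (H2 x)) {1}E /rfactor WE -/g.
have -> : \prod_(i < M) F x i = (qpow q (M%:R * x))^-1 * kp.
  by rewrite big_split /= prodr_const card_ord qpow_muln // exprVn.
have -> : qpoch q (pa l * qpow q x) j * qpoch q (pb l * qpow q x) j
     * qpoch q ((pa l)^-1 * pd l * qpow q (x + j.+1%:R)) (M - j)
     * qpoch q ((pb l)^-1 * pd l * qpow q (x + j.+1%:R)) (M - j) =
  \prod_(i < j) al x i * \prod_(i < M - j) be x (i + j)%N.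
  rewrite /qpoch -!mulrA -big_split mulrA -big_split /=.
  congr (_ * _); apply: eq_bigr => i _; rewrite /be exprD qpowS // qpow_addn // exprS.
  by congr (_ * _); ring.
have gj : g ^+ M = g ^+ (M - j) * g ^+ j by rewrite -exprD subnK.
have qx := qpow_neq0 q0 (M%:R * x); rewrite gj.
have g1 : g ^+ j != 0 by rewrite expf_neq0.
have g2 : g ^+ (M - j) != 0 by rewrite expf_neq0.
move: (\prod_(i < j) _) (\prod_(i < M - j) _) (g ^+ j) (g ^+ (M - j)) (qpow q (M%:R * x)) kp (\prod_(i < M) be 0 i) g1 g2 qx kp0 W0.
move=> A B x1 x2 x3 x4 x5 n1 n2 n3 n4 n5.
by field; rewrite n1 n2 n3 n4 n5.
Qed.

Lemma rfactor_rf M : (forall i, quad_down T za zb zd (nu i) != 0) ->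
  exists2 x0 : C, x0 != 0 & forall x j, (j <= M)%N ->
  rfactor m M j x l = x0 * gauge_prod T za zb zd M j (ux x).
Proof.
have [E|[q E]] : m = Racah \/ exists q, m = qRacah q by case: (m) => [|q]; [left | right; exists q].
  exact: rfactor_racah.
exact: (@rfactor_qracah q M E).
Qed.
End Matching.

(** * Generic parameters *)

Section Generic.
Variables (R : realType) (m : model R).
Hypothesis hm : model_ok m.
Local Notation C := R[i].
Local Notation T := (lat hm).
Local Notation zp := (par_point m).

(** The sign of n is such that [lshift] adds 1 to n on the corresponding point. *)
Definition par_mono (l : params R) (i j k s n : int) : C :=
  match m with
  | Racah => i%:~R * pa l + j%:~R * pb l + k%:~R * pc l + s%:~R * pd l - n%:~R
  | qRacah q => pa l ^ i * pb l ^ j * pc l ^ k * pd l ^ s * q%:C ^ (- n)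
  end.

(** Independence of a, b, c, d modulo the integers, resp. multiplicatively modulo powers of q. Each
    instance is one polynomial condition, there are countably many, and n = 0 then follows from
    [mono_n]. *)
Definition generic_pars (l : params R) :=
  [/\ par_ok m (pa l), par_ok m (pb l), par_ok m (pc l) & par_ok m (pd l)] /\
  forall i j k s n, par_mono l i j k s n = par_unit m -> [/\ i = 0, j = 0, k = 0 & s = 0].

Local Notation MP := (mpoly.mpoly 4 C).
Definition mvar (k : 'I_4) : MP := mpoly.mpolyX C (mpoly.mnm1 k).
Definition v0 := mvar (@Ordinal 4 0 isT).
Definition v1 := mvar (@Ordinal 4 1 isT).
Definition v2 := mvar (@Ordinal 4 2 isT).
Definition v3 := mvar (@Ordinal 4 3 isT).

Definition pos_part (i : int) : nat := match i with Posz n => n | Negz _ => 0%N end.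
Definition neg_part (i : int) : nat := match i with Posz _ => 0%N | Negz n => n.+1 end.

Lemma ipm i : i = (pos_part i)%:Z - (neg_part i)%:Z.
Proof. by case: i => n /=; [rewrite subr0 | rewrite NegzE sub0r]. Qed.

(** In the q case the factors with negative exponents are moved to the other side, so that the
    condition becomes polynomial. *)
Definition mono_mpoly (i j k s n : int) : MP :=
  match m with
  | Racah => i%:~R * v0 + j%:~R * v1 + k%:~R * v2 + s%:~R * v3 - n%:~R
  | qRacah q => mpoly.mpolyC 4 (q%:C ^ (- n)) * (v0 ^+ pos_part i * v1 ^+ pos_part j * v2 ^+ pos_part k * v3 ^+ pos_part s)
     - v0 ^+ neg_part i * v1 ^+ neg_part j * v2 ^+ neg_part k * v3 ^+ neg_part s
  end.

Lemma mvarE l : [/\ mpoly.meval (coords l) v0 = pa l, mpoly.meval (coords l) v1 = pb l,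
  mpoly.meval (coords l) v2 = pc l & mpoly.meval (coords l) v3 = pd l].
Proof. by split; rewrite /v0 /v1 /v2 /v3 /mvar mpoly.mevalXU. Qed.

Lemma gpolE l i j k s n : mpoly.meval (coords l) (mono_mpoly i j k s n) =
  match m with
  | Racah => i%:~R * pa l + j%:~R * pb l + k%:~R * pc l + s%:~R * pd l - n%:~R
  | qRacah q => q%:C ^ (- n) * (pa l ^+ pos_part i * pb l ^+ pos_part j * pc l ^+ pos_part k * pd l ^+ pos_part s)
     - pa l ^+ neg_part i * pb l ^+ neg_part j * pc l ^+ neg_part k * pd l ^+ neg_part s
  end.
Proof.
have [E0 E1 E2 E3] := mvarE l; rewrite /mono_mpoly; case: (m) => [|q].
  by rewrite rmorphB !rmorphD !rmorphM !rmorph_int /= E0 E1 E2 E3.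
by rewrite rmorphB !rmorphM !rmorphXn /= mpoly.mevalC E0 E1 E2 E3.
Qed.

Lemma gpol_mono l i j k s n : [/\ par_ok m (pa l), par_ok m (pb l), par_ok m (pc l) & par_ok m (pd l)] ->
  par_mono l i j k s n = par_unit m -> mpoly.meval (coords l) (mono_mpoly i j k s n) = 0.
Proof.
rewrite gpolE /par_mono /par_ok /par_unit; case: (m) => [|q] [a0 b0 c0 d0]; first by move->.
have E x z : x != 0 -> x ^ z * x ^+ neg_part z = x ^+ pos_part z :> C.
  by move=> x0; rewrite !exprnP -expfzDr // {1}(ipm z) subrK.
rewrite -!E //; set A := _ ^ i; set B := _ ^ j; set D := _ ^ k; set F := _ ^ s.
move=> H; apply/eqP; rewrite subr_eq0; apply/eqP.
transitivity (A * B * D * F * q%:C ^ (- n) * (pa l ^+ neg_part i * pb l ^+ neg_part j * pc l ^+ neg_part k * pd l ^+ neg_part s)); first by ring.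
by rewrite H mul1r.
Qed.

Lemma q_expz q z : m = qRacah q -> q%:C ^ z = 1 -> z = 0.
Proof.
move=> E; have := hm; rewrite E /= => /andP [q0 q1]; have qn : q%:C != 0 by rewrite fmorph_eq0 gt_eqF.
have P n : q%:C ^+ n.+1 != 1.
  by rewrite -rmorphXn fmorph_eq1 lt_eqF // exprn_ilt1 // ltW.
case: z => [[|n]|n] //.
  by rewrite -exprnP => H; have := P n; rewrite H eqxx.
rewrite NegzE -exprnN => H; have := P n; rewrite -(inj_eq invr_inj) H invr1 eqxx //.
Qed.

Lemma two_expn n : (2 : C) ^+ n.+1 != 1.
Proof. by rewrite gt_eqF // exprn_egt1 // ltr1n. Qed.

Lemma two_ipm z : z != 0 -> (2 : C) ^+ pos_part z != 2 ^+ neg_part z.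
Proof.
by case: z => [[|n]|n] //= _; rewrite expr0 ?two_expn // eq_sym two_expn.
Qed.

Lemma gpol_neq0 i j k s n : ~~ [&& i == 0, j == 0, k == 0 & s == 0] -> mono_mpoly i j k s n != 0.
Proof.
move=> e; suff [l] : exists l, mpoly.meval (coords l) (mono_mpoly i j k s n) != 0.
  by apply: contraNneq => ->; rewrite rmorph0.
(* Sample parameters: v in the first place with a nonzero exponent and u elsewhere. This settles n =
   0; for other n, all parameters equal to the unit will do. *)
pose sel (u v : C) := if i != 0 then Params v u u u else if j != 0 then Params u v u u
  else if k != 0 then Params u u v u else Params u u u v.
have [n0|n0] := eqVneq n 0.
  rewrite n0; have [E|[q E]] : m = Racah \/ exists q, m = qRacah q by case: (m) => [|q]; [left | right; exists q].
    exists (sel 0 1); rewrite gpolE E /sel; move: e.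
    by do 4?[case: eqVneq => [->|?] //=]; rewrite ?mulr0 ?mulr1 ?mul0r ?add0r ?addr0 ?subr0 ?intr_eq0.
  exists (sel 1 2); rewrite gpolE E /sel oppr0 expr0z mul1r; move: e.
  by do 4?[case: eqVneq => [->|?] //=]; rewrite !expr1n ?mulr1 ?mul1r subr_eq0 two_ipm.
have [E|[q E]] : m = Racah \/ exists q, m = qRacah q by case: (m) => [|q]; [left | right; exists q].
  by exists (Params 0 0 0 0); rewrite gpolE E /= !mulr0 !add0r oppr_eq0 intr_eq0.
exists (Params 1 1 1 1); rewrite gpolE E /= !expr1n !mulr1 subr_eq0.
by apply: contraNneq n0 => /(q_expz E) /eqP; rewrite oppr_eq0.
Qed.

Lemma generic_good (P : params R -> Prop) : (forall l, generic_pars l -> P l) -> generically P.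
Proof.
(* The conditions are enumerated through codes of exponent tuples. The product of the variables
   forces nonzero parameters, and 1 is used where there is no condition. *)
move=> H; pose F N : MP := match unpickle N with
  | Some (i, j, k, s, n) =>
     (if [&& i == 0, j == 0, k == 0 & s == 0] then 1 else mono_mpoly i j k s n) * (v0 * v1 * v2 * v3)
  | None => 1 end.
have vn : v0 * v1 * v2 * v3 != 0.
  have [E0 E1 E2 E3] := mvarE (Params 1 1 1 1).
  rewrite !mulf_neq0 //; [move: E0 | move: E1 | move: E2 | move: E3];
    by apply: contra_eq_neq => ->; rewrite rmorph0 eq_sym oner_eq0.
exists F; split => [N|l FN].
  rewrite /F; case: (unpickle N) => [[[[[i j] k] s] n]|]; last exact: oner_neq0.
  by case: ifPn => e; rewrite mulf_neq0 ?oner_neq0 ?gpol_neq0.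
have FE i j k s n : mpoly.meval (coords l)
   ((if [&& i == 0, j == 0, k == 0 & s == 0] then 1 else mono_mpoly i j k s n) * (v0 * v1 * v2 * v3)) != 0.
  by have := FN (pickle (i, j, k, s, n)); rewrite /F pickleK.
apply: H; have [E0 E1 E2 E3] := mvarE l.
have gg : [/\ par_ok m (pa l), par_ok m (pb l), par_ok m (pc l) & par_ok m (pd l)].
  have := FE 0 0 0 0 0; rewrite mul1r !rmorphM /= E0 E1 E2 E3 /par_ok !mulf_eq0 !negb_or.
  by case: (m) => // q /andP [/andP [/andP [-> ->] ->] ->].
split=> // i j k s n M1.
have := FE i j k s n; case: ifPn => [/and4P [/eqP i0 /eqP j0 /eqP k0 /eqP s0] //|e].
by rewrite rmorphM /= (gpol_mono gg M1) mul0r eqxx.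
Qed.

Variable l : params R.
Hypothesis gl : generic_pars l.

Let ga : par_ok m (pa l). Proof. by case: gl => [[]]. Qed.
Let gb : par_ok m (pb l). Proof. by case: gl => [[]]. Qed.
Let gc : par_ok m (pc l). Proof. by case: gl => [[]]. Qed.
Let gd : par_ok m (pd l). Proof. by case: gl => [[]]. Qed.

Definition mono_pt i j k s n := zp (par_mono l i j k s n).

Lemma zp_inj : injective zp.
Proof.
rewrite /par_point => x y; case E: m => [|q]; first exact: oppr_inj.
by have [_ _ q1] := q_facts hm E; move/(divIf q1)/addIr.
Qed.

Lemma gok_mono i j k s n : par_ok m (par_mono l i j k s n).
Proof.
move: ga gb gc gd; rewrite /par_ok /par_mono; case E: m => [|q] // a0 b0 c0 d0.
by have [_ q0 _] := q_facts hm E; rewrite !mulf_neq0 ?expfz_neq0.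
Qed.

Lemma gdiv_mono i j k s n i' j' k' s' n' :
  par_div m (par_mono l i j k s n) (par_mono l i' j' k' s' n') = par_mono l (i - i') (j - j') (k - k') (s - s') (n - n').
Proof.
move: ga gb gc gd; rewrite /par_ok /par_mono /par_div; case E: m => [|q] // a0 b0 c0 d0.
  by rewrite !rmorphB /=; ring.
have [_ q0 _] := q_facts hm E.
have Ez x z z' : x != 0 -> x ^ (z - z') = x ^ z / x ^ z' :> C.
  by move=> x0; rewrite expfzDr // invr_expz.
rewrite opprB [n' - n]addrC -[n']opprK !Ez // opprK !invfM; ring.
Qed.

Lemma mono_pt_io i j k s n i' j' k' s' n' : lrefl T (mono_pt i j k s n) (mono_pt i' j' k' s' n') =
  mono_pt (i - i') (j - j') (k - k') (s - s') (n - n').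
Proof. by rewrite /mono_pt zp_io ?gok_mono // gdiv_mono. Qed.

Lemma mono_pt_sh i j k s n : lshift T (mono_pt i j k s n) = mono_pt i j k s (n + 1).
Proof.
rewrite /mono_pt zp_sh; congr zp; rewrite /par_mono; case E: m => [|q]; first by rewrite rmorphD /=; ring.
have [_ q0 _] := q_facts hm E.
by rewrite opprD expfzDr // exprN1 mulrA.
Qed.

Lemma zp_gz : zp (par_unit m) = 0.
Proof. by rewrite /par_point /par_unit; case: (m) => [|q]; rewrite ?oppr0 // subrr mul0r. Qed.

Lemma mono0 : par_mono l 0 0 0 0 0 = par_unit m.
Proof. by rewrite /par_mono /par_unit; case: (m) => [|q]; rewrite ?oppr0 ?expr0z ?mulr1 // !mul0r !addr0. Qed.

Lemma mono_pt0 : mono_pt 0 0 0 0 0 = 0.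
Proof. by rewrite /mono_pt mono0 zp_gz. Qed.

Lemma mono_pt_wt i j k s n : lwt T (mono_pt i j k s n) != 0.
Proof. by rewrite wt_zp0 // gok_mono. Qed.

Lemma mono_n n : par_mono l 0 0 0 0 n = par_unit m -> n = 0.
Proof.
rewrite /par_mono /par_unit; case E: m => [|q]; rewrite ?expr0z ?mul0r ?mulr1 ?mul1r.
  by rewrite !addr0 sub0r => /eqP; rewrite oppr_eq0 intr_eq0 => /eqP.
by move/(q_expz E)/eqP; rewrite oppr_eq0 => /eqP.
Qed.

Lemma mono_pt_inj i j k s n i' j' k' s' n' : mono_pt i j k s n = mono_pt i' j' k' s' n' ->
  [/\ i = i', j = j', k = k', s = s' & n = n'].
Proof.
move/zp_inj => E; have D : par_mono l (i - i') (j - j') (k - k') (s - s') (n - n') = par_unit m.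
  rewrite -gdiv_mono E; have := gok_mono i' j' k' s' n'; rewrite /par_div /par_unit /par_ok.
  by case: (m) => [|q] h; rewrite ?subrr // divff.
have [_ /(_ _ _ _ _ _ D) [i0 j0 k0 s0]] := gl.
move: D; rewrite i0 j0 k0 s0 => /mono_n n0.
by split; apply/eqP; rewrite -subr_eq0; apply/eqP.
Qed.
End Generic.

(** With V = q ^ v, W = q ^ w and t = q, the last factor is 1 minus a nontrivial monomial in the
    parameters, which generic parameters keep away from 0. *)
Lemma venergy_alg (F : fieldType) (a b c d t V W : F) :
  V != 0 -> W != 0 -> t != 0 -> c != 0 -> d != 0 ->
  - ((1 - c * V) * (1 - c^-1 * (a * b * c * d^-1 * t^-1) * V^-1)) -
  - ((1 - c * W) * (1 - c^-1 * (a * b * c * d^-1 * t^-1) * W^-1)) =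
  c * (V - W) * (1 - a * b * c^-1 * d^-1 * (t * (V * W))^-1).
Proof. by move=> V0 W0 t0 c0 d0; field; rewrite W0 V0 t0 c0 d0. Qed.

Lemma energy_alg (F : fieldType) (a b c d t V N : F) :
  V != 0 -> N != 0 -> t != 0 -> c != 0 -> d != 0 ->
  (N^-1 - 1) * (1 - a * b * c * d^-1 * t^-1 * N) -
  - ((1 - c * V) * (1 - c^-1 * (a * b * c * d^-1 * t^-1) * V^-1)) =
  N^-1 * (1 - c * (V * N)) * (1 - a * b * d^-1 * (N * (t * V)^-1)).
Proof. by move=> V0 numer0 t0 c0 d0; field; rewrite V0 numer0 t0 c0 d0. Qed.

(** * Nonvanishing of the normalization constants *)

Section Nonvanishing.
Variables (R : realType) (m : model R).
Hypothesis hm : model_ok m.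
Local Notation C := R[i].
Variable l : params R.
Hypothesis gl : generic_pars m l.

Lemma mono_neq i j k s n : ~~ [&& i == 0, j == 0, k == 0 & s == 0] -> par_mono m l i j k s n != par_unit m.
Proof.
by apply: contraNneq; case: gl => _ /[apply] -[-> -> -> ->]; rewrite !eqxx.
Qed.

Lemma racah_neq i j k s n : m = Racah -> ~~ [&& i == 0, j == 0, k == 0 & s == 0] ->
  i%:~R * pa l + j%:~R * pb l + k%:~R * pc l + s%:~R * pd l - n%:~R != 0.
Proof. by move=> E /(@mono_neq i j k s n); rewrite /par_mono /par_unit E. Qed.

Lemma qracah_neq q i j k s n : m = qRacah q -> ~~ [&& i == 0, j == 0, k == 0 & s == 0] ->
  1 - pa l ^ i * pb l ^ j * pc l ^ k * pd l ^ s * q%:C ^ n != 0.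
Proof.
move=> E /(@mono_neq i j k s (- n)); rewrite /par_mono /par_unit E opprK => H.
by rewrite subr_eq0 eq_sym.
Qed.

Lemma qracah_pars q : m = qRacah q -> [/\ pa l != 0, pb l != 0, pc l != 0 & pd l != 0].
Proof. by move=> E; case: gl => + _; rewrite /par_ok E. Qed.

Lemma Bprime_neq0 j : Bprime m j%:R l != 0.
Proof.
rewrite /Bprime; case E: m => [|q]; rewrite oppr_eq0.
  have H := fun i j k s n => @racah_neq i j k s n E.
  have F1 : j%:R + pd l - pa l + 1 != 0.
    by have := H (-1) 0 0 1 (- j.+1%:Z) isT; congr (_ != 0); ring.
  have F2 : j%:R + pd l - pb l + 1 != 0.
    by have := H 0 (-1) 0 1 (- j.+1%:Z) isT; congr (_ != 0); ring.
  have F3 : j%:R + pc l != 0 by have := H 0 0 1 0 (- j%:Z) isT; congr (_ != 0); ring.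
  have F4 : j%:R + pd l != 0 by have := H 0 0 0 1 (- j%:Z) isT; congr (_ != 0); ring.
  have F5 : 2 * j%:R + pd l != 0 by have := H 0 0 0 1 (- (j.*2)%:Z) isT; congr (_ != 0); rewrite -addnn; ring.
  have F6 : 2 * j%:R + 1 + pd l != 0 by have := H 0 0 0 1 (- (j.*2.+1)%:Z) isT; congr (_ != 0); rewrite -addnn; ring.
  by rewrite !mulf_neq0 ?invr_eq0 ?mulf_neq0.
have [q0 qn q1] := q_facts hm E.
have H := fun i j k s n => @qracah_neq q i j k s n E.
have qE n : qpow q n%:R = q%:C ^+ n by have := qpow_addn q0 0 n; rewrite add0r qpow0 mul1r.
rewrite -natrM !natr1 !qE.
have F1 : 1 - (pa l)^-1 * pd l * q%:C ^+ j.+1 != 0.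
  by have := H (-1) 0 0 1 j.+1%:Z isT; rewrite exprN1 !expr0z expr1z !mulr1.
have F2 : 1 - (pb l)^-1 * pd l * q%:C ^+ j.+1 != 0.
  by have := H 0 (-1) 0 1 j.+1%:Z isT; rewrite exprN1 !expr0z expr1z !mulr1 mul1r.
have F3 : 1 - pc l * q%:C ^+ j != 0.
  by have := H 0 0 1 0 j%:Z isT; rewrite !expr0z expr1z !mulr1 mul1r.
have F4 n : 1 - pd l * q%:C ^+ n != 0.
  by have := H 0 0 0 1 n%:Z isT; rewrite !expr0z expr1z !mulr1 mul1r.
by rewrite !mulf_neq0 ?invr_eq0 ?mulf_neq0.
Qed.

Lemma alpha_neq0 : alpha m l != 0.
Proof.
rewrite /alpha; case E: m => [|q]; first exact: oner_neq0.
have [_ qn _] := q_facts hm E; have [a0 b0 c0 d0] := qracah_pars E.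
by rewrite !mulf_neq0 ?invr_eq0.
Qed.

Lemma venergy_neq v w : v <> w -> venergy m v l - venergy m w l != 0.
Proof.
move=> vw; rewrite /venergy /dtilde; case E: m => [|q].
  have F : pc l - pa l - pb l + pd l + 1 + v%:R + w%:R != 0.
    by have := @racah_neq (-1) (-1) 1 1 (- (v + w).+1%:Z) E isT; congr (_ != 0); ring.
  have -> : - ((pc l + v%:R) * (pa l + pb l + pc l - pd l - 1 - pc l - v%:R)) -
   - ((pc l + w%:R) * (pa l + pb l + pc l - pd l - 1 - pc l - w%:R)) =
   (v%:R - w%:R) * (pc l - pa l - pb l + pd l + 1 + v%:R + w%:R) by ring.
  by rewrite mulf_neq0 // subr_eq0 eqr_nat; apply/eqP.
have [_ qn _] := q_facts hm E; have [a0 b0 c0 d0] := qracah_pars E.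
have := @qracah_neq q 1 1 (-1) (-1) (- (v + w).+1%:Z) E isT.
rewrite !exprN1 !expr1z -exprnN exprS exprD.
have : q%:C ^+ v != q%:C ^+ w.
  apply/eqP => H; apply: vw; have : v%:Z - w%:Z = 0.
    by apply: (q_expz hm E); rewrite expfzDr // -exprnP H -exprnN divff // expf_neq0.
  by move/eqP; rewrite subr_eq0 => /eqP [].
move=> VW F; rewrite venergy_alg ?expf_neq0 //.
by rewrite !mulf_neq0 // subr_eq0.
Qed.

Lemma energy_venergy n v : energy m n l - venergy m v l != 0.
Proof.
rewrite /energy /venergy /dtilde; case E: m => [|q].
  have F1 : n%:R + pc l + v%:R != 0.
    by have := @racah_neq 0 0 1 0 (- (n + v)%:Z) E isT; congr (_ != 0); ring.
  have F2 : n%:R + pa l + pb l - pd l - 1 - v%:R != 0.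
    by have := @racah_neq 1 1 0 (-1) (v.+1%:Z - n%:Z) E isT; congr (_ != 0); ring.
  set z := (X in X != 0).
  have -> : z = (n%:R + pc l + v%:R) * (n%:R + pa l + pb l - pd l - 1 - v%:R) by rewrite /z; ring.
  by rewrite mulf_neq0.
have [_ qn _] := q_facts hm E; have [a0 b0 c0 d0] := qracah_pars E.
have := @qracah_neq q 0 0 1 0 (v + n)%:Z E isT.
have := @qracah_neq q 1 1 0 (-1) (n%:Z - v.+1%:Z) E isT.
rewrite !exprN1 !expr1z !expr0z expfzDr // -!exprnP -exprnN exprS exprD !mulr1 mul1r.
move=> F1 F2; rewrite energy_alg ?expf_neq0 //.
by rewrite !mulf_neq0 // invr_eq0 expf_neq0.
Qed.
End Nonvanishing.

(** Both sides are windows of one sum over t = j + L, padded with zeros: terms below n vanish by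
    assumption, terms below L stand for negative indices. *)
Lemma sum_window (V : nmodType) (G : nat -> V) n L :
  (forall j, (j + L < n)%N -> G j = 0) ->
  \sum_(j < n + L.+1) G j = \sum_(i < L.*2.+1) (if (L <= n + i)%N then G (n + i - L)%N else 0).
Proof.
move=> G0; pose H t := if (L <= t)%N then G (t - L)%N else 0.
have E1 : \sum_(0 <= t < n + L.*2.+1) H t = \sum_(j < n + L.+1) G j.
  rewrite (@big_cat_nat _ _ _ L) //=; last by lia.
  rewrite big_nat big1 ?add0r => [|t /andP [_ tL]]; last by rewrite /H leqNgt tL.
  rewrite -{1}(add0n L) big_addn.
  have -> : (n + L.*2.+1 - L = n + L.+1)%N by lia.
  by rewrite big_mkord; apply: eq_bigr => t _; rewrite /H leq_addl addnK.
rewrite -E1 (@big_cat_nat _ _ _ n) //=; last by lia.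
rewrite big_nat big1 ?add0r => [|t /andP [_ tn]]; last first.
  by rewrite /H; case: leqP => // Lt; apply: G0; rewrite subnK.
rewrite -{1}(add0n n) big_addn addKn big_mkord; apply: eq_bigr => t _.
by rewrite /H addnC.
Qed.

(** * Identification of [Xi], [PD] and [Imap] *)

Section Identification.
Variables (R : realType) (mo : model R).
Hypothesis hm : model_ok mo.
Local Notation C := R[i].
Local Notation T := (lat hm).
Local Notation wt := (lwt T).
Local Notation sh := (lshift T).
Local Notation et := (leta T).
Local Notation nu := (lnum T).
Local Notation ux := (pos_point mo).
Variable l : params R.
Hypothesis gl : generic_pars mo l.
Local Notation pt := (mono_pt mo l).
Local Notation za := (par_point mo (pa l)).
Local Notation zb := (par_point mo (pb l)).
Local Notation zc := (par_point mo (pc l)).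
Local Notation zd := (par_point mo (pd l)).
Local Notation lv := (level T zd).

Let ga : par_ok mo (pa l). Proof. by case: gl => [[]]. Qed.
Let gb : par_ok mo (pb l). Proof. by case: gl => [[]]. Qed.
Let gc : par_ok mo (pc l). Proof. by case: gl => [[]]. Qed.
Let gd : par_ok mo (pd l). Proof. by case: gl => [[]]. Qed.

Lemma pt_pars : [/\ pt 1 0 0 0 0 = za, pt 0 1 0 0 0 = zb, pt 0 0 1 0 0 = zc & pt 0 0 0 1 0 = zd].
Proof.
by split; congr (par_point mo _); rewrite /par_mono; case: (mo) => [|q];
  rewrite ?expr1z ?expr0z ?mulr1 ?mul1r ?mul0r ?add0r ?addr0 ?subr0.
Qed.

Let psh := mono_pt_sh hm l.
Let pio := mono_pt_io hm gl.
Let pp0 : pt 0 0 0 0 0 = 0 := mono_pt0 mo l.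
Let pwt := mono_pt_wt hm gl.
Let pinj := mono_pt_inj hm gl.

Let nuE n : nu n = pt 0 0 0 0 n%:Z. Proof. exact: (pt_nu psh pp0). Qed.
Let lvE s : lv s = pt 0 0 0 1 (- s%:Z).
Proof. by have [_ _ _ <-] := pt_pars; apply: (pt_lv psh). Qed.

Lemma et_nu_neq s i j : i <> j -> et (lv s) (nu i) != et (lv s) (nu j).
Proof.
move=> ij; rewrite -subr_eq0 et_pt ?wt_nu0 // !nuE lvE pio.
rewrite !mulf_neq0 ?invr_eq0 ?(lk_neq0 T) ?pwt // subr_eq0; apply/eqP => /pinj [] //; lia.
Qed.

(** The coordinate takes distinct values at the natural numbers. This gives the uniqueness of the
    polynomials that [xget] selects. *)
Lemma poly_nu_eq s (p p' : {poly C}) : (forall n, p.[et (lv s) (nu n)] = p'.[et (lv s) (nu n)]) -> p = p'.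
Proof.
move=> H; apply/eqP; rewrite -subr_eq0; apply/negPn/negP => d0.
have [A B] : all (root (p - p')) [seq et (lv s) (nu i) | i <- iota 0 (size (p - p')%R)] /\
    uniq [seq et (lv s) (nu i) | i <- iota 0 (size (p - p')%R)].
  split; first by apply/allP => _ /mapP [i _ ->]; rewrite /root hornerD hornerN H subrr.
  rewrite map_inj_uniq ?iota_uniq // => i j E; apply/eqP/negPn/negP => /eqP ij.
  by have := et_nu_neq s ij; rewrite E eqxx.
by have := max_poly_roots d0 A B; rewrite size_map size_iota ltnn.
Qed.

Lemma eta_shift x s : eta mo x (shift mo l s%:Z) = et (lv s) (ux x).
Proof. by rewrite (etaE hm) (zp_shift hm). Qed.

Lemma varphi_phi N : exists2 x0 : C, x0 != 0 & forall x, varphi mo N x l = x0 * eta_diffs T zd N (ux x).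
Proof.
exists (\prod_(k < N) \prod_(j < N | (j < k)%N) (eta mo (k - j)%:R l)^-1).
  apply/prodf_neq0 => k _; apply/prodf_neq0 => j jk; rewrite invr_eq0 (etaE hm) ux_nat.
  have := @et_nu_neq 0 (k - j)%N 0; rewrite nu0 /= => H.
  have -> : 0 = et zd 0 by rewrite /leta !mul0r mulr0 mul0r.
  by apply: H; move: jk; lia.
move=> x; rewrite /varphi /eta_diffs -big_split /=; apply: eq_bigr => k _.
rewrite -big_split /=; apply: eq_bigr => j _.
by rewrite !(etaE hm) !(ux_addn hm) mulrC.
Qed.

Lemma phi_nu_neq0 N n : eta_diffs T zd N (nu n) != 0.
Proof.
apply/prodf_neq0 => k _; apply/prodf_neq0 => j jk.
rewrite -!(shn0 T) -!iterD !shn0 subr_eq0; apply: (et_nu_neq 0); move: jk; lia.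
Qed.

Lemma varphi_nat_neq0 N n : varphi mo N n%:R l != 0.
Proof. by have [x0 x0n ->] := varphi_phi N; rewrite mulf_neq0 // (ux_nat hm) phi_nu_neq0. Qed.

Variable m : nat.
Local Notation M := m.+1.
(** Existence comes from [Dop_surj], and the selected polynomial is then identified with that
    solution. *)
Lemma ImapP (p : {poly C}) : p != 0 ->
  let X := Imap mo (shift mo l M%:Z) p in
  size X = (size p).+1 /\ forall y, wt y != 0 ->
    X.[et (lv M) (sh y)] - X.[et (lv M) y] = lk T * lwidth T (lv M.+1) y * p.[et (lv m) (sh y)].
Proof.
move=> p0 X; have wl : wt (lv M) != 0 by rewrite lvE pwt.
(* The right-hand side is given in the level m coordinate at sh y, which is this affine function of
   the level M + 1 coordinate at y. *)
pose aff : {poly C} := lr T *: 'X + (et (lv m) 1)%:P.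
have sa : size aff = 2.
  rewrite /aff size_polyDl size_scale ?(lr_neq0 T) // size_polyX //.
  by rewrite (leq_ltn_trans (size_polyC_leq1 _)).
have sp : size (p \Po aff) = size p by rewrite size_comp_poly2.
have pa0 : p \Po aff != 0 by rewrite -size_poly_gt0 sp size_poly_gt0.
have affE y : wt y != 0 -> (p \Po aff).[et (lv M.+1) y] = p.[et (lv m) (sh y)].
  by move=> wy; rewrite horner_comp /aff !horner_simpl et_shE.
have [P [P0 sP PE]] := Dop_surj wl pa0.
have uxm x : ux x = sh (ux (x - 1)) by rewrite -(uxS hm) subrK.
have eqx x : eta mo x (shift mo l M%:Z) = et (lv M) (sh (ux (x - 1))) by rewrite eta_shift uxm.
have ex1 x : eta mo (x - 1) (shift mo l M%:Z) = et (lv M) (ux (x - 1)) by rewrite eta_shift.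
have em x : eta mo x (shift mo (shift mo l M%:Z) (- 1)) = et (lv m) (sh (ux (x - 1))).
  by rewrite (etaE hm) (zp_shiftN hm) (zp_shift hm) -uxm hsK.
have dE y : wt y != 0 -> et (lv M) (sh y) - et (lv M) y = lk T * lwidth T (lv M.+1) y.
  by move=> wy; rewrite et_diff.
have PP : [/\ P.[0] = 0, size P = (size p).+1 &
    forall x : C, eta mo x (shift mo l M%:Z) - eta mo (x - 1) (shift mo l M%:Z) != 0 ->
      (P.[eta mo x (shift mo l M%:Z)] - P.[eta mo (x - 1) (shift mo l M%:Z)]) /
       (eta mo x (shift mo l M%:Z) - eta mo (x - 1) (shift mo l M%:Z))
      = p.[eta mo x (shift mo (shift mo l M%:Z) (- 1))]].
  split=> // [|x]; first by rewrite sP sp.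
  rewrite eqx ex1 em; have wy := wt_ux hm (x - 1) => d0.
  by rewrite PE // -affE // -dE // mulrC mulKf.
have [X0 sX XE] := @xgetPex _ (0 : {poly C}) [set P : {poly C} |
    [/\ P.[0] = 0, size P = (size p).+1 &
        forall x : C, eta mo x (shift mo l M%:Z) - eta mo (x - 1) (shift mo l M%:Z) != 0 ->
          (P.[eta mo x (shift mo l M%:Z)] - P.[eta mo (x - 1) (shift mo l M%:Z)]) /
           (eta mo x (shift mo l M%:Z) - eta mo (x - 1) (shift mo l M%:Z))
          = p.[eta mo x (shift mo (shift mo l M%:Z) (- 1))]]]%classic (ex_intro _ P PP).
rewrite -/(Imap mo (shift mo l M%:Z) p) -/X in X0 sX XE.
have <- : P = X; last first.
  by split=> [|y wy]; [rewrite sP sp | rewrite PE // affE].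
(* Uniqueness by induction along x = 0, 1, 2, ...: the values at 0 agree and the increments
   agree. *)
have [_ _ PX] := PP; apply: (poly_nu_eq (s := M)); elim=> [|n IH].
  by rewrite nu0 /leta !mul0r mulr0 mul0r P0 X0.
have dn : eta mo n.+1%:R (shift mo l M%:Z) - eta mo (n.+1%:R - 1) (shift mo l M%:Z) != 0.
  rewrite -natr1 addrK natr1 !eta_shift !(ux_nat hm) subr_eq0; apply: et_nu_neq; lia.
have := XE _ dn; rewrite -(PX _ dn) => /(divIf dn).
by rewrite -natr1 addrK natr1 !eta_shift !(ux_nat hm) IH => /addIr.
Qed.
Variable D : M.-tuple nat.
Hypothesis hD : sorted ltn D.

Lemma tnthD_lt (j k : 'I_M) : (j < k)%N -> (tnth D j < tnth D k)%N.
Proof.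
move=> jk; rewrite !(tnth_nth 0%N); apply: (sorted_ltn_nth ltn_trans) => //.
  by rewrite inE size_tuple.
by rewrite inE size_tuple.
Qed.

Lemma CD_neq0 : CD mo D l != 0.
Proof.
rewrite mulf_neq0 ?invr_eq0 ?(varphi_nat_neq0 M 0) //.
apply/prodf_neq0 => k _; apply/prodf_neq0 => j jk.
rewrite mulf_neq0 ?invr_eq0 ?mulf_neq0 ?(alpha_neq0 hm gl) ?(Bprime_neq0 hm gl) //.
by apply: (venergy_neq hm gl); have := tnthD_lt jk; lia.
Qed.

Lemma CDn_neq0 n : CDn mo D n l != 0.
Proof.
have v0 N : varphi mo N 0 l != 0 := varphi_nat_neq0 N 0.
rewrite /CDn; apply: mulf_neq0.
  apply: mulf_neq0; first by apply: mulf_neq0; [rewrite signr_eq0 | exact: CD_neq0].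
  by rewrite mulf_neq0 ?invr_eq0 ?v0.
apply/prodf_neq0 => j _.
by rewrite mulf_neq0 ?invr_eq0 ?mulf_neq0 ?(alpha_neq0 hm gl) ?(Bprime_neq0 hm gl) ?(energy_venergy hm gl).
Qed.

Local Notation dg := (nth 0%N D).
Local Notation fp := (seed_poly T pt dg).
Local Notation pp := (main_poly T pt).

Let nk j : [&& nu j != za, nu j != zb & nu j != zc].
Proof.
have [<- <- <- _] := pt_pars; rewrite nuE.
by apply/and3P; split; apply/eqP => /pinj [].
Qed.

Lemma PcheckE n x : Pcheck mo n x l = (pp n).[et zd (ux x)].
Proof.
rewrite (Pcheck_Pn ga gb gc gd nk) /main_poly.
by have [-> -> -> ->] := pt_pars.
Qed.

Lemma xicheckE j x : xicheck mo (dg j) x l = (fp j).[et zd (ux x)].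
Proof.
have tc : pc (twist mo l) = pc l by case: (mo).
have td : pd (twist mo l) = pd l by case: (mo).
have gt : [/\ par_ok mo (pa (twist mo l)), par_ok mo (pb (twist mo l)), par_ok mo (pc (twist mo l)) & par_ok mo (pd (twist mo l))].
  rewrite tc td; split=> //; move: ga gb gd; rewrite /par_ok /twist; case E: mo => [|q] //= a0 b0 d0;
    by have [_ qn _] := q_facts hm E; rewrite !mulf_neq0 ?invr_eq0.
have [g1 g2 g3 g4] := gt.
have [pa1 pb1 pc1 pd1] := pt_pars.
have nk' i : [&& nu i != par_point mo (pa (twist mo l)), nu i != par_point mo (pb (twist mo l)) & nu i != par_point mo (pc (twist mo l))].
  rewrite (zp_twist_a hm ga) (zp_twist_b hm gb) tc -pa1 -pb1 -pc1 -pd1 nuE.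
  rewrite (pt_tw_a psh pio) (pt_tw_b psh pio).
  by apply/and3P; split; apply/eqP => /pinj [].
rewrite /xicheck (Pcheck_Pn g1 g2 g3 g4 nk') /seed_poly pa1 pb1 pc1 pd1.
by rewrite (zp_twist_a hm ga) (zp_twist_b hm gb) tc td.
Qed.

Lemma rfactorE : exists2 x0 : C, x0 != 0 & forall x j, (j <= M)%N ->
  rfactor mo M j x l = x0 * gauge_prod T za zb zd M j (ux x).
Proof.
apply: (@rfactor_rf _ _ hm l ga gb gc gd M) => i.
have [pa1 pb1 pc1 pd1] := pt_pars; rewrite -pa1 -pb1 -pd1.
apply/eqP => /(am_zero pwt); rewrite wt_nu0 => /(_ isT); rewrite (pt_tw_a psh pio) (pt_tw_b psh pio) nuE.
by case=> /pinj [].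
Qed.

Lemma Xi_scale (XA : {poly C}) :
  eq_valid T (casoratian T za zb zd M (plain_col fp)) (fun u => eta_diffs T zd M u * XA.[et (lv m) u]) ->
  exists2 x0 : C, x0 != 0 & Xi mo D l = x0 *: XA.
Proof.
move=> XAE; have [v0 v0n vE] := varphi_phi M.
pose x0 := (CD mo D l)^-1 * v0^-1.
have x0n : x0 != 0 by rewrite mulf_neq0 ?invr_eq0 ?CD_neq0.
have H x : varphi mo M x l != 0 ->
    (x0 *: XA).[eta mo x (shift mo l (M%:Z - 1))] = Xi_det mo D x l.
  move=> vn; have -> : M%:Z - 1 = m%:Z by lia.
  have pn : eta_diffs T zd M (ux x) != 0.
    by apply: contraNneq vn => p0; rewrite vE p0 mulr0.
  rewrite eta_shift hornerZ /Xi_det.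
  have -> : \det (\matrix_(j < M, k < M) xicheck mo (tnth D k) (x + j%:R) l) = casoratian T za zb zd M (plain_col fp) (ux x).
    congr (\det _); apply/matrixP => j k; rewrite !mxE (tnth_nth 0%N) xicheckE (ux_addn hm).
    by rewrite /casorati_entry /plain_col mul1r.
  rewrite XAE ?(wt_ux hm) // vE /x0; field.
  by rewrite pn v0n CD_neq0.
exists x0 => //; apply: (poly_nu_eq (s := m)) => n.
rewrite -(ux_nat hm) -!eta_shift; have -> : m%:Z = M%:Z - 1 by lia.
rewrite H ?varphi_nat_neq0 //.
have := @xgetPex _ (0 : {poly C}) [set p : {poly C} | forall x : C, varphi mo M x l != 0 ->
            p.[eta mo x (shift mo l (M%:Z - 1))] = Xi_det mo D x l]%classic.
by move=> -> //; [exists (x0 *: XA) | apply: varphi_nat_neq0].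
Qed.

Lemma PD_scale (n : nat) (g : {poly C}) :
  eq_valid T (casoratian T za zb zd M.+1 (last_gauge_col m fp (pp n))) (fun u => eta_diffs T zd M.+1 u * g.[et (lv M) u]) ->
  exists2 x0 : C, x0 != 0 & PD mo D n l = x0 *: g.
Proof.
move=> gE; have [v0 v0n vE] := varphi_phi M.+1; have [r0 r0n rE] := rfactorE.
pose x0 := (CDn mo D n l)^-1 * v0^-1 * r0.
have x0n : x0 != 0 by rewrite !mulf_neq0 ?invr_eq0 ?CDn_neq0.
have H x : varphi mo M.+1 x l != 0 ->
    (x0 *: g).[eta mo x (shift mo l M%:Z)] = PD_det mo D n x l.
  move=> vn.
  have pn : eta_diffs T zd M.+1 (ux x) != 0.
    by apply: contraNneq vn => p0; rewrite vE p0 mulr0.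
  rewrite eta_shift hornerZ /PD_det.
  set dt := (X in _ = _ * X).
  have -> : dt = r0 * casoratian T za zb zd M.+1 (last_gauge_col m fp (pp n)) (ux x).
    have S := @det_last_scale C M.+1 (fun s t => if (t < M)%N then (fp t).[et zd (iter s sh (ux x))]
      else rfactor mo M s x l * (pp n).[et zd (iter s sh (ux x))])
      (fun s t => casorati_entry T za zb zd M (last_gauge_col m fp (pp n) t) s (ux x)) r0 M.
    rewrite /casoratian /= -[X in X * _]expr1 -[X in _ ^+ X](subSnn M) -S //.
      congr (\det _); apply/matrixP => s t; rewrite !mxE -(ux_addn hm).
      case: unliftP => [k ->|->]; last by rewrite /= ltnn PcheckE.
      by rewrite lift_max ltn_ord (tnth_nth 0%N) xicheckE.
    move=> s t sM tM; rewrite /casorati_entry /last_gauge_col; case: ltnP => tM' /=; first by rewrite mul1r mulr1.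
    by rewrite rE //; ring.
  rewrite gE ?(wt_ux hm) // vE /x0; field.
  by rewrite pn v0n CDn_neq0.
exists x0 => //; apply: (poly_nu_eq (s := M)) => k.
rewrite -(ux_nat hm) -!eta_shift H ?varphi_nat_neq0 //.
have := @xgetPex _ (0 : {poly C}) [set p : {poly C} | forall x : C, varphi mo M.+1 x l != 0 ->
            p.[eta mo x (shift mo l M%:Z)] = PD_det mo D n x l]%classic.
by move=> -> //; [exists (x0 *: g) | apply: varphi_nat_neq0].
Qed.

End Identification.

(** * The recurrence relations for generic parameters *)

Lemma recurrence_good (R : realType) (mo : model R) (hm : model_ok mo)
    (m : nat) (D : m.+1.-tuple nat) (hD : sorted ltn D) (l : params R) (gl : generic_pars mo l)
    (Y : {poly R[i]}) : Y != 0 ->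
    let X := Imap mo (shift mo l m.+1%:Z) (Xi mo D l * Y) in
    let L := (size X).-1 in
    L = (ellD D + (size Y).-1 + 1)%N /\
    exists r : nat -> int -> R[i], forall (n : nat) (z : R[i]),
      X.[z] * (PD mo D n l).[z] =
      \sum_(i < L.*2.+1) r n (i%:Z - L%:Z) * (PDz mo D (n%:Z + (i%:Z - L%:Z)) l).[z].
Proof.
move=> Y0 X L.
have dg_lt i j : (i < j < m.+1)%N -> (nth 0%N D i < nth 0%N D j)%N.
  move=> /andP [ij jM]; apply: (sorted_ltn_nth ltn_trans) => //; rewrite inE size_tuple //.
  exact: ltn_trans jM.
have [XA [gh [lA [lE sX sg XAE [ghE rec]]]]] :=
  uniform_recurrence (mono_pt_sh hm l) (mono_pt_io hm gl) (mono_pt0 mo l) (mono_pt_wt hm gl) (mono_pt_inj hm gl) dg_lt.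
have [pa1 pb1 pc1 pd1] := pt_pars mo l.
rewrite pa1 pb1 pd1 in XAE ghE rec.
have [x0 x0n XiE] := Xi_scale gl hD XAE.
have /boolp.choice [cp cpP] : forall n, exists x : R[i], x != 0 /\ PD mo D n l = x *: gh n.
  by move=> n; have [x] := PD_scale gl hD (ghE n); exists x.
have sXi : size (Xi mo D l) = lA.+1 by rewrite XiE size_scale.
have Xi0 : Xi mo D l != 0 by rewrite -size_poly_gt0 sXi.
have p0 : Xi mo D l * Y != 0 by rewrite mulf_neq0.
have [sXX XX] := @ImapP _ _ hm _ gl m _ p0; rewrite -/X in sXX XX.
have LE : L = (lA + size Y)%N.
  by rewrite /L sXX /= size_mul // sXi.
split.
  have s0 : (0 < size Y)%N by rewrite size_poly_gt0.
  have -> : ellD D = lA.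
    rewrite /ellD; have -> : \sum_(j < m.+1) tnth D j = (lA + 'C(m.+1, 2))%N.
      by rewrite lE; apply: eq_bigr => j _; rewrite (tnth_nth 0%N).
    by rewrite addnK.
  by rewrite LE; lia.
have XEqX : diff_divisible (lat hm) (par_point mo (pd l)) m XA X (x0 *: Y).
  by move=> y wy; rewrite XX // XiE hornerM !hornerZ; ring.
have /boolp.choice [xc xcP] : forall n, exists x : nat -> R[i],
    X * gh n = \sum_(j < n + size X) x j *: gh j /\
    forall j, (j + (size X).-1 < n)%N -> x j = 0.
  by move=> n; apply: rec XEqX.
have sXL : size X = L.+1 by rewrite /L sXX.
(* The factor cp n / cp j passes from the Casoratian quotients to the normalized polynomials. *)
pose y n j := cp n * xc n j / cp j.
exists (fun n k => if n%:Z + k is Posz j then y n j else 0) => n z.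
have G0 j : (j + L < n)%N -> y n j * (PD mo D j l).[z] = 0.
  by move=> jL; have [_ H] := xcP n; rewrite /y H // mulr0 !mul0r.
have -> : X.[z] * (PD mo D n l).[z] = \sum_(j < n + L.+1) y n j * (PD mo D j l).[z].
  have [xE _] := xcP n; have [_ ->] := cpP n; rewrite hornerZ mulrCA -hornerM xE sXL.
  rewrite horner_sum mulr_sumr; apply: eq_bigr => j _.
  by have [cj ->] := cpP j; rewrite !hornerZ /y; field.
rewrite (@sum_window _ (fun j => y n j * (PD mo D j l).[z]) n L G0); apply: eq_bigr => i _.
case: leqP => Li.
  by have -> : n%:Z + (i%:Z - L%:Z) = Posz (n + i - L)%N by lia.
have -> : n%:Z + (i%:Z - L%:Z) = Negz (L - (n + i)).-1 by lia.
by rewrite mul0r.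
Qed.

Theorem theorem2 (R : realType) (m : model R) (hm : model_ok m)
    (M : nat) (hM : (1 <= M)%N)
    (D : M.-tuple nat) (hDincr : sorted ltn D) (hDpos : all (ltn 0%N) D)
    (hA : hypA m D) :
  generically (fun l : params R =>
    forall Y : {poly R[i]}, Y != 0 ->
    let X := Imap m (shift m l M%:Z) (Xi m D l * Y) in
    let L := (size X).-1 in
    L = (ellD D + (size Y).-1 + 1)%N /\
    exists r : nat -> int -> R[i],
      (forall (n : nat) (z : R[i]),
         X.[z] * (PD m D n l).[z] =
         \sum_(i < L.*2.+1)
            r n (i%:Z - L%:Z) * (PDz m D (n%:Z + (i%:Z - L%:Z)) l).[z]) /\
      (forall (n : nat) (x : R[i]),
         X.[eta m x (shift m l M%:Z)] * PDcheck m D n x l =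
         \sum_(i < L.*2.+1)
            r n (i%:Z - L%:Z) * PDcheck m D (n%:Z + (i%:Z - L%:Z)) x l)).
Proof.
clear hA hDpos; apply: (generic_good hm) => l gl Y Y0.
case: M hM D hDincr => [//|M] _ D hD.
have [LE [r rE]] := recurrence_good hm hD gl Y0.
split=> //; exists r; split=> // n x; exact: rE.
Qed.
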